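(* Let $m>1$ and assume $W$ is not $H$-stable. Then there exists a parameter value $0<\beta_c\le\beta_\sharp^m$, where $$\beta_\sharp^m:=-\frac{m\,\rho_\infty^{m-3/2}}{\displaystyle\min_{k\in\mathbb N^d,\,k\ne0}\frac{\hat W(k)}{\Theta(k)}},$$ such that $\beta_c$ is a transition point of $\mathcal F_\beta^m$. Thus, $W$ not being $H$-stable is a necessary and sufficient condition for the existence of a transition point of $\mathcal F_\beta^m$.
   Context: $\Omega=\mathbb T^d$ is the torus of side length $L>0$, $\rho_\infty:=L^{-d}=|\Omega|^{-1}$; $\mathcal P(\Omega)$ is the set of Borel probability measures on $\Omega$, identified with their densities when these exist. $W\in C^2(\Omega)$ is even along every coordinate and has mean zero. For $m>1$, $$\mathcal F_\beta^m(\rho)=\frac{\beta^{-1}}{m-1}\int_\Omega\rho^m\,dx-\frac{\beta^{-1}}{m-1}+\frac12\iint_{\Omega\times\Omega}W(x-y)\rho(x)\rho(y)\,dx\,dy$$ whenever these quantities are finite, and $+\infty$ otherwise; ''minimiser'' means minimiser over $\mathcal P(\Omega)$. Fourier conventions ($\mathbb N\ni0$): for $k\in\mathbb Z^d$, $e_k(x)=N_k\prod_{i=1}^d e_{k_i}(x_i)$ with $e_{k_i}(x_i)=\cos(2\pi k_ix_i/L)$ if $k_i>0$, $1$ if $k_i=0$, $\sin(2\pi k_ix_i/L)$ if $k_i<0$; $N_k=L^{-d/2}\Theta(k)$, $\Theta(k)=\prod_{i=1}^d(2-\delta_{k_i,0})^{1/2}$; $\hat W(k)=\langle W,e_k\rangle_{L^2(\Omega)}$.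 $W$ is $H$-stable if $\hat W(k)\ge0$ for all $k\in\mathbb Z^d\setminus\{0\}$. Transition point: $\beta_c>0$ is a transition point of $\mathcal F_\beta^m$ if (1) for $\beta<\beta_c$, $\rho_\infty$ is the unique minimiser of $\mathcal F_\beta^m$; (2) at $\beta=\beta_c$, $\rho_\infty$ is a minimiser; (3) for every $\beta>\beta_c$ there exists a minimiser $\rho_\beta\neq\rho_\infty$ of $\mathcal F_\beta^m$. *)

(* Defs.v *)
From HB Require Import structures.
From mathcomp Require Import all_boot all_order all_algebra.
From mathcomp Require Import all_classical all_reals all_analysis.
From mathcomp Require Import giry.

Set Implicit Arguments.
Unset Strict Implicit.
Unset Printing Implicit Defensive.

Import Order.TTheory GRing.Theory Num.Theory.
Import numFieldNormedType.Exports.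

Local Open Scope classical_set_scope.
Local Open Scope ring_scope.

(* The torus of side length L is represented by the fundamental domain
   [0, L[^d of R^d / L Z^d: the quotient map restricted to that domain is a
   Borel isomorphism, so a Borel probability measure on the torus is a Borel
   probability measure on R^d giving mass 1 to [0, L[^d, and a function on the
   torus is a function on R^d that is L-periodic in every coordinate.
   Measures live on d-tuples of reals (product sigma-algebra), derivatives are
   taken on 'rV[R]_d (normed space), and [vec] identifies the two. *)

Notation points R d := (d.-tuple (measurableTypeR R)).

Definition vec (R : realType) (d : nat) (x : points R d) : 'rV[R]_d :=
  \row_i tnth x i.

Definition torus (R : realType) (L : {posnum R}) (d : nat) :
    set (points R d) :=
  [set x | forall i, 0 <= (tnth x i : R) < L%:num].
Arguments torus {R} L d.

Section torus_measure.
Context {R : realType}.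
Local Open Scope ereal_scope.

Definition circle_measure (L : {posnum R}) :
    set (measurableTypeR R) -> \bar R :=
  mrestr (@lebesgue_measure R) (measurable_itv `[0%R, L%:num[).

HB.instance Definition _ (L : {posnum R}) := Measure.on (circle_measure L).

Lemma circle_measureT (L : {posnum R}) :
  circle_measure L [set: measurableTypeR R] = L%:num%:E.
Proof.
rewrite /circle_measure /mrestr setTI lebesgue_measure_itv/= lte_fin.
by rewrite gt0 oppr0 adde0.
Qed.

Lemma circle_measure_fin (L : {posnum R}) : fin_num_fun (circle_measure L).
Proof.
by apply: lty_fin_num_fun; have := circle_measureT L => /= ->; rewrite ltry.
Qed.

HB.instance Definition _ (L : {posnum R}) :=
  @Measure_isFinite.Build _ _ _ (circle_measure L) (@circle_measure_fin L).

Section tuple_measure_step.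
Context (mu : {finite_measure set (measurableTypeR R) -> \bar R}) (n : nat).
Context (nu : {finite_measure set (points R n) -> \bar R}).

Definition cons_pair (p : measurableTypeR R * points R n) : points R n.+1 :=
  [tuple of p.1 :: p.2].

Lemma measurable_cons_pair : measurable_fun setT cons_pair.
Proof.
by apply: measurable_cons; [exact: measurable_fst|exact: measurable_snd].
Qed.

Definition prod_tuple_measure : set (points R n.+1) -> \bar R :=
  pushforward (mu \x nu) cons_pair.

Let prod_tuple_measure0 : prod_tuple_measure set0 = 0.
Proof. by rewrite /prod_tuple_measure /pushforward preimage_set0 measure0. Qed.

Let prod_tuple_measure_ge0 A : 0 <= prod_tuple_measure A.
Proof. by rewrite /prod_tuple_measure /pushforward measure_ge0. Qed.

Let prod_tuple_measure_sigma_additive : semi_sigma_additive prod_tuple_measure.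
Proof.
by apply: measure_semi_sigma_additive; exact: measurable_cons_pair.
Qed.

HB.instance Definition _ := isMeasure.Build _ _ _ prod_tuple_measure
  prod_tuple_measure0 prod_tuple_measure_ge0 prod_tuple_measure_sigma_additive.

Lemma prod_tuple_measureT :
  prod_tuple_measure setT = mu [set: measurableTypeR R] * nu setT.
Proof.
by rewrite /prod_tuple_measure /pushforward preimage_setT -setXTT
  product_measure1E.
Qed.

Lemma prod_tuple_measure_fin : fin_num_fun prod_tuple_measure.
Proof.
apply: lty_fin_num_fun; rewrite [ltLHS]prod_tuple_measureT.
by rewrite ltey_eq fin_numM ?fin_num_measure.
Qed.

HB.instance Definition _ :=
  @Measure_isFinite.Build _ _ _ prod_tuple_measure prod_tuple_measure_fin.

End tuple_measure_step.

(* The d-fold product of Lebesgue measure on [0, L[. *)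
Fixpoint torus_measure (L : {posnum R}) (d : nat) :
    {finite_measure set (points R d) -> \bar R} :=
  match d with
  | 0%N => dirac [tuple]
  | n.+1 => prod_tuple_measure (circle_measure L) (torus_measure L n)
  end.

Lemma torus_measureT (L : {posnum R}) (d : nat) :
  torus_measure L d setT = (L%:num ^+ d)%:E.
Proof.
elim: d => [|d IH] /=; first by rewrite diracT expr0.
rewrite [LHS]prod_tuple_measureT [X in X * _]circle_measureT.
by rewrite [X in _ * X]IH exprS EFinM.
Qed.

End torus_measure.

Section potential.
Context {R : realType} (d : nat).
Implicit Types W : 'rV[R]_d -> R.

Definition torus_periodic (L : {posnum R}) W :=
  forall (i : 'I_d) (x : 'rV[R]_d), W (x + L%:num *: delta_mx 0 i) = W x.

Definition coordinatewise_even W :=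
  forall (i : 'I_d) (x : 'rV[R]_d),
    W (\row_j (if j == i then - x 0 j else x 0 j)) = W x.

Fixpoint continuously_differentiable (n : nat) W : Prop :=
  continuous W /\
  (if n is n'.+1 then
     forall i : 'I_d, (forall x, derivable W x (delta_mx 0 i)) /\
       continuously_differentiable n' ('D_(delta_mx 0 i) W)
   else True).

Definition mean_zero (L : {posnum R}) W :=
  \int[torus_measure L d]_x W (vec x) = 0.

End potential.

Section fourier.
Context {R : realType} (L : {posnum R}) (d : nat).
Implicit Types (k : 'rV[int]_d) (W : 'rV[R]_d -> R).

Definition fourier_basis1 (n : int) (t : R) : R :=
  if 0 < n then cos (2 * pi * n%:~R * t / L%:num)
  else if n == 0 then 1
  else sin (2 * pi * n%:~R * t / L%:num).

Definition Theta k : R := \prod_i Num.sqrt (2 - (k 0 i == 0)%:R).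

Definition fourier_basis k (x : 'rV[R]_d) : R :=
  (L%:num `^ (- (d%:R / 2)) * Theta k) * \prod_i fourier_basis1 (k 0 i) (x 0 i).

Definition fourier_coeff W k : R :=
  \int[torus_measure L d]_x (W (vec x) * fourier_basis k (vec x)).

Definition H_stable W := forall k, k != 0 -> 0 <= fourier_coeff W k.

Definition fourier_ratios W : set R :=
  [set fourier_coeff W k / Theta k |
     k in [set k : 'rV[int]_d | (forall i, 0 <= k 0 i) /\ k != 0]].

End fourier.

Section free_energy.
Context {R : realType} (L : {posnum R}) (d : nat).
Implicit Types (W : 'rV[R]_d -> R) (mu nu : probability (points R d) R).

Definition rho_infty : R := (L%:num ^+ d)^-1.

Definition uniform_measure : set (points R d) -> \bar R :=
  mscale ((L%:num ^+ d)^-1)%:nng (torus_measure L d).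

HB.instance Definition _ := Measure.on uniform_measure.

Lemma uniform_measureT : uniform_measure setT = 1%E.
Proof.
by rewrite /uniform_measure /mscale /= torus_measureT -EFinM mulVf.
Qed.

HB.instance Definition _ :=
  Measure_isProbability.Build _ _ _ uniform_measure uniform_measureT.

(* The Radon-Nikodym derivative of the library is only a.e. nonnegative, and is
   a default value when mu is not absolutely continuous; both are harmless in
   free_energy. *)
Definition density mu (x : points R d) : R :=
  fine (Radon_Nikodym (charge_of_finite_measure mu) (torus_measure L d) x).

Definition free_energy (m : R) W (beta : R) mu : \bar R :=
  let dx := torus_measure L d in
  let dxdy := (dx \x dx)%E in
  let rho := density mu in
  let power x := rho x `^ m in
  let interaction z := W (vec z.1 - vec z.2) * rho z.1 * rho z.2 in
  if `[< [/\ mu `<< dx,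
             dx.-integrable setT (fun x => (power x)%:E) &
             dxdy.-integrable setT (fun z => (interaction z)%:E)] >]
  then (beta^-1 / (m - 1) * (\int[dx]_x power x) - beta^-1 / (m - 1)
        + 2^-1 * \int[dxdy]_z interaction z)%:E
  else +oo%E.

Definition torus_probability mu := mu (torus L d) = 1%E.

Definition minimiser (F : probability (points R d) R -> \bar R) mu :=
  torus_probability mu /\ forall nu, torus_probability nu -> (F mu <= F nu)%E.

(* A probability is a function on all sets, so two of them are the same
   measure when they agree on measurable sets. *)
Definition unique_minimiser (F : probability (points R d) R -> \bar R) mu :=
  minimiser F mu /\ forall nu, minimiser F nu -> measure_eq nu mu.

Definition transition_point (m : R) W (beta_c : R) :=
  [/\ 0 < beta_c,
      forall beta, 0 < beta -> beta < beta_c ->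
        unique_minimiser (free_energy m W beta) uniform_measure,
      minimiser (free_energy m W beta_c) uniform_measure &
      forall beta, beta_c < beta ->
        exists2 mu, minimiser (free_energy m W beta) mu &
          ~ measure_eq mu uniform_measure].

Definition beta_sharp (m : R) W : R :=
  - (m * rho_infty `^ (m - 3 / 2) / inf (fourier_ratios L W)).

End free_energy.

(* Main.v *)
Require Import Defs.
From HB Require Import structures.
From mathcomp Require Import all_boot all_order all_algebra.
From mathcomp Require Import all_classical all_reals all_analysis.
From mathcomp Require Import measurable_realfun giry zify ring lra.

Set Implicit Arguments.
Unset Strict Implicit.
Unset Printing Implicit Defensive.

Import Order.TTheory GRing.Theory Num.Theory.
Import numFieldNormedType.Exports.

Local Open Scope classical_set_scope.
Local Open Scope ring_scope.

(** A measure without density has infinite free energy, so the problem concerns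
densities [f]: up to a constant the free energy is [kappa * S f + B f / 2] with
[S f] the integral of [f `^ m], [B] the quadratic form of the convolution kernel
and [kappa] inversely proportional to [beta]. Let [A] be the set of [beta] at
which the uniform density is optimal. The transition point is [sup A], for the
following reasons.

The entropy excess over the uniform density [r] bounds the square of the [L1]
distance to [r] ([entropy_excess], a Pinsker inequality), while the interaction
is at most quadratic in that distance, because [W] has mean zero and so only
[f - r] interacts ([bilin_excess]). Hence [A] contains all small [beta]. Since the
entropy excess is positive away from [r], decreasing [beta] keeps [r] optimal
and makes it the only minimiser ([uniform_min_mono], [uniform_min_unique]), and
[A] is closed at its supremum ([uniform_min_closed]).

If [W] is not stable, some cosine coefficient is negative; as the coefficients
tend to zero ([cos_coeff_small], a Riemann-Lebesgue lemma), they have a negative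
minimum ([cos_coeff_min]), and perturbing [r] along the corresponding product of
cosines, an eigenfunction of the convolution, lowers the energy to second order
as soon as [beta] exceeds the threshold [beta_sharp] ([uniform_not_optimal]). So [A]
is bounded by it. Above [sup A] the uniform density is not optimal, and any
minimiser is a different one. If [W] is stable, [B] is nonnegative, [r] is the only minimiser for all
[beta], and there is no transition.

Two analytic facts support this. First, [W] is even in each coordinate, so its
sine coefficients vanish and its convolutions with products of Fejer kernels are
finite cosine sums with positive multiples of the cosine coefficients. They
converge uniformly ([conv_kernel_finite_rank]); this yields both the
nonnegativity of [B] in the stable case and the approximation of [B] by forms of
finite rank. Secondly, minimisers exist ([energy_minimiser_exists]). Weak
compactness is replaced by an ultrafilter of almost minimisers: along it the
finitely many functionals in a finite-rank form converge, so the interaction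
energy of differences becomes small, and uniform convexity of the power then
forces [L1] convergence. *)

(** * Convexity inequalities for powers *)

Section power_inequalities.
Context {R : realType}.
Implicit Types m s t b lam : R.

(** Convexity of [t `^ m] with an explicit remainder. With [t = s ^ 2] the power
is [s ^ 2 * exp (2 (m - 1) ln s)], and the claim follows from [exp x >= 1 + x]
and [ln s >= 1 - 1 / s]. The remainder is a squared Hellinger distance, which
works for every [m > 1], also below [2] where no quadratic remainder in [t - 1]
is available globally. *)
Lemma powR_ge_tangent_Hellinger m t : 1 < m -> 0 <= t ->
  1 + m * (t - 1) + (m - 1) * (Num.sqrt t - 1) ^+ 2 <= t `^ m.
Proof.
move=> m1; rewrite le_eqVlt => /predU1P[<-|t0].
  by rewrite sqrtr0 powR0 ?gt_eqF//; lra.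
have s0 : 0 < Num.sqrt t by rewrite sqrtr_gt0.
have ts : t = Num.sqrt t ^+ 2 by rewrite sqr_sqrtr ?ltW.
move: s0 ts; set s : R := Num.sqrt t; clearbody s => s0 ->.
have lns : 1 - s^-1 <= ln s.
  have si : 0 < s^-1 by rewrite invr_gt0.
  have := @le_ln1Dx R (s^-1 - 1); rewrite (addrC 1) subrK lnV ?posrE// => h.
  have {}h : - ln s <= s^-1 - 1 by apply: h; lra.
  by lra.
have -> : (s ^+ 2) `^ m = s ^+ 2 * expR ((m - 1) * (2 * ln s)).
  rewrite -(mulr_powRB1 _ (lt_trans ltr01 m1)) ?sqr_ge0//; congr (_ * _).
  by rewrite /powR gt_eqF ?exprn_gt0// lnXn// mulr_natl.
have := expR_ge1Dx ((m - 1) * (2 * ln s)).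
have h : (m - 1) * (2 * (1 - s^-1)) <= (m - 1) * (2 * ln s).
  by rewrite ler_pM2l; lra.
move=> h'; have {h'}h' := le_trans (lerD (lexx 1) h) h'.
apply: le_trans (ler_wpM2l (sqr_ge0 s) h').
rewrite le_eqVlt; apply/orP; left; apply/eqP; field; lra.
Qed.

(** With [s ^ 2 = t] one has [|t - 1| = |s - 1| (s + 1)], so this is
arithmetic-geometric mean. Integrated, and with the free parameter [b]
optimised, it bounds the Hellinger distance below by the square of the [L1]
distance. *)
Lemma Hellinger_ge_abs t b : 0 <= t -> 0 <= b ->
  2 * b * `|t - 1| - 2 * b ^+ 2 * (t + 1) <= (Num.sqrt t - 1) ^+ 2.
Proof.
move=> t0 b0.
have s0 : 0 <= Num.sqrt t by exact: sqrtr_ge0.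
have ts : t = Num.sqrt t ^+ 2 by rewrite sqr_sqrtr.
move: s0 ts; set s : R := Num.sqrt t; clearbody s => s0 ->.
have [s1|s1] := leP 1 s.
  rewrite ger0_norm; last nra.
  have := sqr_ge0 ((s - 1) - b * (s + 1)); have := sqr_ge0 (b * (s - 1)).
  by rewrite !expr2; lra.
rewrite ler0_norm; last nra.
have := sqr_ge0 ((1 - s) - b * (s + 1)); have := sqr_ge0 (b * (s - 1)).
by rewrite !expr2; lra.
Qed.

(** The convexity defect at the midpoint controls the distance, up to an error
that is small with [lam]. Dividing by the mean [p] reduces to two points with
mean [1] at distance [r] from it, where the defect is at least of order
[r ^ 2]. Relative distances [r <= lam] and small means [p <= lam] are absorbed
in the first term; otherwise [p / lam <= (p / lam) `^ m] and
[r <= r ^ 2 / lam], and the defect takes over. *)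
Lemma powR_uniform_convexity m lam s t : 1 < m -> 0 < lam ->
  0 <= s -> 0 <= t ->
  `|s - t| <= 2 * lam * ((s + t) / 2 + 1) + 8 / ((m - 1) * lam `^ m) *
    ((s `^ m + t `^ m) / 2 - ((s + t) / 2) `^ m).
Proof.
move=> m1 l0 s0 t0.
have lm0 : 0 < lam `^ m by exact: powR_gt0.
have /predU1P[p0|p0] : (0 == (s + t) / 2) || (0 < (s + t) / 2).
  by rewrite -le_eqVlt; lra.
  have -> : s = 0 by lra.
  have -> : t = 0 by lra.
  by rewrite subrr normr0 addr0 mul0r powR0 ?gt_eqF ?(lt_trans _ m1)//; nra.
have [p pE] : exists p, p = (s + t) / 2 by exists ((s + t) / 2).
rewrite -pE in p0 *.
pose a := s / p; pose c := t / p.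
have sE : s = p * a by rewrite /a; field; lra.
have tE : t = p * c by rewrite /c; field; lra.
have a0 : 0 <= a by rewrite divr_ge0// ltW.
have c0 : 0 <= c by rewrite divr_ge0// ltW.
have ac : a + c = 2.
  rewrite /a /c -mulrDl (_ : s + t = 2 * p) ?mulfK ?gt_eqF//; lra.
have cE : c = 2 - a by lra.
pose r : R := `|a - 1|.
have r0 : 0 <= r by exact: normr_ge0.
have cr : `|c - 1| = r by rewrite /r -(normrN (a - 1)) cE; congr `|_|; ring.
(* The parameter [r / 4] optimises the Hellinger bound. *)
have hd : p `^ m * (m - 1) * r ^+ 2 / 4 <= (s `^ m + t `^ m) / 2 - p `^ m.
  have r40 : 0 <= r / 4 by lra.
  have ha := powR_ge_tangent_Hellinger m1 a0.
  have hc := powR_ge_tangent_Hellinger m1 c0.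
  have ha' := Hellinger_ge_abs a0 r40.
  have hc' := Hellinger_ge_abs c0 r40.
  rewrite -/r in ha'; rewrite cr in hc'.
  have q0 : 0 < p `^ m by exact: powR_gt0.
  rewrite sE tE (powRM _ (ltW p0) a0) (powRM _ (ltW p0) c0).
  set A := a `^ m in ha *; set B := c `^ m in hc *.
  set u : R := (Num.sqrt a - 1) ^+ 2 in ha ha'.
  set v : R := (Num.sqrt c - 1) ^+ 2 in hc hc'.
  have uv : r ^+ 2 / 2 <= u + v by rewrite cE in hc'; lra.
  have AB : 2 + (m - 1) * (r ^+ 2 / 2) <= A + B.
    have : (m - 1) * (r ^+ 2 / 2) <= (m - 1) * (u + v).
      by rewrite ler_pM2l//; lra.
    have : m * (a - 1) + m * (c - 1) = 0 by rewrite cE; ring.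
    by lra.
  have := ler_wpM2l (ltW q0) AB; lra.
have -> : `|s - t| = 2 * p * r.
  rewrite sE tE cE -mulrBr normrM (gtr0_norm p0).
  rewrite (_ : a - (2 - a) = 2 * (a - 1)); last by ring.
  by rewrite normrM gtr0_norm// /r; ring.
have K0 : 0 < 8 / ((m - 1) * lam `^ m).
  by rewrite divr_gt0// mulr_gt0//; lra.
apply: le_trans (_ : 2 * lam * (p + 1) +
  8 / ((m - 1) * lam `^ m) * (p `^ m * (m - 1) * r ^+ 2 / 4) <= _); last first.
  by rewrite lerD2l ler_pM2l.
have -> : 8 / ((m - 1) * lam `^ m) * (p `^ m * (m - 1) * r ^+ 2 / 4) =
  2 * (p `^ m / lam `^ m) * r ^+ 2.
  by field; apply/andP; split; lra.
have q0 : 0 <= p `^ m / lam `^ m by rewrite divr_ge0 ?powR_ge0.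
have hq : 0 <= 2 * (p `^ m / lam `^ m) * r ^+ 2.
  by apply: mulr_ge0; [exact: mulr_ge0|exact: sqr_ge0].
have lp0 : 0 <= lam * p by rewrite mulr_ge0// ltW.
have [rl|lr] := leP r lam.
  by have := ler_wpM2l (ltW p0) rl; lra.
have r1 : r <= 1.
  by rewrite /r ler_norml; apply/andP; split; lra.
have [pl|lp] := leP p lam.
  by have := ler_wpM2l (ltW p0) r1; lra.
have : p / lam <= p `^ m / lam `^ m.
  rewrite -(@mulr_powRB1 _ p m) ?(ltW p0)//; last lra.
  rewrite -(@mulr_powRB1 _ lam m) ?(ltW l0)//; last lra.
  have l1 : 0 < lam `^ (m - 1) by exact: powR_gt0.
  rewrite invfM mulrACA -[leLHS]mulr1 ler_wpM2l//.
    by rewrite divr_ge0// ltW.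
  rewrite ler_pdivlMr// mul1r ltW//; apply: gt0_ltr_powR => //; first lra.
    by rewrite nnegrE ltW.
  by rewrite nnegrE ltW.
move=> pq.
have : p * r <= p / lam * r ^+ 2.
  have h : r <= r ^+ 2 / lam.
    by rewrite ler_pdivlMr// expr2; apply: ler_wpM2l => //; exact: ltW.
  by rewrite [leRHS]mulrAC -mulrA; apply: ler_wpM2l => //; exact: ltW.
have := ler_wpM2r (sqr_ge0 r) pq.
have : 0 <= 2 * lam * (p + 1) by rewrite !mulr_ge0//; lra.
lra.
Qed.

(** A second-order Taylor upper bound with any constant above half the second
derivative. The difference of the two sides vanishes at [0] and its derivative
[dg] has the sign of [x], because [k] exceeds the slope of [t `^ (m - 1)] at
[1]. *)
Lemma powR1D_le_quadratic m K : 1 < m -> m * (m - 1) / 2 < K ->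
  exists2 r : R, 0 < r &
    forall x, `|x| <= r -> (1 + x) `^ m <= 1 + m * x + K * x ^+ 2.
Proof.
move=> m1 mK; have m0 : 0 < m by lra.
pose k : R := 2 * K / m.
have mk : m - 1 < k by rewrite /k ltr_pdivlMr//; lra.
have : (fun h : R => h^-1 *: (((@powR R) ^~ (m - 1) \o shift 1) (h *: 1) -
    1 `^ (m - 1))) @ 0^' --> m - 1.
  have [dh dE] := @is_derive1_powR R (m - 1) 1 ltr01.
  by rewrite powR1 mulr1 in dE; rewrite -[X in _ --> X]dE.
move=> /cvgr_lt /(_ _ mk).
move=> /nbhs_ballP[e /= e0 He].
have slope h : h != 0 -> `|h| < e -> h^-1 * ((1 + h) `^ (m - 1) - 1) < k.
  move=> h0 he; have := He h; rewrite /ball/= sub0r normrN => /(_ he h0).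
  by rewrite powR1 /GRing.scale/= /shift/= mulr1 (addrC h).
pose g (x : R) := 1 + m * x + K * x ^+ 2 - (1 + x) `^ m.
pose dg (x : R) := m * (1 + k * x - (1 + x) `^ (m - 1)).
have g'E (x : R) : -1 < x -> is_derive x 1 g (dg x).
  move=> x1.
  have x1' : 0 < 1 + x by lra.
  have := @is_derive1_powR R m _ x1' => dp.
  have dc : is_derive x (1 : R) (fun y : R => (1 + y) `^ m) (m * (1 + x) `^ (m - 1)).
    have := @is_derive1_comp R ((@powR R) ^~ m) (fun y => 1 + y) x _ 1 dp _.
    by rewrite mulr1; apply; rewrite -[X in is_derive _ _ _ X]add0r; exact: is_deriveD.
  rewrite /g; apply: is_derive_eq.
  rewrite /dg /GRing.scale/= /k; field; lra.
have cg (x y : R) : -1 < x -> {within `[x, y], continuous g}.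
  move=> x1; apply: derivable_within_continuous => z; rewrite in_itv/= => /andP[xz _].
  by apply: ex_derive; apply: g'E; lra.
have g0 : g 0 = 0 by rewrite /g addr0 powR1; ring.
exists (Num.min e 1 / 2) => [|x]; first by rewrite divr_gt0// lt_min e0/=.
have me : Num.min e 1 <= e by rewrite ge_min lexx.
have me1 : Num.min e 1 <= 1 by rewrite ge_min lexx orbT.
move=> xr; rewrite -subr_ge0 -/(g x).
have xe : `|x| < e by lra.
have x2 : `|x| <= 1 / 2 by lra.
have [x0|x0|->] := ltgtP x 0; last by rewrite g0.
- rewrite ltr0_norm// in xe x2.
  have [||c] := @MVT R g dg x 0 x0.
  + by move=> y; rewrite in_itv/= => /andP[xy y0]; apply: g'E; lra.
  + by apply: cg; lra.
  rewrite in_itv/= g0 => /andP[xc c0] gE.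
  have := slope c; rewrite lt_eqF// ltr0_norm// => /(_ isT).
  rewrite ltr_ndivrMl// => /(_ _) ck.
  have : dg c * x >= 0.
    rewrite mulr_le0 ?(ltW x0)// /dg pmulr_rle0//.
    have := ck _; rewrite mulrC; lra.
  by move: gE; lra.
- rewrite gtr0_norm// in xe x2.
  have [||c] := @MVT R g dg 0 x x0.
  + by move=> y; rewrite in_itv/= => /andP[xy y0]; apply: g'E; lra.
  + by apply: cg; lra.
  rewrite in_itv/= g0 => /andP[xc c0] gE.
  have := slope c; rewrite gt_eqF// gtr0_norm// => /(_ isT).
  rewrite ltr_pdivrMl// => ck.
  have : dg c * x >= 0.
    rewrite mulr_ge0 ?(ltW x0)// /dg pmulr_rge0//.
    have {}ck := ck _; rewrite mulrC in ck; lra.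
  by move: gE; lra.
Qed.

End power_inequalities.

(** * Calculus of integrable real functions *)

Notation "mu .-L1 f" := (mu.-integrable [set: _] (EFin \o f))
  (at level 2, f at level 1, format "mu .-L1  f") : type_scope.

Section L1_calculus.
Context d (T : measurableType d) (R : realType) (mu : {measure set T -> \bar R}).
Implicit Types f g h : T -> R.

Lemma L1_measurable f : mu.-L1 f -> measurable_fun setT f.
Proof. by move=> /measurable_int /measurable_EFinP. Qed.

Lemma L1D f g : mu.-L1 f -> mu.-L1 g -> mu.-L1 (fun x => f x + g x).
Proof. by move=> fi gi; have := integrableD measurableT fi gi. Qed.

Lemma L1B f g : mu.-L1 f -> mu.-L1 g -> mu.-L1 (fun x => f x - g x).
Proof. by move=> fi gi; have := integrableB measurableT fi gi. Qed.

Lemma L1Z k f : mu.-L1 f -> mu.-L1 (fun x => k * f x).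
Proof. by move=> fi; have := integrableZl measurableT k fi. Qed.

Lemma L1_norm f : mu.-L1 f -> mu.-L1 (fun x => `|f x|).
Proof. by move=> fi; have := integrable_abse fi. Qed.

Lemma L1_sum I (s : seq I) (f : I -> T -> R) :
  (forall i, mu.-L1 (f i)) -> mu.-L1 (fun x => \sum_(i <- s) f i x).
Proof.
move=> fi; have := @integrable_sum _ T R mu setT measurableT I s xpredT
  (fun i => EFin \o f i) (fun i _ => fi i).
by apply: eq_integrable => // x _ /=; rewrite sumEFin.
Qed.

Lemma L1_le f g : measurable_fun setT f -> (forall x, `|f x| <= g x) ->
  mu.-L1 g -> mu.-L1 f.
Proof.
move=> mf fg; apply: le_integrable => //; first exact/measurable_EFinP.
by move=> x _ /=; rewrite lee_fin (le_trans (fg x))// ler_norm.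
Qed.

Lemma L1_mulr f h C : measurable_fun setT h -> (forall x, `|h x| <= C) ->
  mu.-L1 f -> mu.-L1 (fun x => h x * f x).
Proof.
move=> mh hC fi; apply: (@L1_le _ (fun x => C * `|f x|)).
- by apply: measurable_funM => //; exact: L1_measurable.
- by move=> x; rewrite normrM ler_wpM2r.
- exact/L1Z/L1_norm.
Qed.

Lemma int_ge0 f : (forall x, 0 <= f x) -> 0 <= \int[mu]_x f x.
Proof. by move=> f0; apply: Rintegral_ge0. Qed.

Lemma intD f g : mu.-L1 f -> mu.-L1 g ->
  \int[mu]_x (f x + g x) = \int[mu]_x f x + \int[mu]_x g x.
Proof. by move=> fi gi; rewrite RintegralD. Qed.

Lemma intB f g : mu.-L1 f -> mu.-L1 g ->
  \int[mu]_x (f x - g x) = \int[mu]_x f x - \int[mu]_x g x.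
Proof. by move=> fi gi; rewrite RintegralB. Qed.

Lemma intZ k f : mu.-L1 f -> \int[mu]_x (k * f x) = k * \int[mu]_x f x.
Proof. by move=> fi; rewrite RintegralZl. Qed.

Lemma int_sum I (s : seq I) (f : I -> T -> R) : (forall i, mu.-L1 (f i)) ->
  \int[mu]_x (\sum_(i <- s) f i x) = \sum_(i <- s) \int[mu]_x f i x.
Proof.
move=> fi; elim: s => [|i s IH].
  rewrite big_nil; under eq_Rintegral do rewrite big_nil.
  by rewrite Rintegral_cst// mul0r.
rewrite big_cons -IH -intD//; last exact: L1_sum.
by apply: eq_Rintegral => x _; rewrite big_cons.
Qed.

Lemma int_le f g : mu.-L1 f -> mu.-L1 g -> (forall x, f x <= g x) ->
  \int[mu]_x f x <= \int[mu]_x g x.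
Proof. by move=> fi gi fg; apply: le_Rintegral. Qed.

Lemma int_norm f : mu.-L1 f -> `|\int[mu]_x f x| <= \int[mu]_x `|f x|.
Proof. by move=> fi; exact: le_normr_Rintegral. Qed.

Lemma int_ae f g : {ae mu, forall x, f x = g x} ->
  measurable_fun setT f -> measurable_fun setT g ->
  \int[mu]_x f x = \int[mu]_x g x.
Proof.
move=> fg mf mg; congr fine; apply: ae_eq_integral => //.
- exact/measurable_EFinP.
- exact/measurable_EFinP.
- by apply: filterS fg => x /= -> _.
Qed.

Lemma EFin_int f : mu.-L1 f -> (\int[mu]_x f x)%:E = (\int[mu]_x (f x)%:E)%E.
Proof. by move=> fi; rewrite fineK// integrable_fin_num. Qed.

End L1_calculus.

Section finite_measure.
Context d (T : measurableType d) (R : realType)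
  (mu : {finite_measure set T -> \bar R}).
Implicit Types f g h : T -> R.

Lemma L1_bounded h C : measurable_fun setT h -> (forall x, `|h x| <= C) ->
  mu.-L1 h.
Proof.
move=> mh hC; apply: measurable_bounded_integrable => //.
  by rewrite ltey_eq fin_num_measure.
exists C; split; first exact: num_real.
by move=> M CM x _ /=; rewrite (le_trans (hC x))// ltW.
Qed.

Lemma L1_cst c : mu.-L1 (fun=> c).
Proof. by apply: (@L1_bounded _ `|c|). Qed.

End finite_measure.

Section tensor.
Context d1 d2 (T1 : measurableType d1) (T2 : measurableType d2) (R : realType).
Context (m1 : {finite_measure set T1 -> \bar R}).
Context (m2 : {finite_measure set T2 -> \bar R}).
Local Notation m12 := (m1 \x m2)%E.

Lemma L1_tensor f g : m1.-L1 f -> m2.-L1 g -> m12.-L1 (fun z => f z.1 * g z.2).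
Proof.
move=> fi gi.
have mf := L1_measurable fi; have mg := L1_measurable gi.
have mfg : measurable_fun setT (fun z : T1 * T2 => f z.1 * g z.2).
  by apply: measurable_funM; [exact: measurableT_comp mf _|exact: measurableT_comp mg _].
apply/integrable12ltyP; first exact/measurable_EFinP.
rewrite (_ : (fun x => _) = fun x => (`|f x| * \int[m2]_y `|g y|)%:E).
  rewrite -EFin_int ?ltry//.
  by have := L1Z (\int[m2]_y `|g y|) (L1_norm fi); apply: eq_integrable => // x _ /=; rewrite mulrC.
apply/funext => x; rewrite -intZ; last exact: L1_norm.
rewrite EFin_int; last exact/L1Z/L1_norm.
by apply: eq_integral => y _ /=; rewrite normrM.
Qed.

Lemma int_tensor f g : m1.-L1 f -> m2.-L1 g ->
  \int[m12]_z (f z.1 * g z.2) = (\int[m1]_x f x) * (\int[m2]_y g y).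
Proof.
move=> fi gi; apply: EFin_inj; rewrite EFin_int; last exact: L1_tensor.
rewrite -integral12_prod_meas1; last exact: L1_tensor.
rewrite mulrC -intZ// EFin_int; last exact: L1Z.
apply: eq_integral => x _; rewrite /fubini_F/= mulrC -intZ//.
by rewrite EFin_int//; exact: L1Z.
Qed.

Lemma int_Fubini (h : T1 * T2 -> R) : m12.-L1 h ->
  (forall x, m2.-L1 (fun y => h (x, y))) ->
  \int[m12]_z h z = \int[m1]_x \int[m2]_y h (x, y).
Proof.
move=> hi hx; rewrite /Rintegral -integral12_prod_meas1//; congr fine.
by apply: eq_integral => x _; rewrite /fubini_F/= -EFin_int.
Qed.

Lemma int_Fubini_swap (h : T1 * T2 -> R) : m12.-L1 h ->
  (forall y, m1.-L1 (fun x => h (x, y))) ->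
  \int[m12]_z h z = \int[m2]_y \int[m1]_x h (x, y).
Proof.
move=> hi hx; rewrite /Rintegral -integral21_prod_meas1//; congr fine.
by apply: eq_integral => x _; rewrite /fubini_G/= -EFin_int.
Qed.

End tensor.

(** * Quadratic forms of bounded kernels *)

Section bilinear.
Context d (T : measurableType d) (R : realType)
  (mu : {finite_measure set T -> \bar R}).
Implicit Types (f g : T -> R) (w : T * T -> R).

Definition bounded_kernel w C :=
  measurable_fun setT w /\ forall z, `|w z| <= C.

Definition bilin w f g : R := \int[(mu \x mu)%E]_z (w z * f z.1 * g z.2).

(** Uniform approximation by diagonal forms; the predicate [P] on the
coefficients records either nothing or their nonnegativity. *)
Definition finite_rank_approx (P : R -> Prop) w :=
  forall e : R, 0 < e ->
    exists (I : finType) (c : I -> R) (phi : I -> T -> R),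
    [/\ forall i, P (c i), forall i, measurable_fun setT (phi i),
        forall i x, `|phi i x| <= 1 &
        forall x y, `|w (x, y) - \sum_i c i * (phi i x * phi i y)| <= e].

Section basic.
Variables (w : T * T -> R) (C : R).
Hypothesis wC : bounded_kernel w C.

Lemma bilin_L1 f g : mu.-L1 f -> mu.-L1 g ->
  (mu \x mu)%E.-L1 (fun z => w z * f z.1 * g z.2).
Proof.
move=> fi gi; have := L1_mulr wC.1 wC.2 (L1_tensor fi gi).
by apply: eq_integrable => // z _ /=; rewrite mulrA.
Qed.

Lemma bilin_linl a b f1 f2 g : mu.-L1 f1 -> mu.-L1 f2 -> mu.-L1 g ->
  bilin w (fun x => a * f1 x + b * f2 x) g = a * bilin w f1 g + b * bilin w f2 g.
Proof.
move=> f1i f2i gi; rewrite /bilin -!intZ; [|exact: bilin_L1..].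
rewrite -intD; [|exact/L1Z/bilin_L1..].
by apply: eq_Rintegral => z _; ring.
Qed.

Lemma bilin_linr a b f g1 g2 : mu.-L1 f -> mu.-L1 g1 -> mu.-L1 g2 ->
  bilin w f (fun x => a * g1 x + b * g2 x) = a * bilin w f g1 + b * bilin w f g2.
Proof.
move=> f1i f2i gi; rewrite /bilin -!intZ; [|exact: bilin_L1..].
rewrite -intD; [|exact/L1Z/bilin_L1..].
by apply: eq_Rintegral => z _; ring.
Qed.

Lemma bilin_norm f g : mu.-L1 f -> mu.-L1 g ->
  `|bilin w f g| <= C * (\int[mu]_x `|f x|) * (\int[mu]_x `|g x|).
Proof.
move=> fi gi; rewrite (le_trans (int_norm (bilin_L1 fi gi)))//.
rewrite -mulrA -int_tensor; [|exact: L1_norm..].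
have h := L1_tensor (L1_norm fi) (L1_norm gi).
rewrite -intZ//; apply: int_le; [exact/L1_norm/bilin_L1|exact: L1Z|].
move=> z; rewrite -mulrA !normrM; apply: ler_wpM2r; last exact: wC.2.
exact: mulr_ge0.
Qed.

Lemma bilin_expand a f g : mu.-L1 f -> mu.-L1 g ->
  bilin w (fun x => f x + a * g x) (fun x => f x + a * g x) =
  bilin w f f + a * (bilin w f g + bilin w g f) + a ^+ 2 * bilin w g g.
Proof.
move=> fi gi.
have -> : (fun x => f x + a * g x) = (fun x => 1 * f x + a * g x).
  by apply/funext => x; rewrite mul1r.
rewrite bilin_linl//; last by apply: L1D; exact: L1Z.
by rewrite !bilin_linr//; ring.
Qed.

(** The interaction energy is not convex; this parallelogram identity isolates
the term by which it fails to be. *)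
Lemma bilin_midpoint f g : mu.-L1 f -> mu.-L1 g ->
  bilin w (fun x => (f x + g x) / 2) (fun x => (f x + g x) / 2) =
  (bilin w f f + bilin w g g) / 2 -
  bilin w (fun x => f x - g x) (fun x => f x - g x) / 4.
Proof.
move=> fi gi.
have -> : (fun x => (f x + g x) / 2) = (fun x => 2^-1 * f x + 2^-1 * g x).
  by apply/funext => x; ring.
have -> : (fun x => f x - g x) = (fun x => 1 * f x + (-1) * g x).
  by apply/funext => x; ring.
rewrite !bilin_linl//; [|by apply: L1D; exact: L1Z..].
by rewrite !bilin_linr//; field.
Qed.

Lemma bilin_diff f g : mu.-L1 f -> mu.-L1 g ->
  `|bilin w f f - bilin w g g| <=
  C * (\int[mu]_x `|f x| + \int[mu]_x `|g x|) * \int[mu]_x `|f x - g x|.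
Proof.
move=> fi gi.
have hi := L1B fi gi.
have E : bilin w f f - bilin w g g =
    bilin w (fun x => f x - g x) f + bilin w g (fun x => f x - g x).
  have -> : (fun x => f x - g x) = (fun x => 1 * f x + (-1) * g x).
    by apply/funext => x; ring.
  by rewrite bilin_linl// bilin_linr//; ring.
rewrite E (le_trans (ler_normD _ _))//.
rewrite (le_trans (lerD (bilin_norm hi fi) (bilin_norm gi hi)))//.
by rewrite le_eqVlt; apply/orP; left; apply/eqP; ring.
Qed.

Lemma bilin_finite_rank (e : R) (I : finType) (c : I -> R) (phi : I -> T -> R) f :
  (forall i, measurable_fun setT (phi i)) -> (forall i x, `|phi i x| <= 1) ->
  (forall x y, `|w (x, y) - \sum_i c i * (phi i x * phi i y)| <= e) ->
  mu.-L1 f ->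
  `|bilin w f f - \sum_i c i * (\int[mu]_x (phi i x * f x)) ^+ 2|
    <= e * (\int[mu]_x `|f x|) ^+ 2.
Proof.
move=> mphi phi1 wphi fi.
have pfi i : mu.-L1 (fun x => phi i x * f x).
  exact: L1_mulr (mphi i) (phi1 i) fi.
have ti i : (mu \x mu)%E.-L1
    (fun z => c i * ((phi i z.1 * f z.1) * (phi i z.2 * f z.2))).
  by apply: L1Z; exact: L1_tensor (pfi i) (pfi i).
have -> : \sum_i c i * (\int[mu]_x (phi i x * f x)) ^+ 2 =
   \int[(mu \x mu)%E]_z \sum_i c i * ((phi i z.1 * f z.1) * (phi i z.2 * f z.2)).
  rewrite int_sum//; apply: eq_bigr => i _.
  rewrite intZ ?expr2 -?(int_tensor (pfi i) (pfi i))//.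
  exact: L1_tensor (pfi i) (pfi i).
have ffi := L1_tensor (L1_norm fi) (L1_norm fi).
have si := L1_sum (index_enum _) ti.
rewrite -intB//; last exact: bilin_L1.
rewrite expr2 -int_tensor ?L1_norm// -intZ// (le_trans (int_norm _))//.
  by apply: L1B => //; exact: bilin_L1.
apply: int_le => [||z]; [|exact: L1Z|].
  by apply/L1_norm/L1B => //; exact: bilin_L1.
have -> : w z * f z.1 * f z.2 -
    \sum_i c i * (phi i z.1 * f z.1 * (phi i z.2 * f z.2)) =
   (w (z.1, z.2) - \sum_i c i * (phi i z.1 * phi i z.2)) * (f z.1 * f z.2).
  rewrite mulrBl mulr_suml -surjective_pairing mulrA; congr (_ - _).
  by apply: eq_bigr => i _; ring.
by rewrite !normrM ler_wpM2r// mulr_ge0.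
Qed.

End basic.

(** A uniform limit of sums of squares. *)
Lemma bilin_ge0 w C f : bounded_kernel w C ->
  finite_rank_approx (fun c => 0 <= c) w -> mu.-L1 f -> 0 <= bilin w f f.
Proof.
move=> wC fr fi; rewrite leNgt; apply/negP => B0.
set N := (\int[mu]_x `|f x|) ^+ 2.
have N0 : 0 <= N by exact: sqr_ge0.
have e0 : 0 < - bilin w f f / (N + 1) by rewrite divr_gt0//; lra.
have [J [c [phi [c0 mphi phi1 wphi]]]] := fr _ e0.
have := bilin_finite_rank wC mphi phi1 wphi fi.
have : 0 <= \sum_i c i * (\int[mu]_x (phi i x * f x)) ^+ 2.
  by apply: sumr_ge0 => i _; rewrite mulr_ge0// sqr_ge0.
rewrite -/N; set S := \sum_i _ => S0.
rewrite ler_norml => /andP[+ _].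
have : - bilin w f f / (N + 1) * N < - bilin w f f.
  by rewrite mulrAC ltr_pdivrMr ?ltr_pM2l; lra.
lra.
Qed.

End bilinear.

(** * Compactness and convergence *)

(** Closed bounded intervals are compact, and on an ultrafilter a cluster point
is a limit. *)
Lemma ultrafilter_bounded_cvg (X : Type) (R : realType) (U : set_system X)
    (phi : X -> R) (C : R) : UltraFilter U -> U [set x | `|phi x| <= C] ->
  exists l : R, forall e : R, 0 < e -> U [set x | `|phi x - l| < e].
Proof.
move=> UU UC.
have PF : ProperFilter (phi @ U) by exact: fmap_proper_filter.
have [|l [_ cl]] := @segment_compact R (- C) C (phi @ U) PF.
  by apply: (@filterS _ U _ _ _ _ UC) => x /= xC; rewrite in_itv/= -ler_norml.
exists l => e e0.
have [//|UN] := in_ultra_setVsetC [set x | `|phi x - l| < e] UU.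
have [||y [/= yn yl]] := cl [set y | ~ `|y - l| < e] (ball l e).
- exact: (@filterS _ U _ _ _ _ UN).
- exact: nbhsx_ballx.
- by exfalso; apply: yn; move: yl; rewrite /ball/= distrC.
Qed.

Lemma powR_cvg_nonneg (R : realType) (m : R) (u : R ^nat) (l : R) : 1 < m ->
  (forall n, 0 <= u n) -> 0 <= l -> u @ \oo --> l ->
  (fun n => u n `^ m) @ \oo --> l `^ m.
Proof.
move=> m1 u0; rewrite le_eqVlt => /predU1P[<-|l0] ul; last first.
  have cl : {for l, continuous ((@powR R) ^~ m)}.
    apply: differentiable_continuous; apply/derivable1_diffP.
    by have [] := @is_derive1_powR R m l l0.
  exact: (cvg_comp _ _ ul cl).
rewrite powR0; last by rewrite gt_eqF// (lt_trans ltr01).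
apply/cvgr0Pnorm_lt => e e0.
have d0 : 0 < Num.min 1 e by rewrite lt_min ltr01.
near=> n.
have : u n < Num.min 1 e by near: n; exact: (cvgr_lt _ ul).
rewrite lt_min => /andP[u1 ue].
rewrite ger0_norm ?powR_ge0//; have := u0 n; rewrite le_eqVlt => /predU1P[<-|un].
  by rewrite powR0// gt_eqF//; lra.
by apply: le_lt_trans ue; rewrite ge1r_powR ?un ?(ltW u1)// ltW.
Unshelve. all: by end_near. Qed.

Section convergence.
Context d (T : measurableType d) (R : realType) (mu : {measure set T -> \bar R}).

(** Lower semicontinuity of the entropy: only almost everywhere convergence and
an eventual bound on the integrals are at hand. *)
Lemma fatou_bound (h : nat -> T -> R) (g : T -> R) (M : R) N :
  (forall n, mu.-L1 (h n)) -> (forall n x, 0 <= h n x) ->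
  measurable_fun setT g -> (forall x, 0 <= g x) ->
  {ae mu, forall x, h ^~ x @ \oo --> g x} ->
  (forall n, (N <= n)%N -> \int[mu]_x h n x <= M) ->
  mu.-L1 g /\ \int[mu]_x g x <= M.
Proof.
move=> hi h0 mg g0 hg hM.
have mh n : measurable_fun setT (EFin \o h n) by exact: measurable_int (hi n).
have key : (\int[mu]_x (g x)%:E <= M%:E)%E.
  rewrite (@ae_eq_integral _ _ _ mu setT (fun x => limn_einf (fun n => (h n x)%:E)))//.
  - apply: le_trans (fatou mu measurableT mh _) _.
      by move=> n x _; rewrite lee_fin.
    rewrite limn_einf_lim; apply: lime_le; first exact: is_cvg_einfs.
    exists N => // n /= Nn; apply: (@le_trans _ _ (\int[mu]_x (h n x)%:E)%E).
      by apply: ereal_inf_lbound; exists n => //=.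
    by rewrite -EFin_int// lee_fin hM.
  - exact/measurable_EFinP.
  - rewrite (_ : (fun x => _) = -%E \o fun x => limn_esup (fun n => (- h n x)%:E)).
      apply: measurableT_comp => //; apply: measurable_fun_limn_esup => n.
      by apply/measurable_EFinP/measurable_funN/measurable_EFinP.
    apply/funext => x /=.
    by rewrite -[LHS]oppeK -limn_esupN.
  - apply: filterS hg => x hx _; symmetry.
    have : (fun n => (h n x)%:E) @ \oo --> (g x)%:E by apply: cvg_EFin => //; apply: nearW.
    by move=> /cvg_limn_einf_sup[].
have gi : mu.-L1 g.
  apply/integrableP; split; first exact/measurable_EFinP.
  apply: le_lt_trans (ltry M); apply: le_trans key.
  by under eq_integral do rewrite /= ger0_norm//.
by split => //; rewrite -lee_fin EFin_int.
Qed.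

(** Completeness of [L1] in the form the direct method needs. The sum [s] of the
increments is integrable, hence finite almost everywhere; where it is finite
the sequence converges, and [|f 0| + s] dominates it. *)
Lemma L1_Cauchy_cvg (f : nat -> T -> R) :
  (forall n, mu.-L1 (f n)) -> (forall n x, 0 <= f n x) ->
  (forall n, \int[mu]_x `|f n x - f n.+1 x| <= 1 / (2 ^ n.+1)%:R) ->
  exists g : T -> R, [/\ forall x, 0 <= g x, mu.-L1 g,
    {ae mu, forall x, f ^~ x @ \oo --> g x} &
    (fun n => \int[mu]_x `|f n x - g x|) @ \oo --> (0 : R)].
Proof.
move=> fi f0 fc.
pose a k x : \bar R := `|f k x - f k.+1 x|%:E.
have a0 k x : (0 <= a k x)%E by rewrite lee_fin.
have ai k : mu.-integrable setT (a k) by exact/L1_norm/L1B.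
have ma k : measurable_fun setT (a k) by exact: measurable_int (ai k).
pose s x := (\sum_(0 <= k <oo) a k x)%E.
have ms : measurable_fun setT s.
  exact: (@ge0_emeasurable_sum _ T R setT a xpredT (fun k x _ _ => a0 k x)
     (fun k _ => ma k)).
have s0 x : (0 <= s x)%E by apply: nneseries_ge0 => k _ _.
have si : mu.-integrable setT s.
  apply/integrableP; split => //.
  under eq_integral do rewrite gee0_abs//.
  rewrite integral_nneseries//; apply: le_lt_trans (ltry 1).
  apply: le_trans (epsilon_trick0 xpredT ler01).
  apply: lee_nneseries => [k _ _|k _]; first exact: integral_ge0.
  by rewrite -EFin_int ?lee_fin//; exact/L1_norm/L1B.
pose D := [set x | s x < +oo]%E.
have mD : measurable D.
  by have := emeasurable_fun_infty_o measurableT ms +oo%E; rewrite setTI.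
have aeD : {ae mu, forall x, D x}.
  have := integrable_ae measurableT si; apply: filterS => x /(_ I).
  by rewrite /D/= ltey_eq => ->.
have bnd x n : D x -> `|f n x - f 0 x| <= fine (s x).
  move=> Dx; have : (\sum_(0 <= k < n) a k x <= s x)%E.
    by apply: nneseries_lim_ge => k _ _.
  rewrite sumEFin -[s x]fineK ?ge0_fin_numE// lee_fin; apply: le_trans.
  rewrite -(@telescope_sumr _ 0 n (f ^~ x))// (le_trans (ler_norm_sum _ _ _))//.
  by apply: ler_sum => k _; rewrite distrC.
have cvgf x : D x -> cvg (f ^~ x @ \oo).
  move=> Dx.
  have : cvgn (series (fun k => f k.+1 x - f k x)).
    apply: normed_cvg; apply: nondecreasing_is_cvgn.
      by move=> i j; apply: (@nondecreasing_series _ (fun k => `|f k.+1 x - f k x|) xpredT 0).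
    exists (fine (s x)) => _ [n _ <-].
    have : (\sum_(0 <= k < n) a k x <= s x)%E.
      by apply: nneseries_lim_ge => k _ _.
    rewrite sumEFin -[s x]fineK ?ge0_fin_numE// lee_fin; apply: le_trans.
    by rewrite /series/= le_eqVlt; apply/orP; left; apply/eqP/eq_bigr => k _; rewrite distrC.
  move=> cs; have -> : f ^~ x = (fun n => f 0 x + series (fun k => f k.+1 x - f k x) n).
    apply/funext => n; rewrite /series/= (@telescope_sumr _ 0 n (f ^~ x))//; ring.
  by apply: is_cvgD => //; exact: is_cvg_cst.
pose f' n x := \1_D x * f n x.
pose g x := lim (f' ^~ x @ \oo).
have cf' x : f' ^~ x @ \oo --> g x.
  rewrite /g/f' indicE; have [/set_mem Dx|_] := boolP (x \in D).
    by under eq_fun do rewrite mul1r; exact: cvgf.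
  under eq_fun do rewrite mul0r; rewrite lim_cst//; exact: cvg_cst.
have mg : measurable_fun setT g.
  apply: (@measurable_fun_cvg _ _ _ _ f') => // n.
  by apply: measurable_funM; [exact: measurable_indic|exact: L1_measurable (fi n)].
have g0 x : 0 <= g x.
  by apply: limr_ge; [exact: cvgP (cf' x)|apply: nearW => n; rewrite mulr_ge0].
have aeg : {ae mu, forall x, f ^~ x @ \oo --> g x}.
  apply: filterS aeD => x Dx; have := cf' x; rewrite /f' indicE mem_set//.
  by under eq_fun do rewrite mul1r.
have Gi : mu.-integrable setT (fun x => (`|f 0 x|%:E + s x)%E).
  by apply: integrableD => //; exact: (L1_norm (fi 0)).
have [|||gi gl _] := @dominated_convergence _ T R mu setT measurableT
  (fun n => EFin \o f n) (EFin \o g) (fun x => (`|f 0 x|%:E + s x)%E)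
  (fun n => @measurable_int _ _ _ mu _ _ (fi n)) _ _ Gi _.
- exact/measurable_EFinP.
- apply: filterS aeg => x gx _; apply: cvg_EFin => //; exact: nearW.
- apply: filterS aeD => x Dx n _ /=.
  rewrite -[s x]fineK ?ge0_fin_numE// lee_fin.
  have := bnd x n Dx; have := ler_normD (f n x - f 0 x) (f 0 x).
  rewrite subrK; lra.
exists g; split => //.
have -> : (fun n => \int[mu]_x `|f n x - g x|) =
    fine \o [sequence \int[mu]_x `|(EFin \o f n) x - (EFin \o g) x|]_n%E by [].
exact: (fine_cvg gl).
Qed.

End convergence.

(** * Existence of minimisers *)

Section minimiser_existence.
Context d (T : measurableType d) (R : realType)
  (mu : {finite_measure set T -> \bar R}).
Implicit Types (f g : T -> R).

Definition admissible (m : R) f :=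
  [/\ forall x, 0 <= f x, mu.-L1 f, \int[mu]_x f x = 1 &
      mu.-L1 (fun x => f x `^ m)].

Definition energy (w : T * T -> R) (kappa m : R) f : R :=
  kappa * \int[mu]_x (f x `^ m) + 2^-1 * bilin mu w f f.

Lemma admissible_norm m f : admissible m f -> \int[mu]_x `|f x| = 1.
Proof.
by case=> f0 _ <- _; apply: eq_Rintegral => x _; rewrite ger0_norm.
Qed.

Lemma admissible_diff m f g : admissible m f -> admissible m g ->
  \int[mu]_x `|f x - g x| <= 2.
Proof.
move=> af ag; have [_ fi _ _] := af; have [_ gi _ _] := ag.
rewrite (_ : 2 = \int[mu]_x (`|f x| + `|g x|)); last first.
  by rewrite intD ?(admissible_norm af) ?(admissible_norm ag)//; exact: L1_norm.
apply: int_le => [||x]; [exact/L1_norm/L1B|apply: L1D; exact: L1_norm|].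
exact: ler_normB.
Qed.

Variables (w : T * T -> R) (C m kappa : R).
Hypotheses (wC : bounded_kernel w C) (m1 : 1 < m) (kappa0 : 0 < kappa).

Lemma admissible_midpoint f g : admissible m f -> admissible m g ->
  admissible m (fun x => (f x + g x) / 2).
Proof.
move=> [f0 fi f1 fm] [g0 gi g1 gm].
have hi : mu.-L1 (fun x => (f x + g x) / 2).
  have -> : (fun x => (f x + g x) / 2) = (fun x => 2^-1 * (f x + g x)).
    by apply/funext => x; rewrite mulrC.
  exact/L1Z/L1D.
split => //.
- by move=> x; rewrite divr_ge0// addr_ge0.
- under eq_Rintegral do rewrite mulrC.
  by rewrite intZ ?intD ?f1 ?g1//; [field|exact: L1D].
- apply: (@L1_le _ _ _ _ _ (fun x => f x `^ m + g x `^ m)); last exact: L1D.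
    by apply: (measurableT_comp (measurable_powR _)); exact: L1_measurable hi.
  move=> x; rewrite ger0_norm ?powR_ge0//.
  have m0 : 0 <= m := ltW (lt_trans ltr01 m1).
  have [fg|gf] := leP (f x) (g x).
    apply: le_trans (_ : g x `^ m <= _); last by rewrite lerDr powR_ge0.
    by apply: ge0_ler_powR => //; rewrite ?nnegrE ?divr_ge0 ?addr_ge0//; lra.
  apply: le_trans (_ : f x `^ m <= _); last by rewrite lerDl powR_ge0.
  by apply: ge0_ler_powR => //; rewrite ?nnegrE ?divr_ge0 ?addr_ge0//; lra.
Qed.

Lemma energy_ge f : admissible m f -> - (C / 2) <= energy w kappa m f.
Proof.
move=> af; have [f0 fi f1 fm] := af.
have := bilin_norm wC fi fi; rewrite (admissible_norm af) !mulr1 ler_norml.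
move=> /andP[h _]; rewrite /energy.
have : 0 <= kappa * \int[mu]_x (f x `^ m).
  by rewrite mulr_ge0 ?(ltW kappa0)//; apply: int_ge0 => x; exact: powR_ge0.
lra.
Qed.

(** The midpoint of two nearly minimal densities cannot have much less energy
than they have. By the parallelogram identity the interaction accounts for at
most the energy of their difference, which is assumed small, so the convexity
defect of the entropy is small and uniform convexity bounds the distance. *)
Lemma almost_minimisers_close (I : R) (e : R) : 0 < e ->
  (forall f, admissible m f -> I <= energy w kappa m f) ->
  exists2 eta : R, 0 < eta & forall f g, admissible m f -> admissible m g ->
    energy w kappa m f < I + eta -> energy w kappa m g < I + eta ->
    `|bilin mu w (fun x => f x - g x) (fun x => f x - g x)| <= eta ->
    \int[mu]_x `|f x - g x| <= e.
Proof.
move=> e0 Imin; have gt1 := m1; have kp := kappa0.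
pose V : R := \int[mu]_x (1 : R).
have V0 : 0 <= V by apply: int_ge0.
pose lam : R := e / (4 * (V + 1)).
have lam0 : 0 < lam by rewrite divr_gt0//; lra.
pose K : R := 8 / ((m - 1) * lam `^ m).
have K0 : 0 < K by rewrite divr_gt0// mulr_gt0 ?powR_gt0//; lra.
exists (e * kappa / (4 * K)) => [|f g af ag If Ig Bfg].
  by rewrite divr_gt0// mulr_gt0.
set eta := e * kappa / (4 * K) in If Ig Bfg.
have ah := admissible_midpoint af ag.
have [f0 fi f1 fm] := af; have [g0 gi g1 gm] := ag; have [h0 hi h1 hm] := ah.
have Ih := Imin _ ah.
pose delta := (\int[mu]_x (f x `^ m) + \int[mu]_x (g x `^ m)) / 2 -
  \int[mu]_x (((f x + g x) / 2) `^ m).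
have hd : kappa * delta <= 2 * eta.
  move: Ih If Ig Bfg; rewrite /energy (bilin_midpoint wC fi gi) ler_norml.
  set b := bilin _ _ _ _; set A := \int[mu]_x _; set F := \int[mu]_x (f x `^ m).
  set G := \int[mu]_x (g x `^ m).
  rewrite /delta -/A -/F -/G => Ih If Ig /andP[b1 b2]; lra.
have : \int[mu]_x `|f x - g x| <= 2 * lam * (1 + V) + K * delta.
  have i1 : mu.-L1 (fun x => 2^-1 * (f x `^ m + g x `^ m)) by exact/L1Z/L1D.
  have i2 := L1B i1 hm.
  have i3 : mu.-L1 (fun x => (f x + g x) / 2 + 1) by apply: L1D => //; exact: L1_cst.
  have -> : 2 * lam * (1 + V) + K * delta = \int[mu]_x (2 * lam * ((f x + g x) / 2 + 1)
      + K * (2^-1 * (f x `^ m + g x `^ m) - ((f x + g x) / 2) `^ m)).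
    rewrite intD; [|exact: L1Z..].
    rewrite !intZ// intD//; last exact: L1_cst.
    by rewrite h1 intB// intZ ?intD//; [rewrite /delta /V; field|exact: L1D].
  apply: int_le => [||x]; [exact/L1_norm/L1B|by apply: L1D; exact: L1Z|].
  by have := powR_uniform_convexity m1 lam0 (f0 x) (g0 x); rewrite -/K; lra.
have -> : 2 * lam * (1 + V) = e / 2 by rewrite /lam; field; lra.
have : K * delta <= e / 2.
  have := ler_wpM2l (ltW K0) hd; rewrite mulrCA.
  have -> : K * (2 * eta) = kappa * (e / 2) by rewrite /eta; field; lra.
  by rewrite ler_pM2l.
lra.
Qed.

(** Along an ultrafilter every bounded linear functional converges, so its
values at [f] and [g] agree up to a small error for all [f] and [g] in some
member of it. A kernel of nearly finite rank only sees finitely many such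
functionals. This replaces weak compactness of the set of densities. *)
Lemma interaction_small_along_ultrafilter (U : set_system (T -> R)) (e : R) :
  UltraFilter U -> U (admissible m) -> finite_rank_approx (fun=> True) w ->
  0 < e ->
  exists2 P, U P & forall f g, P f -> P g ->
    `|bilin mu w (fun x => f x - g x) (fun x => f x - g x)| <= e.
Proof.
move=> UU Uadm fr e0.
have e8 : 0 < e / 8 by lra.
have [J [c [phi [_ mphi phi1 wphi]]]] := fr _ e8.
have cvg_phi i : exists l : R, forall e : R, 0 < e ->
    U [set f | `|\int[mu]_x (phi i x * f x) - l| < e].
  apply: (@ultrafilter_bounded_cvg _ _ _ _ 1) => //.
  apply: filterS Uadm => f /= af; have [f0 fi f1 fm] := af.
  have pfi := L1_mulr (mphi i) (phi1 i) fi.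
  rewrite -(admissible_norm af) (le_trans (int_norm pfi))//.
  apply: int_le => [||x]; [exact: L1_norm|exact: L1_norm|].
  by rewrite normrM ler_piMl.
have [l hl] := choice cvg_phi.
pose S : R := \sum_i `|c i|.
have S0 : 0 <= S by apply: sumr_ge0.
have [eta eta0 Heta] : exists2 eta : R, 0 < eta & S * (2 * eta) ^+ 2 <= e / 2.
  exists (Num.min 1 (e / (8 * (S + 1)))).
    by rewrite lt_min ltr01 divr_gt0//; lra.
  set k := Num.min _ _.
  have k1 : k <= 1 by rewrite ge_min lexx.
  have ke : k <= e / (8 * (S + 1)) by rewrite ge_min lexx orbT.
  have k0 : 0 < k by rewrite lt_min ltr01 divr_gt0//; lra.
  have : k * (8 * (S + 1)) <= e by rewrite -ler_pdivlMr//; lra.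
  have : S * k ^+ 2 <= S * k.
    by rewrite ler_wpM2l// expr2 ger_pMl.
  have : 0 <= S * k by rewrite mulr_ge0// ltW.
  rewrite exprMn; lra.
exists (admissible m `&`
  [set f | forall i, `|\int[mu]_x (phi i x * f x) - l i| < eta]).
  apply: filterI => //.
  by apply: filter_forall => i; exact: hl.
move=> f g [af hf] [ag hg]; have [f0 fi f1 fm] := af; have [g0 gi g1 gm] := ag.
have di := L1B fi gi.
have := bilin_finite_rank wC mphi phi1 wphi di.
set B := bilin _ _ _ _; set Q := \sum_i _.
have : `|Q| <= e / 2.
  apply: le_trans Heta; rewrite /S mulr_suml (le_trans (ler_norm_sum _ _ _))//.
  apply: ler_sum => i _; rewrite normrM ler_wpM2l// normrX.
  have pfi := L1_mulr (mphi i) (phi1 i) fi.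
  have pgi := L1_mulr (mphi i) (phi1 i) gi.
  under eq_Rintegral do rewrite mulrBr.
  rewrite intB// ler_sqr ?nnegrE//; last lra.
  have := hf i; have := hg i; rewrite !ltr_norml ler_norml => /andP[a b] /andP[a' b'].
  by apply/andP; split; lra.
have : (\int[mu]_x `|f x - g x|) ^+ 2 <= 4.
  have := admissible_diff af ag.
  have : 0 <= \int[mu]_x `|f x - g x| by apply: int_ge0.
  by move: (\int[mu]_x _) => a a0 a2; rewrite expr2; nra.
move: (_ ^+ 2) => D D4; rewrite !ler_norml => /andP[q1 q2] /andP[b1 b2].
have : e / 8 * D <= e / 8 * 4 by rewrite ler_pM2l.
by move=> h; apply/andP; split; lra.
Qed.

(** Refine the filter of almost minimisers to an ultrafilter. By the two preceding
lemmas it has members of arbitrarily small [L1] diameter, and these yield an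
[L1] Cauchy sequence of almost minimisers. Along it the interaction converges
and the entropy is lower semicontinuous, so the limit is a minimiser. *)
Theorem energy_minimiser_exists :
  finite_rank_approx (fun=> True) w -> (exists f, admissible m f) ->
  exists2 f, admissible m f &
    forall g, admissible m g -> energy w kappa m f <= energy w kappa m g.
Proof.
move=> fr [f_ af_]; have kp := kappa0.
pose E := [set energy w kappa m f | f in admissible m].
pose I := inf E.
have hE : has_inf E.
  split; first by exists (energy w kappa m f_); exists f_.
  by exists (- (C / 2)) => _ [f af <-]; exact: energy_ge.
have Imin f : admissible m f -> I <= energy w kappa m f.
  by move=> af; apply: ge_inf; [case: hE|exists f].
pose A (e : R) := [set f | admissible m f /\ energy w kappa m f < I + e].
have FF : ProperFilter (filter_from [set e : R | 0 < e] A).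
  apply: filter_from_proper.
    apply: filter_from_filter; first by exists 1 => /=.
    move=> e1 e2 /= e10 e20; exists (Num.min e1 e2) => [|f [af If]].
      by rewrite /= lt_min e10.
    by split; split => //; apply: lt_le_trans If _; rewrite lerD2l ge_min lexx ?orbT.
  move=> e /= e0; have [_ [f af <-] If] := inf_adherent e0 hE.
  by exists f.
have [U [UU FU]] := ultraFilterLemma FF.
have UA e : 0 < e -> U (A e) by move=> e0; apply: FU; exists e.
have Uadm : U (admissible m).
  by apply: (@filterS _ U _ _ _ _ (UA 1 ltr01)) => f [].
have UP e : 0 < e -> exists2 P, U P &
    forall f g, P f -> P g -> \int[mu]_x `|f x - g x| <= e.
  move=> e0; have [eta eta0 H] := almost_minimisers_close e0 Imin.
  have [P UP PB] := interaction_small_along_ultrafilter UU Uadm fr eta0.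
  exists (A eta `&` P); first by apply: filterI => //; exact: UA.
  by move=> f g [[af If] Pf] [[ag Ig] Pg]; apply: H => //; exact: PB.
pose eps n : R := 1 / (2 ^ n.+1)%:R.
have eps0 n : 0 < eps n by rewrite divr_gt0// ltr0n expn_gt0.
have /choice[P HP] : forall n, exists P, U P /\
    forall f g, P f -> P g -> \int[mu]_x `|f x - g x| <= eps n.
  by move=> n; have [P ? ?] := UP _ (eps0 n); exists P.
(* Each [u n] lies in all of [P 0], ..., [P n], so consecutive terms share [P n]. *)
have /choice[u Hu] : forall n, exists f,
    A (eps n) f /\ forall i : 'I_n.+1, P i f.
  move=> n; have [|f [Af Pf]] := @filter_ex _ U _ (A (eps n) `&`
      [set f | forall i : 'I_n.+1, P i f]); last by exists f.
  apply: filterI; first exact: UA.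
  by apply: filter_forall => i; exact: (HP i).1.
have au n : admissible m (u n) by have [[]] := Hu n.
have u0 n x : 0 <= u n x by have [] := au n.
have ui n : mu.-L1 (u n) by have [] := au n.
have um n : mu.-L1 (fun x => u n x `^ m) by have [] := au n.
have uc n : \int[mu]_x `|u n x - u n.+1 x| <= eps n.
  apply: (HP n).2; first by have [_ /(_ ord_max)] := Hu n.
  by have [_ /(_ (widen_ord (leqnSn _) ord_max))] := Hu n.+1.
have [f [f0 fi cvf0 cvf]] := L1_Cauchy_cvg ui u0 uc.
have uf0 n : `|\int[mu]_x u n x - \int[mu]_x f x| <= \int[mu]_x `|u n x - f x|.
  by rewrite -intB//; apply: int_norm; exact: L1B.
have f1 : \int[mu]_x f x = 1.
  apply/eqP; rewrite -subr_eq0 -normr_le0 leNgt; apply/negP => h.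
  have [N _ HN] := cvgr_lt _ cvf _ h.
  have := HN N (leqnn N); have := uf0 N.
  by have [_ _ -> _] := au N; rewrite distrC; lra.
pose M e := (I + e - 2^-1 * bilin mu w f f) / kappa.
have C0 : 0 <= C by apply: le_trans (wC.2 point); exact: normr_ge0.
have eventually_M e : 0 < e ->
    exists N, forall n, (N <= n)%N -> \int[mu]_x (u n x `^ m) <= M e.
  move=> e0.
  have d0 : 0 < e / (2 * (C + 1)) by rewrite divr_gt0//; lra.
  have [N1 _ HN1] := cvgr_lt _ cvf _ d0.
  have [N2 HN2] : exists N, forall n, (N <= n)%N -> eps n < e / 2.
    have e2 : 0 < e / 2 by lra.
    have [N _ HN] := near_infty_natSinv_expn_lt (PosNum e2).
    exists N => n Nn; rewrite /eps natrX; apply: HN => /=; exact: leq_trans Nn _.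
  exists (maxn N1 N2) => n; rewrite geq_max => /andP[n1 n2].
  have [[_ +] _] := Hu n; rewrite /energy.
  have := HN1 n n1; have := HN2 n n2.
  have := bilin_diff wC fi (ui n).
  have -> : \int[mu]_x `|f x - u n x| = \int[mu]_x `|u n x - f x|.
    by apply: eq_Rintegral => x _; rewrite distrC.
  rewrite (admissible_norm (au n)).
  have -> : \int[mu]_x `|f x| = 1.
    by rewrite -f1; apply: eq_Rintegral => x _; rewrite ger0_norm.
  rewrite /M ler_pdivlMr//.
  have : 0 <= \int[mu]_x `|u n x - f x| by apply: int_ge0.
  set D := \int[mu]_x `|_ - _|; set b := bilin _ _ _ _.
  set b' := bilin _ _ _ _; set F := \int[mu]_x _.
  rewrite ler_norml => D0 /andP[h1 h2] en De.
  have : D * (2 * (C + 1)) < e by rewrite -ltr_pdivlMr//; lra.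
  lra.
have cum : {ae mu, forall x, (fun n => u n x `^ m) @ \oo --> f x `^ m}.
  by apply: filterS cvf0 => x; apply: powR_cvg_nonneg.
have fmM e : 0 < e -> mu.-L1 (fun x => f x `^ m) /\ \int[mu]_x (f x `^ m) <= M e.
  move=> e0; have [N HN] := eventually_M _ e0.
  apply: (@fatou_bound _ _ _ mu (fun n x => u n x `^ m) _ _ N) => //.
  - by move=> n x; exact: powR_ge0.
  - exact: (measurableT_comp (measurable_powR _) (L1_measurable fi)).
  - by move=> x; exact: powR_ge0.
have af : admissible m f by split => //; have [] := fmM _ ltr01.
exists f => // g ag; apply: le_trans (Imin _ ag).
apply/ler_addgt0Pr => e e0; have [_] := fmM _ e0.
by rewrite /M ler_pdivlMr// /energy; lra.
Qed.

End minimiser_existence.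

(** * Optimality of the uniform density *)

Section uniform_density.
Context d (T : measurableType d) (R : realType)
  (mu : {finite_measure set T -> \bar R}).
Implicit Types (f g : T -> R).
Variables (w : T * T -> R) (C m r : R).
Hypotheses (wC : bounded_kernel w C) (m1 : 1 < m) (r0 : 0 < r)
  (r1 : \int[mu]_x r = 1)
  (w1 : forall x, \int[mu]_y w (x, y) = 0)
  (w2 : forall y, \int[mu]_x w (x, y) = 0).

Let V : R := \int[mu]_x (1 : R).

Let rV : r * V = 1.
Proof.
rewrite -r1 /V -intZ; last exact: L1_cst.
by apply: eq_Rintegral => x _; rewrite mulr1.
Qed.

Let V0 : 0 < V.
Proof. by rewrite -(pmulr_rgt0 _ r0) rV. Qed.

Let int_cst c : \int[mu]_x c = c * V.
Proof.
rewrite /V -intZ; last exact: L1_cst.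
by apply: eq_Rintegral => x _; rewrite mulr1.
Qed.

Lemma admissible_cst : admissible mu m (fun=> r).
Proof. by split => //; [move=> _; exact: ltW|exact: L1_cst|exact: L1_cst]. Qed.

Lemma bilin_cstr f : mu.-L1 f -> bilin mu w f (fun=> r) = 0.
Proof.
move=> fi; have ri := L1_cst mu r.
rewrite /bilin int_Fubini; last 2 first.
- exact: (bilin_L1 wC fi ri).
- move=> x; apply: (@L1_bounded _ _ _ _ _ (C * `|f x| * r)).
    apply: measurable_funM => //; apply: measurable_funM; last by move=> /=; exact: measurable_cst.
    by apply: (measurableT_comp wC.1); exact: pair1_measurable.
  move=> y; rewrite 2!normrM (gtr0_norm r0) ler_wpM2r// ?(ltW r0)//.
  by rewrite ler_wpM2r// wC.2.
have -> : (fun x => \int[mu]_y (w (x, y) * f x * r)) = fun=> 0 :> R.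
  apply/funext => x.
  have -> : (fun y => w (x, y) * f x * r) = (fun y => (f x * r) * w (x, y)).
    by apply/funext => y; ring.
  rewrite intZ ?w1 ?mulr0//; apply: (@L1_bounded _ _ _ _ _ C).
    by apply: (measurableT_comp wC.1); exact: pair1_measurable.
  by move=> y; exact: wC.2.
by rewrite int_cst mul0r.
Qed.

Lemma bilin_cstl f : mu.-L1 f -> bilin mu w (fun=> r) f = 0.
Proof.
move=> fi; have ri := L1_cst mu r.
rewrite /bilin int_Fubini_swap; last 2 first.
- exact: (bilin_L1 wC ri fi).
- move=> y; apply: (@L1_bounded _ _ _ _ _ (C * r * `|f y|)).
    apply: measurable_funM; last by move=> /=; exact: measurable_cst.
    apply: measurable_funM; last by move=> /=; exact: measurable_cst.
    by apply: (measurableT_comp wC.1); exact: pair2_measurable.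
  move=> x; rewrite 2!normrM (gtr0_norm r0) ler_wpM2r//.
  by rewrite ler_wpM2r ?(ltW r0)// wC.2.
have -> : (fun y => \int[mu]_x (w (x, y) * r * f y)) = fun=> 0 :> R.
  apply/funext => y.
  have -> : (fun x => w (x, y) * r * f y) = (fun x => (r * f y) * w (x, y)).
    by apply/funext => x; ring.
  rewrite intZ ?w2 ?mulr0//; apply: (@L1_bounded _ _ _ _ _ C).
    by apply: (measurableT_comp wC.1); exact: pair2_measurable.
  by move=> x; exact: wC.2.
by rewrite int_cst mul0r.
Qed.

Lemma bilin_perturbation a f : mu.-L1 f ->
  bilin mu w (fun x => r + a * f x) (fun x => r + a * f x) =
  a ^+ 2 * bilin mu w f f.
Proof.
move=> fi; have ri := L1_cst mu r; rewrite (bilin_expand wC a ri fi).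
by rewrite !bilin_cstr// bilin_cstl//; ring.
Qed.

Lemma energy_cst kappa : energy mu w kappa m (fun=> r) = kappa * (r `^ m * V).
Proof.
by rewrite /energy bilin_cstr ?mulr0 ?addr0 ?int_cst//; exact: L1_cst.
Qed.

Lemma energy_excess kappa f : admissible mu m f ->
  energy mu w kappa m f - energy mu w kappa m (fun=> r) =
  kappa * (\int[mu]_x (f x `^ m) - r `^ m * V) + 2^-1 * bilin mu w f f.
Proof. by rewrite energy_cst /energy => _; ring. Qed.

(** Since [w] has zero marginals, only [f - r] interacts. *)
Lemma bilin_excess f : admissible mu m f ->
  `|bilin mu w f f| <= C * (\int[mu]_x `|f x - r|) ^+ 2.
Proof.
case=> f0 fi f1 fm; have di : mu.-L1 (fun x => f x - r) by apply: L1B => //; exact: L1_cst.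
have -> : bilin mu w f f = bilin mu w (fun x => f x - r) (fun x => f x - r).
  have := bilin_perturbation 1 di; rewrite expr1n mul1r => <-.
  by congr bilin; apply/funext => x; ring.
by rewrite (le_trans (bilin_norm wC di di))// expr2 mulrA.
Qed.

(** A Pinsker inequality for the power entropy. The tangent term integrates to
zero since [f] and the constant have the same mass; the remainder is bounded
below by the [L1] distance [a], the choice [a / 4] of the free parameter being
optimal. *)
Lemma entropy_excess f : admissible mu m f ->
  (m - 1) * r `^ m * V / 4 * (\int[mu]_x `|f x - r|) ^+ 2 <=
  \int[mu]_x (f x `^ m) - r `^ m * V.
Proof.
move=> [f0 fi f1 fm]; have gt1 := m1.
set a := \int[mu]_x `|f x - r|.
have a0 : 0 <= a by exact: int_ge0.
have b0 : 0 <= a / 4 by rewrite divr_ge0.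
have di : mu.-L1 (fun x => f x - r) by apply: L1B => //; exact: L1_cst.
pose c1 : R := m - 2 * (m - 1) * (a / 4) ^+ 2.
pose c2 : R := 1 - m - 2 * (m - 1) * (a / 4) ^+ 2.
pose c3 : R := 2 * (m - 1) * (a / 4).
have i1 : mu.-L1 (fun x => c1 * (r^-1 * f x) + c2) by apply: L1D; [exact/L1Z/L1Z|exact: L1_cst].
have i2 : mu.-L1 (fun x => c3 * (r^-1 * `|f x - r|)) by exact/L1Z/L1Z/L1_norm.
have key : \int[mu]_x (r `^ m * (c1 * (r^-1 * f x) + c2 + c3 * (r^-1 * `|f x - r|)))
    <= \int[mu]_x (f x `^ m).
  apply: int_le => // [|x]; first exact/L1Z/L1D.
  have t0 : 0 <= f x / r by rewrite divr_ge0// ltW.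
  have h1 := powR_ge_tangent_Hellinger m1 t0.
  have h2 := Hellinger_ge_abs t0 b0.
  have -> : f x `^ m = r `^ m * (f x / r) `^ m.
    by rewrite -powRM ?(ltW r0)// mulrC divfK ?gt_eqF.
  have -> : r^-1 * `|f x - r| = `|f x / r - 1|.
    by rewrite -{1}(gtr0_norm r0) -normfV -normrM mulrBr mulVf ?gt_eqF// mulrC.
  rewrite ler_pM2l ?powR_gt0//; apply: le_trans h1.
  rewrite (mulrC r^-1); have := ler_wpM2l (ltW (_ : 0 < m - 1)) h2.
  move=> /(_ ltac:(lra)); rewrite /c1 /c2 /c3; lra.
have rVi : r^-1 = V by rewrite -[RHS](mulKf (lt0r_neq0 r0)) rV mulr1.
move: key; rewrite intZ; last exact: L1D.
rewrite intD//; rewrite intD; [|exact/L1Z/L1Z|exact: L1_cst].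
rewrite !intZ//; [|exact: L1_norm|exact/L1Z/L1_norm|exact: L1Z].
rewrite f1 int_cst rVi -/a /c1 /c2 /c3; lra.
Qed.

(** Both the gain in entropy and the possible loss in interaction are quadratic
in the [L1] distance to the constant. *)
Lemma uniform_min_large_kappa : exists2 kappa1, 0 < kappa1 &
  forall kappa, kappa1 <= kappa -> forall f, admissible mu m f ->
  energy mu w kappa m (fun=> r) <= energy mu w kappa m f.
Proof.
have gt1 := m1.
pose K : R := (m - 1) * r `^ m * V / 4.
have K0 : 0 < K by rewrite divr_gt0// !mulr_gt0 ?powR_gt0//; lra.
have C0 : 0 <= C by apply: le_trans (wC.2 point); exact: normr_ge0.
exists ((C + 1) / (2 * K)) => [|kappa Hk f af].
  by rewrite divr_gt0//; lra.
rewrite -subr_ge0 energy_excess//.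
have := bilin_excess af; have := entropy_excess af; rewrite -/K.
have := sqr_ge0 (\int[mu]_x `|f x - r|).
move: (_ ^+ 2) => a a0.
set S := \int[mu]_x (f x `^ m) - _; set B := bilin _ _ _ _.
have k0 : 0 < kappa by apply: lt_le_trans Hk; rewrite divr_gt0//; lra.
move: Hk; rewrite ler_pdivrMr; last lra.
move=> Hk /(ler_wpM2l (ltW k0)) h1; rewrite ler_norml => /andP[h2 _].
have := ler_wpM2r a0 Hk; lra.
Qed.

(** Optimality at [kappa] and at most equality at [kappa'] force the entropy
excess to vanish, and then so does the distance. *)
Lemma uniform_min_unique kappa kappa' : kappa < kappa' ->
  (forall f, admissible mu m f ->
    energy mu w kappa m (fun=> r) <= energy mu w kappa m f) ->
  forall f, admissible mu m f ->
  energy mu w kappa' m f <= energy mu w kappa' m (fun=> r) ->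
  \int[mu]_x `|f x - r| = 0.
Proof.
move=> kk H f af; have gt1 := m1; rewrite -subr_le0 energy_excess//.
have := H f af; rewrite -subr_ge0 energy_excess//.
have := entropy_excess af.
have K0 : 0 < (m - 1) * r `^ m * V / 4 by rewrite divr_gt0// !mulr_gt0 ?powR_gt0//; lra.
set S := \int[mu]_x (f x `^ m) - _; set B := bilin _ _ _ _ => h1 h2 h3.
have S0 : (kappa' - kappa) * S <= 0 by lra.
rewrite pmulr_rle0 ?subr_gt0// in S0.
have := le_trans h1 S0; rewrite pmulr_rle0// => a0.
by apply/eqP; rewrite -sqrf_eq0 eq_le a0 sqr_ge0.
Qed.

Lemma uniform_min_mono kappa kappa' : kappa <= kappa' ->
  (forall f, admissible mu m f ->
    energy mu w kappa m (fun=> r) <= energy mu w kappa m f) ->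
  forall f, admissible mu m f ->
    energy mu w kappa' m (fun=> r) <= energy mu w kappa' m f.
Proof.
move=> kk H f af; have gt1 := m1; rewrite -subr_ge0 energy_excess//.
have := H f af; rewrite -subr_ge0 energy_excess//.
have := entropy_excess af; set S := \int[mu]_x (f x `^ m) - _.
set B := bilin _ _ _ _ => h1 h2.
have S0 : 0 <= S.
  apply: le_trans h1.
  by rewrite mulr_ge0 ?sqr_ge0// divr_ge0// !mulr_ge0 ?powR_ge0 ?(ltW V0)//; lra.
have : kappa * S <= kappa' * S by rewrite ler_wpM2r.
lra.
Qed.

Lemma uniform_min_closed kappa :
  (forall kappa', kappa < kappa' -> forall f, admissible mu m f ->
    energy mu w kappa' m (fun=> r) <= energy mu w kappa' m f) ->
  forall f, admissible mu m f ->
    energy mu w kappa m (fun=> r) <= energy mu w kappa m f.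
Proof.
move=> H f af; rewrite -subr_ge0 energy_excess//.
set S := \int[mu]_x (f x `^ m) - _; set B := bilin _ _ _ _.
have S0 : 0 <= S.
  apply: le_trans (entropy_excess af); have gt1 := m1.
  by rewrite mulr_ge0 ?sqr_ge0// divr_ge0// !mulr_ge0 ?powR_ge0 ?(ltW V0)//; lra.
apply/ler_addgt0Pr => e e0.
have := H (kappa + e / (S + 1)) _ f af; rewrite ltrDl divr_gt0//; last lra.
rewrite -subr_ge0 energy_excess// -/S -/B => /(_ isT).
have : e / (S + 1) * S <= e.
  by rewrite mulrAC ler_pdivrMr ?ler_pM2l//; lra.
lra.
Qed.

Lemma uniform_min_positive kappa f : 0 < kappa -> admissible mu m f ->
  0 <= bilin mu w f f ->
  energy mu w kappa m (fun=> r) <= energy mu w kappa m f /\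
  (energy mu w kappa m f <= energy mu w kappa m (fun=> r) ->
   \int[mu]_x `|f x - r| = 0).
Proof.
move=> k0 af B0; have gt1 := m1.
rewrite -subr_ge0 -(subr_le0 (energy _ _ _ _ (fun=> r))) energy_excess//.
have := entropy_excess af.
have K0 : 0 < (m - 1) * r `^ m * V / 4 by rewrite divr_gt0// !mulr_gt0 ?powR_gt0//; lra.
set S := \int[mu]_x (f x `^ m) - _; set a := \int[mu]_x _ => h1.
have S0 : 0 <= S by apply: le_trans h1; rewrite mulr_ge0 ?sqr_ge0// ltW.
have kS : 0 <= kappa * S by rewrite mulr_ge0// ltW.
split=> [|h]; first by lra.
have : kappa * S <= 0 by lra.
rewrite pmulr_rle0// => {}S0.
have := le_trans h1 S0; rewrite pmulr_rle0// => a0.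
by apply/eqP; rewrite -sqrf_eq0 eq_le a0 sqr_ge0.
Qed.

End uniform_density.

(** * Measure-preserving maps of the circle *)

Section circle.
Context {R : realType} (L : {posnum R}).
Local Notation leb := (@lebesgue_measure R).
Local Notation circle := (circle_measure L).
Local Notation mR := (measurableTypeR R).

(** The representative of [t] modulo [L] in the fundamental domain. *)
Definition fold (t : R) : R := t - L%:num * (Num.floor (t / L%:num))%:~R.

Lemma fold_itv t : 0 <= fold t < L%:num.
Proof.
have /andP[h1 h2] := floor_itv (t / L%:num).
rewrite /fold subr_ge0 ltrBlDr -{3}(mulr1 L%:num) -mulrDr.
rewrite -(ler_pM2l (gt0 L)) (mulrC _ (t / _)) divfK// in h1.
rewrite -(ltr_pM2l (gt0 L)) (mulrC _ (t / _)) divfK// intrD in h2.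
by rewrite h1 addrC.
Qed.

Lemma fold_unique t (n : int) : 0 <= t - L%:num * n%:~R < L%:num ->
  fold t = t - L%:num * n%:~R.
Proof.
move=> /andP[h1 h2]; rewrite /fold; congr (_ - _ * _%:~R).
apply: floor_def; rewrite ler_pdivlMr// ltr_pdivrMr// intrD.
by apply/andP; split; lra.
Qed.

Lemma fold_id t : 0 <= t < L%:num -> fold t = t.
Proof. by move=> h; rewrite (@fold_unique t 0) ?mulr0 subr0. Qed.

Lemma foldE t : exists n : int, fold t = t + L%:num * n%:~R.
Proof. by exists (- Num.floor (t / L%:num)); rewrite /fold rmorphN/= mulrN. Qed.

Lemma measurable_fold : measurable_fun [set: mR] (fold : mR -> mR).
Proof.
have mf : measurable_fun [set: mR] (fun t : R => (Num.floor t)%:~R : R).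
  by apply: nondecreasing_measurable => // x y xy; rewrite ler_int le_floor.
apply: measurable_funB => //; apply: measurable_funM => //.
apply: (measurableT_comp mf); exact: measurable_funM.
Qed.

Lemma lebesgue_measure_shift (a : R) (A : set R) : measurable A ->
  leb ((fun t : R => t + a) @^-1` A) = leb A.
Proof.
have mshift : measurable_fun [set: mR] ((fun t : R => t + a) : mR -> mR).
  exact: measurable_funD.
move=> mA; apply/esym.
apply: (@lebesgue_measure_unique R (pushforward leb (fun t : mR => t + a : mR))) => //.
move=> _ [[x y]] _ <-; rewrite /pushforward/=.
transitivity (leb `]x - a, y - a]); last first.
  by congr (leb _); apply/seteqP; split => t /=; rewrite !in_itv/= ltrBlDr lerBrDr.
by rewrite !lebesgue_measure_itv/= !lte_fin ltrD2r -!EFinB; case: ifPn => // _; congr EFin; ring.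
Qed.

Lemma circleE A : circle A = leb (A `&` `[0, L%:num[).
Proof. by []. Qed.

Lemma circleE_oo A : measurable A -> circle A = leb (A `&` `]0, L%:num[).
Proof.
move=> mA; rewrite circleE.
have -> : A `&` `[0, L%:num[ = (A `&` `]0, L%:num[) `|` (A `&` [set 0]).
  apply/seteqP; split => [t /= [At]|t /=]; rewrite !in_itv/=.
    rewrite le_eqVlt => /andP[/predU1P[t0|t0] tL]; [by right; split|left].
    by split => //; rewrite t0.
  move=> [[At /andP[t0 tL]]|[At t0]]; split => //; first by rewrite tL ltW.
  by rewrite t0 lexx/=.
have l0 : leb (A `&` [set 0]) = 0%E.
  apply/eqP; rewrite eq_le measure_ge0 andbT.
  rewrite -(lebesgue_measure_set1 (0 : R)); apply: le_measure.
  - by rewrite inE; exact: measurableI.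
  - by rewrite inE.
  - exact: subIsetr.
rewrite measureU//; [by rewrite [X in (_ + X)%E]l0 adde0| | |].
- exact: measurableI.
- exact: measurableI.
- by apply/seteqP; split => // t /= [[_ +] [_ t0]]; rewrite t0 in_itv/= ltxx.
Qed.

(** Invariance of the circle measure is all that is needed from the group
structure of the torus; it passes to products without any change of variables
in several dimensions. *)
Definition circle_preserving (phi : mR -> mR) :=
  measurable_fun setT phi /\
  forall A, measurable A -> circle (phi @^-1` A) = circle A.

Lemma circle_preserving_comp phi psi : circle_preserving phi ->
  circle_preserving psi -> circle_preserving (phi \o psi).
Proof.
move=> [mphi cphi] [mpsi cpsi]; split; first exact: measurableT_comp.
move=> A mA; rewrite comp_preimage cpsi ?cphi//.
by rewrite -[X in measurable X]setTI; exact: mphi.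
Qed.

(** The rotation cuts the fundamental interval at [L - a] and exchanges the two
pieces, each by a translation of the line. *)
Lemma circle_preserving_rot0 a : 0 <= a < L%:num ->
  circle_preserving (fun t => fold (t + a)).
Proof.
move=> /andP[a0 aL]; split.
  by apply: (measurableT_comp measurable_fold); exact: measurable_funD.
move=> A mA; rewrite !circleE.
have -> : (fun t => fold (t + a)) @^-1` A `&` `[0, L%:num[ =
    ((fun t => t + a) @^-1` (A `&` `[a, L%:num[)) `|`
    ((fun t => t + (a - L%:num)) @^-1` (A `&` `[0, a[)).
  apply/seteqP; split => [t /= [At]|t /=]; rewrite !in_itv/=.
    move=> /andP[t0 tL]; have [taL|Lta] := ltP (t + a) L%:num.
      left; move: At; rewrite fold_id ?taL ?addr_ge0// => At.
      by split => //; apply/andP; split => //; lra.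
    right; move: At; rewrite (@fold_unique _ 1) ?mulr1.
      by move=> At; rewrite addrA; split => //; apply/andP; split; lra.
    by apply/andP; split; lra.
  move=> [[At]|[At]] /andP[t1 t2].
    by rewrite fold_id; [split => //; apply/andP; split; lra|apply/andP; split; lra].
  rewrite (@fold_unique _ 1) ?mulr1; last by apply/andP; split; lra.
  by rewrite -addrA; split => //; apply/andP; split; lra.
have mshift (b : R) (B : set mR) : measurable B -> measurable ((fun t : R => t + b) @^-1` B).
  move=> mB; rewrite -[X in measurable X]setTI.
  have mb : measurable_fun [set: mR] ((fun t : R => t + b) : mR -> mR).
    exact: measurable_funD.
  exact: mb.
have m1 : measurable (A `&` `[a, L%:num[) by exact: measurableI.
have m2 : measurable (A `&` `[0, a[) by exact: measurableI.
rewrite measureU; [|exact: mshift|exact: mshift|]; last first.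
  apply/seteqP; split => // t /= [[_ +] [_ +]]; rewrite !in_itv/=.
  by move=> /andP[h1 h2] /andP[h3 h4]; lra.
transitivity (leb (A `&` `[a, L%:num[) + leb (A `&` `[0%R, a[))%E.
  congr (_ + _)%E; exact: lebesgue_measure_shift.
rewrite -measureU//; last first.
  apply/seteqP; split => // t /= [[_ +] [_ +]]; rewrite !in_itv/=.
  by move=> /andP[h1 h2] /andP[h3 h4]; lra.
congr leb; rewrite -setIUr; congr (_ `&` _).
by rewrite setUC -itv_bndbnd_setU// bnd_simp ?ltW.
Qed.

Lemma fold_period t (n : int) : fold (t + L%:num * n%:~R) = fold t.
Proof.
rewrite (@fold_unique _ (Num.floor (t / L%:num) + n)); rewrite intrD mulrDr opprD addrACA subrr addr0//.
exact: fold_itv.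
Qed.

Lemma circle_preserving_rot a : circle_preserving (fun t => fold (t + a)).
Proof.
have -> : (fun t => fold (t + a)) = (fun t => fold (t + fold a)).
  by apply/funext => t; have [n ->] := foldE a; rewrite addrA fold_period.
exact/circle_preserving_rot0/fold_itv.
Qed.

Lemma circle_preserving_opp : circle_preserving (fun t => fold (- t)).
Proof.
split; first by apply: (measurableT_comp measurable_fold); exact: measurable_funN.
move=> A mA; rewrite !circleE_oo//; last first.
  rewrite -[X in measurable X]setTI.
  have mb : measurable_fun [set: mR] ((fun t : R => fold (- t)) : mR -> mR).
    by apply: (measurableT_comp measurable_fold); exact: measurable_funN.
  exact: (mb measurableT _ mA).
have mI : measurable (A `&` `]0, L%:num[) by exact: measurableI.
have mS : measurable ((fun t : R => t + L%:num) @^-1` (A `&` `]0, L%:num[)).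
  rewrite -[X in measurable X]setTI.
  have mb : measurable_fun [set: mR] ((fun t : R => t + L%:num) : mR -> mR).
    exact: measurable_funD.
  exact: (mb measurableT _ mI).
rewrite -[RHS](lebesgue_measure_shift L%:num mI) -[RHS](lebesgue_measureN mS).
congr leb; apply/seteqP; split => t /=; rewrite !in_itv/=.
  move=> [At /andP[t0 tL]]; move: At; rewrite (@fold_unique _ (-1)) ?mulrN1 ?opprK.
    by move=> At; split => //; apply/andP; split; lra.
  by apply/andP; split; lra.
move=> [At /andP[t0 tL]]; rewrite (@fold_unique _ (-1)) ?mulrN1 ?opprK.
  by split => //; apply/andP; split; lra.
by apply/andP; split; lra.
Qed.

Lemma circle_preserving_affine (b : bool) a :
  circle_preserving (fun t => fold ((-1) ^+ b * t + a)).
Proof.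
case: b; last first.
  by under eq_fun do rewrite expr0 mul1r; exact: circle_preserving_rot.
have -> : (fun t : R => fold ((-1) ^+ true * t + a)) =
    (fun t => fold (t + a)) \o (fun t => fold (- t)).
  apply/funext => t /=; have [n ->] := foldE (- t).
  by rewrite expr1 mulN1r addrAC fold_period.
apply: circle_preserving_comp; first exact: circle_preserving_rot.
exact: circle_preserving_opp.
Qed.

End circle.

(** * Integrals over the torus *)

Section measure_preserving.
Context d (T : measurableType d) (R : realType) (mu : {measure set T -> \bar R}).
Variable phi : T -> T.
Hypotheses (mphi : measurable_fun setT phi)
  (pphi : forall A, measurable A -> mu (phi @^-1` A) = mu A).

Lemma ge0_integral_preserving (f : T -> \bar R) : measurable_fun setT f ->
  (forall x, (0 <= f x)%E) -> (\int[mu]_x f (phi x) = \int[mu]_x f x)%E.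
Proof.
move=> mf f0; have := @ge0_integral_pushforward _ _ T T R phi mphi mu setT f
  measurableT mf (fun x _ => f0 x).
rewrite preimage_setT => <-.
by apply: eq_measure_integral => A mA _; exact: pphi.
Qed.

Lemma int_preserving (f : T -> R) : mu.-L1 f ->
  \int[mu]_x f (phi x) = \int[mu]_x f x.
Proof.
move=> fi; congr fine; rewrite (integralE mu _ (fun x => (f (phi x))%:E)).
rewrite [RHS]integralE; have mf := measurable_int mu fi; congr (_ - _)%E.
- rewrite -(ge0_integral_preserving (f := (EFin \o f)^\+%E))//; last exact: measurable_funepos.
  by apply: eq_integral => x _; rewrite -[LHS]/(((EFin \o f) \o phi)^\+%E x) funepos_comp.
- rewrite -(ge0_integral_preserving (f := (EFin \o f)^\-%E))//; last exact: measurable_funeneg.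
  by apply: eq_integral => x _; rewrite -[LHS]/(((EFin \o f) \o phi)^\-%E x) funeneg_comp.
Qed.

End measure_preserving.

Section torus_integrals.
Context {R : realType} (L : {posnum R}).
Local Notation circle := (circle_measure L).
Local Notation mR := (measurableTypeR R).

Lemma ge0_torus_integralS n (f : points R n.+1 -> \bar R) :
  measurable_fun setT f -> (forall x, (0 <= f x)%E) ->
  (\int[torus_measure L n.+1]_x f x =
   \int[circle]_t \int[torus_measure L n]_y f (cons_pair (t, y)))%E.
Proof.
move=> mf f0.
have := @ge0_integral_pushforward _ _ (mR * points R n)%type (points R n.+1) R
  (@cons_pair R n) (@measurable_cons_pair R n)
  (circle \x torus_measure L n)%E setT f measurableT mf (fun x _ => f0 x).
rewrite preimage_setT => h.
transitivity (\int[pushforward (circle \x torus_measure L n)%E (@cons_pair R n)]_x f x)%E.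
  by [].
rewrite h fubini_tonelli1//=.
exact: (measurableT_comp mf (@measurable_cons_pair R n)).
Qed.

Lemma int_torusS n (h : points R n.+1 -> R) : (torus_measure L n.+1).-L1 h ->
  (circle \x torus_measure L n)%E.-L1 (fun z => h (cons_pair z)) /\
  \int[torus_measure L n.+1]_x h x =
  \int[(circle \x torus_measure L n)%E]_z h (cons_pair z).
Proof.
move=> hi; have mh := measurable_int (torus_measure L n.+1) hi.
have hi' : (circle \x torus_measure L n)%E.-L1 (fun z => h (cons_pair z)).
  have /integrableP[_ hf] := hi; apply/integrableP; split.
    exact: (measurableT_comp mh (@measurable_cons_pair R n)).
  rewrite ge0_torus_integralS// in hf; last exact: measurableT_comp.
  rewrite (fubini_tonelli1 (fun z => `|(h (cons_pair z))%:E|%E))//.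
  apply: measurableT_comp => //.
  exact: (measurableT_comp mh (@measurable_cons_pair R n)).
split => //; congr fine.
have := @integral_pushforward _ _ (mR * points R n)%type (points R n.+1) R
  (@cons_pair R n) (@measurable_cons_pair R n)
  (circle \x torus_measure L n)%E setT (EFin \o h) mh.
by rewrite preimage_setT => /(_ hi' measurableT) <-.
Qed.

Definition tmap n (phi : 'I_n -> R -> R) (x : points R n) : points R n :=
  [tuple phi i (tnth x i) | i < n].

Lemma measurable_tmap n (phi : 'I_n -> mR -> mR) :
  (forall i, measurable_fun setT (phi i)) ->
  measurable_fun setT (tmap phi : points R n -> points R n).
Proof.
move=> mphi; apply/measurable_fun_tnthP => i.
rewrite (_ : _ \o _ = phi i \o (fun x : points R n => tnth x i)).
  exact: (measurableT_comp (mphi i) (measurable_tnth i)).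
by apply/funext => x /=; rewrite tnth_mktuple.
Qed.

Lemma tmap_cons n (phi : 'I_n.+1 -> R -> R) t (y : points R n) :
  tmap phi (cons_pair (t, y)) =
  cons_pair (phi ord0 t, tmap (fun i => phi (lift ord0 i)) y).
Proof.
apply: eq_from_tnth => i; rewrite tnth_mktuple.
case: (unliftP ord0 i) => [j ->|->].
  by rewrite /cons_pair/= !tnthS tnth_mktuple.
by rewrite /cons_pair/= !tnth0.
Qed.

(** Fubini in the first coordinate and induction on the dimension. *)
Lemma ge0_integral_tmap n (phi : 'I_n -> mR -> mR) (f : points R n -> \bar R) :
  (forall i, circle_preserving L (phi i)) ->
  measurable_fun setT f -> (forall x, (0 <= f x)%E) ->
  (\int[torus_measure L n]_x f (tmap phi x) = \int[torus_measure L n]_x f x)%E.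
Proof.
elim: n phi f => [|n IH] phi f pphi mf f0.
  by apply: eq_integral => x _; congr f; apply: eq_from_tnth => -[].
have mtmap := measurable_tmap (fun i => (pphi i).1).
rewrite !ge0_torus_integralS//; last exact: measurableT_comp mf mtmap.
pose F t := (\int[torus_measure L n]_y f (cons_pair (t, y)))%E.
have mcons t : measurable_fun setT (fun y => f (cons_pair (t, y))).
  exact: (measurableT_comp (measurableT_comp mf (@measurable_cons_pair R n)) (pair1_measurable t)).
transitivity (\int[circle]_t F (phi ord0 t))%E.
  apply: eq_integral => t _.
  under eq_integral do rewrite tmap_cons.
  exact: (IH _ (fun y => f (cons_pair (phi ord0 t, y)))).
have [mphi cphi] := pphi ord0.
apply: (ge0_integral_preserving mphi cphi) => [|t]; last exact: integral_ge0.
apply: (measurable_fun_fubini_tonelli_F (fun z => f (cons_pair z))) => //.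
exact: (measurableT_comp mf (@measurable_cons_pair R n)).
Qed.

Lemma torus_preserving n (phi : 'I_n -> mR -> mR) :
  (forall i, circle_preserving L (phi i)) ->
  forall A, measurable A ->
    torus_measure L n (tmap phi @^-1` A) = torus_measure L n A.
Proof.
move=> pphi A mA.
have mtA : measurable (tmap phi @^-1` A : set (points R n)).
  rewrite -[X in measurable X]setTI.
  by apply: (measurable_tmap (fun i => (pphi i).1)).
have E (B : set (points R n)) : measurable B ->
    torus_measure L n B = (\int[torus_measure L n]_x (\1_B x)%:E)%E.
  by move=> mB; rewrite integral_indic// setIT.
rewrite !E//.
rewrite -[RHS](ge0_integral_tmap pphi)//; last first.
  by apply/measurable_EFinP; exact: measurable_indic.
Qed.

Lemma int_tmap n (phi : 'I_n -> mR -> mR) (f : points R n -> R) :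
  (forall i, circle_preserving L (phi i)) -> (torus_measure L n).-L1 f ->
  \int[torus_measure L n]_x f (tmap phi x) = \int[torus_measure L n]_x f x.
Proof.
move=> pphi; apply: int_preserving; last exact: torus_preserving.
exact: (measurable_tmap (fun i => (pphi i).1)).
Qed.

Lemma measurable_prod_tnth n (g : 'I_n -> mR -> R) :
  (forall i, measurable_fun setT (g i)) ->
  measurable_fun setT (fun x : points R n => \prod_i g i (tnth x i)).
Proof.
move=> mg; apply: measurable_prod => i _.
exact: (measurableT_comp (mg i) (measurable_tnth i)).
Qed.

Lemma L1_torus_prod n (g : 'I_n -> mR -> R) C :
  (forall i, measurable_fun setT (g i)) -> (forall i t, `|g i t| <= C) ->
  (torus_measure L n).-L1 (fun x => \prod_i g i (tnth x i)).
Proof.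
move=> mg gC; apply: (@L1_bounded _ _ _ _ _ (C ^+ n)).
  exact: measurable_prod_tnth.
move=> x; rewrite normr_prod -[X in _ ^+ X]card_ord -prodr_const.
by apply: ler_prod => i _; rewrite normr_ge0 gC.
Qed.

Lemma int_torus_prod n (g : 'I_n -> mR -> R) C :
  (forall i, measurable_fun setT (g i)) -> (forall i t, `|g i t| <= C) ->
  \int[torus_measure L n]_x (\prod_i g i (tnth x i)) =
  \prod_i \int[circle]_t g i t.
Proof.
elim: n g => [|n IH] g mg gC.
  rewrite big_ord0; under eq_Rintegral do rewrite big_ord0.
  by rewrite Rintegral_cst// mul1r [X in fine X]torus_measureT expr0.
have [_ ->] := int_torusS (L1_torus_prod mg gC).
rewrite big_ord_recl -(IH (fun i => g (lift ord0 i)))//.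
have gi : circle.-L1 (g ord0) by apply: L1_bounded (gC ord0).
have pi := L1_torus_prod (fun i => mg (lift ord0 i)) (fun i => gC (lift ord0 i)).
rewrite -(int_tensor gi pi); apply: eq_Rintegral => -[t y] _ /=.
rewrite big_ord_recl tnth0; congr (_ * _).
by apply: eq_bigr => i _; rewrite tnthS.
Qed.

End torus_integrals.

(** * Periodic functions *)

Section trigonometric.
Context {R : realType} (L : {posnum R}).

Definition tcos (n : int) (t : R) : R := cos (2 * pi * n%:~R * t / L%:num).
Definition tsin (n : int) (t : R) : R := sin (2 * pi * n%:~R * t / L%:num).

Lemma periodic_int (f : R -> R) (T : R) (z : int) x : periodic f T ->
  f (x + T * z%:~R) = f x.
Proof.
move=> fT; case: z => n; first by rewrite -pmulrn mulr_natr (periodicn fT).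
rewrite NegzE rmorphN/= mulrN -pmulrn.
by rewrite -[in RHS](subrK (T * n.+1%:R) x) mulr_natr (periodicn fT).
Qed.

Lemma tcos_period n t (z : int) : tcos n (t + L%:num * z%:~R) = tcos n t.
Proof.
rewrite /tcos -[RHS](@periodic_int cos (pi *+ 2) (n * z) _ (@cosD2pi R)).
by congr cos; rewrite intrM -mulr_natr; field.
Qed.

Lemma tsin_period n t (z : int) : tsin n (t + L%:num * z%:~R) = tsin n t.
Proof.
rewrite /tsin -[RHS](@periodic_int sin (pi *+ 2) (n * z) _ (@sinD2pi R)).
by congr sin; rewrite intrM -mulr_natr; field.
Qed.

Lemma tcosN n t : tcos n (- t) = tcos n t.
Proof. by rewrite /tcos -cosN; congr cos; ring. Qed.

Lemma tsinN n t : tsin n (- t) = - tsin n t.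
Proof. by rewrite /tsin -sinN; congr sin; ring. Qed.

Lemma tcosB n s t : tcos n (s - t) = tcos n s * tcos n t + tsin n s * tsin n t.
Proof. by rewrite /tcos /tsin -cosB; congr cos; ring. Qed.

Lemma tcos_norm n t : `|tcos n t| <= 1. Proof. exact: cos_max. Qed.
Lemma tsin_norm n t : `|tsin n t| <= 1. Proof. exact: sin_max. Qed.

Lemma continuous_tcos n : continuous (tcos n).
Proof.
move=> t; apply: continuous_comp; last exact: continuous_cos.
by apply: cvgM; [apply: cvgM; [exact: cvg_cst|exact: cvg_id]|exact: cvg_cst].
Qed.

Lemma continuous_tsin n : continuous (tsin n).
Proof.
move=> t; apply: continuous_comp; last exact: continuous_sin.
by apply: cvgM; [apply: cvgM; [exact: cvg_cst|exact: cvg_id]|exact: cvg_cst].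
Qed.

Lemma measurable_tcos n : measurable_fun setT (tcos n).
Proof. by apply: continuous_measurable_fun; exact: continuous_tcos. Qed.

Lemma measurable_tsin n : measurable_fun setT (tsin n).
Proof. by apply: continuous_measurable_fun; exact: continuous_tsin. Qed.

(** The function [1 - tcos 1] vanishes on the fundamental interval only at the
points identified with the origin; it serves as a smooth substitute for the
squared distance to the origin of the circle. *)
Lemma tcos1_eq1 t : 0 <= t <= L%:num -> tcos 1 t = 1 -> t = 0 \/ t = L%:num.
Proof.
move=> /andP[t0 tL]; rewrite /tcos mulr1.
set x : R := 2 * pi * t / L%:num => cx.
have pi0 := @pi_gt0 R.
have x0 : 0 <= x by rewrite divr_ge0// !mulr_ge0// ltW.
have x2 : x <= 2 * pi.
  by rewrite ler_pdivrMr// ler_wpM2l// mulr_ge0// ltW.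
have cos1 (y : R) : 0 <= y <= pi -> cos y = 1 -> y = 0.
  move=> yp cy; apply: cos_inj; rewrite ?in_itv/= ?lexx ?(ltW pi0)//.
  by rewrite cos0.
have tE : t = L%:num * (x / (2 * pi)).
  have cancel (a b c : R) : b != 0 -> c != 0 -> a = c * (b * a / c / b).
    by move=> b0 c0; field; rewrite b0.
  by apply: cancel => //; rewrite gt_eqF// mulr_gt0.
have [xpi|pix] := leP x pi.
  by left; rewrite tE (cos1 x) ?x0// mul0r mulr0.
right; have : 2 * pi - x = 0.
  apply: cos1; first by apply/andP; split; lra.
  rewrite -[RHS]cx -cosN -[RHS](@periodic_int cos (pi *+ 2) (-1) x (@cosD2pi R)).
  by congr cos; rewrite mulrN1 mulr2n; ring.
by move=> h; rewrite tE (_ : x = 2 * pi) ?divff ?mulr1 ?gt_eqF ?mulr_gt0//; lra.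
Qed.

End trigonometric.

Section periodic_potential.
Context {R : realType} (L : {posnum R}) (d : nat) (W : 'rV[R]_d -> R).
Hypothesis (W_periodic : torus_periodic L W).

Lemma torus_periodic_int (z : 'I_d -> int) x :
  W (x + \row_i (L%:num * (z i)%:~R)) = W x.
Proof.
have step i (k : int) y : W (y + (L%:num * k%:~R) *: delta_mx 0 i) = W y.
  have stepn (n : nat) u : W (u + (L%:num * n%:R) *: delta_mx 0 i) = W u.
    elim: n u => [|n IH] u; first by rewrite mulr0 scale0r addr0.
    by rewrite -natr1 mulrDr mulr1 scalerDl addrA W_periodic.
  case: k => n; first exact: stepn.
  rewrite NegzE rmorphN/= mulrN scaleNr -[in RHS](subrK ((L%:num * n.+1%:R) *: delta_mx 0 i) y).
  by rewrite stepn.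
have -> : \row_i (L%:num * (z i)%:~R) =
    \sum_i (L%:num * (z i)%:~R) *: delta_mx 0 i :> 'rV[R]_d.
  rewrite [LHS]matrix_sum_delta big_ord1; apply: eq_bigr => i _.
  by rewrite mxE.
elim: (index_enum _) x => [|i s IH] x; first by rewrite big_nil addr0.
by rewrite big_cons addrA IH step.
Qed.

Definition foldv (x : 'rV[R]_d) : 'rV[R]_d := \row_i fold L (x 0 i).

Lemma foldvE x : exists z : 'I_d -> int, foldv x = x + \row_i (L%:num * (z i)%:~R).
Proof.
have /choice[z zE] := fun i => foldE L (x 0 i).
by exists z; apply/rowP => i; rewrite !mxE zE.
Qed.

Lemma W_foldv x : W (foldv x) = W x.
Proof. by have [z ->] := foldvE x; rewrite torus_periodic_int. Qed.

Hypothesis (W_cont : continuous W).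

Let box : set 'rV[R]_d := [set v | forall i, `[0, L%:num]%classic (v ord0 i)].

Let compact_box : compact box.
Proof.
exact: (@rV_compact _ d (fun=> `[0, L%:num]%classic)
  (fun=> @segment_compact R 0 L%:num)).
Qed.

Let foldv_box x : box (foldv x).
Proof.
move=> i /=; rewrite mxE in_itv/=.
by have /andP[-> /ltW ->] := fold_itv L (x 0 i).
Qed.

Lemma continuous_coordP (x : 'rV[R]_d) (e : R) : 0 < e -> exists2 r : R, 0 < r &
  forall y : 'rV[R]_d, (forall i, `|x 0 i - y 0 i| < r) -> `|W x - W y| < e.
Proof.
move=> e0; have Wx : W @ x --> W x by exact: W_cont.
have /cvgrPdist_lt/(_ _ e0)/nbhs_ballP[r /= r0 H] := Wx.
by exists r => // y xy; apply: H; split => // i j; rewrite !ord1; exact: xy.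
Qed.

Lemma W_bounded : exists2 C : R, 0 <= C & forall x, `|W x| <= C.
Proof.
have cW : {within box, continuous (fun x => - `|W x|)}.
  apply: continuous_subspaceT => x.
  have Wx : W @ x --> W x by exact: W_cont.
  exact: (cvgN (cvg_norm Wx)).
have box0 : box !=set0 by exists (foldv 0); exact: foldv_box.
have [c _ cmax] := compact_EVT_min box0 compact_box cW.
exists `|W c| => // x; rewrite -W_foldv -lerN2; apply: cmax.
by apply/mem_set; exact: foldv_box.
Qed.

(** Uniform continuity, with the modulus expressed through [1 - tcos 1] so that
it can be integrated against a trigonometric kernel. On the compact set of
pairs where [W] varies by at least [e] the sum of these gauges does not vanish,
because [z] is then not a period; hence it has a positive minimum there, and
boundedness of [W] gives the constant. *)
Lemma W_modulus (e : R) : 0 < e -> exists2 M : R, 0 <= M &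
  forall x z : 'rV[R]_d, `|W (x - z) - W x| <= e + M * \sum_i (1 - tcos L 1 (z 0 i)).
Proof.
move=> e0; have [C C0 WC] := W_bounded.
pose Phi (z : 'rV[R]_d) := \sum_i (1 - tcos L 1 (z 0 i)).
have Phi0 z : 0 <= Phi z.
  by apply: sumr_ge0 => i _; rewrite subr_ge0 cos_le1.
have Phi_fold z : Phi (foldv z) = Phi z.
  apply: eq_bigr => i _; rewrite mxE; have [n ->] := foldE L (z 0 i).
  by rewrite tcos_period.
pose D (p : 'rV[R]_d * 'rV[R]_d) := `|W (p.1 - p.2) - W p.1|.
have D_fold x z : D (foldv x, foldv z) = D (x, z).
  rewrite /D/= W_foldv; congr `|_ - _|.
  have [a ->] := foldvE x; have [b ->] := foldvE z.
  rewrite opprD addrACA -[RHS](torus_periodic_int (fun i => a i - b i)); congr (W (_ + _)).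
  by apply/rowP => i; rewrite !mxE rmorphB/= mulrBr.
suff [M M0 HM] : exists2 M : R, 0 <= M &
    forall x z, box x -> box z -> D (x, z) <= e + M * Phi z.
  exists M => // x z; rewrite -[leLHS]/(D (x, z)) -D_fold -/(Phi z) -Phi_fold.
  by apply: HM; exact: foldv_box.
have contD : continuous D.
  move=> p.
  have c1 : (fun q : 'rV[R]_d * 'rV[R]_d => q.1) @ p --> p.1 by exact: cvg_fst.
  have c2 : (fun q : 'rV[R]_d * 'rV[R]_d => q.2) @ p --> p.2 by exact: cvg_snd.
  have W1 : (fun q : 'rV[R]_d * 'rV[R]_d => W q.1) @ p --> W p.1.
    by apply: (cvg_comp _ _ c1); exact: W_cont.
  have c12 : (fun q : 'rV[R]_d * 'rV[R]_d => q.1 - q.2) @ p --> p.1 - p.2.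
    exact: cvgB.
  have W12 : (fun q : 'rV[R]_d * 'rV[R]_d => W (q.1 - q.2)) @ p --> W (p.1 - p.2).
    by apply: (cvg_comp _ _ c12); exact: W_cont.
  exact: (cvg_norm (cvgB W12 W1)).
pose S := (box `*` box) `&` [set p | e <= D p].
have cS : compact S.
  apply: compact_closedI; first exact: compact_setX.
  apply: (@preimage_closed _ _ D [set r | e <= r]); last exact: closed_ge.
  by move=> p _; exact: contD.
have [S0|/set0P S0] := eqVneq S set0.
  exists 0 => // x z bx bz; rewrite mul0r addr0 leNgt; apply/negP => he.
  have : S (x, z) by split => //=; exact: ltW.
  by rewrite S0.
have contPhi : {within S, continuous (fun p : 'rV[R]_d * 'rV[R]_d => Phi p.2)}.
  apply: continuous_subspaceT => p; rewrite /Phi.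
  elim: (index_enum _) => [|i s IH].
    under eq_fun do rewrite big_nil; exact: cvg_cst.
  under eq_fun do rewrite big_cons.
  apply: cvgD; last exact: IH.
  apply: cvgB; first exact: cvg_cst.
  have c2 : (fun q : 'rV[R]_d * 'rV[R]_d => q.2) @ p --> p.2 by exact: cvg_snd.
  have ci : (fun q : 'rV[R]_d * 'rV[R]_d => q.2 0 i) @ p --> p.2 0 i.
    exact: (cvg_comp _ _ c2 (@coord_continuous R 1 d 0 i p.2)).
  have c3 : (fun q : 'rV[R]_d * 'rV[R]_d => tcos L 1 (q.2 0 i)) @ p --> tcos L 1 (p.2 0 i).
    exact: (cvg_comp _ _ ci (@continuous_tcos R L 1 (p.2 0 i))).
  exact: c3.
have [p /set_mem Sp pmin] := compact_EVT_min S0 cS contPhi.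
have Phip : 0 < Phi p.2.
  rewrite lt_neqAle Phi0 andbT eq_sym; apply/negP => /eqP Phip.
  have [[b1 b2] /= he] := Sp.
  have zE : forall i, exists n : int, p.2 0 i = - (L%:num * n%:~R).
    move=> i; have h i' : true -> 0 <= 1 - tcos L 1 (p.2 0 i').
      by rewrite subr_ge0 cos_le1.
    have hi := psumr_eq0P h Phip (i := i) isT.
    have := b2 i; rewrite /= in_itv/= => pi.
    have [|->|->] := tcos1_eq1 pi; first by lra.
      by exists 0; rewrite mulr0 oppr0.
    by exists (-1); rewrite mulrN1 opprK.
  have [z {}zE] := choice zE.
  move: he; rewrite /D (_ : p.1 - p.2 = p.1 + \row_i (L%:num * (z i)%:~R)).
    by rewrite torus_periodic_int subrr normr0 leNgt e0.
  by congr (_ + _); apply/rowP => i; rewrite !mxE zE opprK.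
exists (2 * C / Phi p.2) => [|x z bx bz]; first by rewrite divr_ge0 ?mulr_ge0.
have [Dz|eD] := ltP (D (x, z)) e.
  by apply: le_trans (ltW Dz) _; rewrite lerDl mulr_ge0 ?divr_ge0 ?mulr_ge0.
have /pmin/= Pz : (x, z) \in S by apply/mem_set.
have : D (x, z) <= 2 * C.
  by rewrite /D/= (le_trans (ler_normB _ _))// mulr2n mulrDl mul1r lerD.
have : 2 * C <= 2 * C / Phi p.2 * Phi z.
  by rewrite mulrAC ler_pdivlMr// ler_wpM2l// mulr_ge0.
lra.
Qed.

(** Continuity is for the topology of row vectors and measurability for the
product sigma-algebra. The bridge is approximation: rounding the coordinates
down to multiples of [1 / (n + 1)] makes [W] take countably many values on
measurable cells. *)
Lemma measurable_W dT (T : measurableType dT) (F : T -> 'rV[R]_d) :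
  (forall i, measurable_fun setT (fun x => F x 0 i)) ->
  measurable_fun setT (fun x => W (F x)).
Proof.
move=> mF.
pose G (n : nat) x : 'rV[int]_d := \row_i Num.floor (n.+1%:R * F x 0 i).
pose H (n : nat) (k : 'rV[int]_d) : R := W (\row_i ((k 0 i)%:~R / n.+1%:R)).
apply: (@measurable_fun_cvg _ _ _ _ (fun n x => H n (G n x))).
  move=> n _ Y mY; rewrite setTI.
  have -> : (fun x => H n (G n x)) @^-1` Y =
      \bigcup_k [set x | Y (H n k) /\ G n x = k].
    apply/seteqP; split => [x Yx|x [k _ [Yk Gk]]]; first by exists (G n x).
    by rewrite /= Gk.
  apply: countable_bigcupT_measurable => // k.
  have [Yk|nYk] := pselect (Y (H n k)); last first.
    by rewrite (_ : [set x | _] = set0)//; apply/seteqP; split => x // [].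
  have -> : [set x | Y (H n k) /\ G n x = k] =
      \bigcap_(i in [set: 'I_d]) ((fun x => n.+1%:R * F x 0 i) @^-1`
         `[(k 0 i)%:~R, (k 0 i + 1)%:~R[).
    apply/seteqP; split => [x [_ <-] i _|x Gx].
      by rewrite /= in_itv/= mxE floor_itv.
    split => //; apply/rowP => i; rewrite mxE; apply: floor_def.
    by have := Gx i I; rewrite /= in_itv.
  apply: fin_bigcap_measurable => // i _; rewrite -[X in measurable X]setTI.
  have mi : measurable_fun setT (fun x => n.+1%:R * F x 0 i).
    by apply: measurable_funM => //; exact: mF.
  by apply: mi => //; exact: measurable_itv.
move=> x _; apply/cvgrPdist_lt => e e0.
have [r r0 Hr] := continuous_coordP (F x) e0.
have [N _ HN] := near_infty_natSinv_lt (PosNum r0).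
exists N => // n /= Nn; apply: Hr => i; rewrite !mxE.
apply: le_lt_trans (HN n Nn).
have n0 : (0 : R) < n.+1%:R by rewrite ltr0n.
have /andP[] := floor_itv (n.+1%:R * F x 0 i); set f := Num.floor _.
rewrite intrD => h1 h2.
have -> : F x 0 i - f%:~R / n.+1%:R = (n.+1%:R * F x 0 i - f%:~R) / n.+1%:R.
  by field; rewrite gt_eqF.
rewrite ger0_norm; last by rewrite divr_ge0 ?subr_ge0.
by rewrite ler_pdivrMr// mulVf ?gt_eqF//; lra.
Qed.

End periodic_potential.

(** * The Fejer kernel *)

Section circle_trigonometric_integrals.
Context {R : realType} (L : {posnum R}).
Local Notation circle := (circle_measure L).

Lemma L1_tcos n : circle.-L1 (tcos L n).
Proof.
apply: (@L1_bounded _ _ _ _ _ 1); last exact: tcos_norm.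
exact: measurable_tcos.
Qed.

Lemma tcos0 t : tcos L 0 t = 1.
Proof. by rewrite /tcos mulr0 !mul0r cos0. Qed.

Lemma circle_int_cst (c : R) : \int[circle]_t c = c * L%:num.
Proof. by rewrite Rintegral_cst// [X in fine X]circle_measureT. Qed.

Lemma tcos_half_period (n : int) t : n != 0 ->
  tcos L n (t + L%:num / (2 * n%:~R)) = - tcos L n t.
Proof.
move=> n0; rewrite /tcos -(cosDpi (2 * pi * n%:~R * t / L%:num)); congr cos.
have nr : n%:~R != 0 :> R by rewrite intr_eq0.
rewrite mulrDr mulrDl; congr (_ + _).
have cancel (p l k : R) : l != 0 -> k != 0 -> 2 * p * k * (l / (2 * k)) / l = p.
  by move=> l0 k0; field; rewrite l0.
exact: cancel.
Qed.

(** Shifting by half a period changes the sign of a nonconstant cosine. *)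
Lemma int_tcos n : \int[circle]_t tcos L n t = if n == 0 then L%:num else 0.
Proof.
case: eqVneq => [->|n0].
  by under eq_Rintegral do rewrite tcos0; rewrite circle_int_cst mul1r.
have [mrot prot] := circle_preserving_rot L (L%:num / (2 * n%:~R)).
have := int_preserving mrot prot (L1_tcos n).
rewrite (_ : (fun t => tcos L n (fold L _)) = (fun t => (-1) * tcos L n t)).
  by rewrite intZ; [lra|exact: L1_tcos].
apply/funext => t; have [z ->] := foldE L (t + L%:num / (2 * n%:~R)).
by rewrite tcos_period tcos_half_period// mulN1r.
Qed.

(** The Fejer kernel, as a double sum instead of a sum with triangular weights:
a product of such kernels then expands into cosines all of the same positive
weight, and positivity is visible since the double sum is the sum of the squares
of a sum of cosines and a sum of sines. *)
Definition fejer (N : nat) (t : R) : R :=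
  N.+1%:R^-1 * \sum_(p : 'I_N.+1 * 'I_N.+1) tcos L (p.1%:Z - p.2%:Z) t.

Lemma fejer_ge0 N t : 0 <= fejer N t.
Proof.
rewrite /fejer mulr_ge0 ?invr_ge0//.
rewrite -(pair_bigA _ (fun p q : 'I_N.+1 => tcos L (p%:Z - q%:Z) t))/=.
have E (p q : 'I_N.+1) : tcos L (p%:Z - q%:Z) t =
    tcos L p%:Z t * tcos L q%:Z t + tsin L p%:Z t * tsin L q%:Z t.
  by rewrite /tcos /tsin -cosB; congr cos; rewrite rmorphB/=; ring.
under eq_bigr => p _ do under eq_bigr => q _ do rewrite E.
under eq_bigr => p _ do rewrite big_split/= -!mulr_sumr.
by rewrite big_split/= -!mulr_suml -!expr2 addr_ge0 ?sqr_ge0.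
Qed.

Lemma fejer_le N t : fejer N t <= N.+1%:R.
Proof.
rewrite /fejer ler_pdivrMl ?ltr0n//.
apply: le_trans (_ : \sum_(p : 'I_N.+1 * 'I_N.+1) 1 <= _).
  by apply: ler_sum => p _; exact: cos_le1.
by rewrite sumr_const card_prod card_ord natrM.
Qed.

Lemma fejer_norm N t : `|fejer N t| <= N.+1%:R.
Proof. by rewrite ger0_norm ?fejer_le ?fejer_ge0. Qed.

Lemma measurable_fejer N : measurable_fun setT (fejer N).
Proof.
apply: measurable_funM => //; apply: measurable_sum => p.
exact: measurable_tcos.
Qed.

Lemma L1_fejer N : circle.-L1 (fejer N).
Proof.
apply: (@L1_bounded _ _ _ _ _ N.+1%:R); last exact: fejer_norm.
exact: measurable_fejer.
Qed.

Lemma int_fejer N : \int[circle]_t fejer N t = L%:num.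
Proof.
rewrite intZ; last by apply: L1_sum => p; exact: L1_tcos.
rewrite int_sum; last by move=> p; exact: L1_tcos.
under eq_bigr do rewrite int_tcos.
rewrite -(pair_bigA _ (fun p q : 'I_N.+1 => if p%:Z - q%:Z == 0 then L%:num else 0))/=.
under eq_bigr => p _.
  rewrite (bigD1 p)//= subrr eqxx big1 ?addr0 => [|q qp]; last first.
    by rewrite subr_eq0 eqz_nat ifF//; apply: contraNF qp => /eqP pq; apply/eqP/val_inj.
  over.
by rewrite sumr_const card_ord -(mulr_natl L%:num) mulrA mulVf ?mul1r// pnatr_eq0.
Qed.

Lemma int_tcosM1 n : \int[circle]_t (tcos L n t * tcos L 1 t) =
  2^-1 * ((if n + 1 == 0 then L%:num else 0) + (if n - 1 == 0 then L%:num else 0)).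
Proof.
have E t : tcos L n t * tcos L 1 t = 2^-1 * (tcos L (n + 1) t + tcos L (n - 1) t).
  have -> : tcos L (n + 1) t = tcos L n t * tcos L 1 t - tsin L n t * tsin L 1 t.
    by rewrite /tcos /tsin -cosD; congr cos; rewrite rmorphD/=; ring.
  have -> : tcos L (n - 1) t = tcos L n t * tcos L 1 t + tsin L n t * tsin L 1 t.
    by rewrite /tcos /tsin -cosB; congr cos; rewrite rmorphB/=; ring.
  by field.
under eq_Rintegral do rewrite E.
rewrite intZ ?intD; [|exact: L1_tcos..|by apply: L1D; exact: L1_tcos].
by rewrite !int_tcos.
Qed.

(** Used for the superdiagonal and, after transposition, the subdiagonal: the
[N] frequency pairs at distance one that resonate with [tcos 1]. *)
Lemma sum_diag_ge N (f : 'I_N.+1 -> 'I_N.+1 -> R) (c : R) :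
  (forall p q, 0 <= f p q) ->
  (forall i : 'I_N, c <= f (widen_ord (leqnSn N) i) (lift ord0 i)) ->
  N%:R * c <= \sum_p \sum_q f p q.
Proof.
move=> f0 fc; rewrite big_ord_recr/=.
rewrite -[leLHS]addr0 lerD ?sumr_ge0//.
rewrite mulr_natl -[X in _ *+ X](card_ord N) -sumr_const.
apply: ler_sum => i _; rewrite (bigD1 (lift ord0 i))//=.
by rewrite -[leLHS]addr0 lerD ?sumr_ge0.
Qed.

(** Only the frequencies [1] and [-1] of the kernel survive against [tcos 1];
they carry [2 N] of the pairs, so that all but a fraction [1 / (N + 1)] of the
mass is recovered. *)
Lemma int_fejer_moment N :
  \int[circle]_t (fejer N t * (1 - tcos L 1 t)) <= L%:num / N.+1%:R.
Proof.
have i1 : circle.-L1 (fun t => fejer N t * tcos L 1 t).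
  apply: (@L1_mulr _ _ _ _ _ _ N.+1%:R); last exact: L1_tcos.
    exact: measurable_fejer.
  exact: fejer_norm.
have -> : (fun t => fejer N t * (1 - tcos L 1 t)) =
    (fun t => fejer N t - fejer N t * tcos L 1 t).
  by apply/funext => t; rewrite mulrBr mulr1.
rewrite intB ?int_fejer//; last exact: L1_fejer.
have i2 (p : 'I_N.+1 * 'I_N.+1) :
    circle.-L1 (fun t => tcos L (p.1%:Z - p.2%:Z) t * tcos L 1 t).
  apply: (@L1_mulr _ _ _ _ _ _ 1); last exact: L1_tcos.
    exact: measurable_tcos.
  exact: tcos_norm.
have -> : (fun t => fejer N t * tcos L 1 t) = (fun t => N.+1%:R^-1 *
    \sum_(p : 'I_N.+1 * 'I_N.+1) tcos L (p.1%:Z - p.2%:Z) t * tcos L 1 t).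
  by apply/funext => t; rewrite /fejer -mulrA mulr_suml.
rewrite intZ; last exact: L1_sum.
rewrite int_sum//; under eq_bigr do rewrite int_tcosM1.
rewrite -(pair_bigA _ (fun p q : 'I_N.+1 => 2^-1 *
   ((if p%:Z - q%:Z + 1 == 0 then L%:num else 0) +
    (if p%:Z - q%:Z - 1 == 0 then L%:num else 0))))/=.
under eq_bigr => p _ do rewrite -mulr_sumr big_split/=.
rewrite -mulr_sumr big_split/=.
set A := \sum_p _; set B := \sum_p _.
have hA : N%:R * L%:num <= A.
  apply: sum_diag_ge => [p q|i]; first by case: ifP.
  by rewrite ifT//= /bump/=; lia.
have hB : N%:R * L%:num <= B.
  rewrite /B exchange_big/=.
  apply: (@sum_diag_ge _ (fun q p : 'I_N.+1 => if p%:Z - q%:Z - 1 == 0 then L%:num else 0)) => [p q|i].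
    by case: ifP.
  by rewrite ifT//= /bump/=; lia.
have n0 : (0 : R) < N.+1%:R by rewrite ltr0n.
rewrite ler_pdivlMr// mulrBl mulrAC mulVf ?gt_eqF// mul1r -natr1; lra.
Qed.

End circle_trigonometric_integrals.

(** * Cosine coefficients of the potential *)

Section periodic_continuous_functions.
Context {R : realType} (L : {posnum R}) (d : nat).
Local Notation dx := (torus_measure L d).
Implicit Types (h : 'rV[R]_d -> R) (v : 'rV[R]_d).

Definition periodic_continuous h := torus_periodic L h /\ continuous h.

(** These maps preserve the torus measure and the continuous periodic functions;
they are all the changes of variables that convolutions and evenness require. *)
Definition affine (b : 'I_d -> bool) (a : 'I_d -> R) v : 'rV[R]_d :=
  \row_i ((-1) ^+ b i * v 0 i + a i).

Lemma pc_L1 h : periodic_continuous h -> dx.-L1 (fun x => h (vec x)).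
Proof.
move=> [hp hc]; have [C _ hC] := W_bounded hp hc.
apply: (@L1_bounded _ _ _ _ _ C) => // .
apply: (measurable_W hc) => i.
rewrite (_ : (fun x => _) = (fun x : points R d => tnth x i)).
  exact: measurable_tnth.
by apply/funext => x; rewrite mxE.
Qed.

Lemma pcM h1 h2 : periodic_continuous h1 -> periodic_continuous h2 ->
  periodic_continuous (fun v => h1 v * h2 v).
Proof.
move=> [p1 c1] [p2 c2]; split=> [i v|v]; first by rewrite p1 p2.
have C1 : h1 @ v --> h1 v by exact: c1.
have C2 : h2 @ v --> h2 v by exact: c2.
exact: (cvgM C1 C2).
Qed.

Lemma pc_prod (f : 'I_d -> R -> R) :
  (forall i t, f i (t + L%:num) = f i t) -> (forall i, continuous (f i)) ->
  periodic_continuous (fun v => \prod_i f i (v 0 i)).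
Proof.
move=> fL fc; split=> [i v|v].
  apply: eq_bigr => j _; rewrite !mxE eqxx/=.
  by case: eqVneq => [->|_]; rewrite ?mulr1 ?fL// mulr0 addr0.
have key (s : seq 'I_d) : (fun u : 'rV[R]_d => \prod_(i <- s) f i (u 0 i) : R) @ v -->
    (\prod_(i <- s) f i (v 0 i) : R); last exact: key.
elim: s => [|i s IH].
  rewrite big_nil (_ : (fun u : 'rV[R]_d => _) = fun=> 1 : R).
    exact: (@cvg_cst R (1 : R) _ (nbhs v) (nbhs_filter v)).
  by apply/funext => u; rewrite big_nil.
rewrite big_cons (_ : (fun u : 'rV[R]_d => _) =
  fun u => f i (u 0 i) * \prod_(j <- s) f j (u 0 j)); last first.
  by apply/funext => u; rewrite big_cons.
have ci : (fun u : 'rV[R]_d => u 0 i) @ v --> v 0 i by exact: coord_continuous.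
have c3 : (fun u : 'rV[R]_d => f i (u 0 i)) @ v --> f i (v 0 i).
  exact: (cvg_comp _ _ ci (fc i (v 0 i))).
exact: (cvgM c3 IH).
Qed.

Lemma pc_affine b a h : periodic_continuous h -> periodic_continuous (fun v => h (affine b a v)).
Proof.
move=> [hp hc].
have key (v : 'rV[R]_d) : (fun u : 'rV[R]_d => h (affine b a u)) @ v --> h (affine b a v).
  apply/(@cvgrPdist_lt R R^o _ (nbhs v) (nbhs_filter v)) => e e0.
  have [r r0 Hr] := continuous_coordP hc (affine b a v) e0.
  apply/nbhs_ballP; exists r => //= u [_ vu]; apply: Hr => i; rewrite !mxE.
  have -> : (-1) ^+ b i * v 0 i + a i - ((-1) ^+ b i * u 0 i + a i) =
    (-1) ^+ b i * (v 0 i - u 0 i) by ring.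
  by rewrite normrM normrX normrN1 expr1n mul1r; exact: vu.
split=> [i v|v]; last exact: key.
rewrite -[RHS](torus_periodic_int hp (fun j => if j == i then (-1) ^+ b i else 0)).
congr h; apply/rowP => j; rewrite !mxE eqxx/=; case: eqVneq => [->|ji].
  by rewrite mulr1 rmorphXn/= rmorphN1; ring.
by rewrite !mulr0 !addr0.
Qed.

Lemma int_affine b a h : periodic_continuous h ->
  \int[dx]_x h (affine b a (vec x)) = \int[dx]_x h (vec x).
Proof.
move=> nh; have [hp hc] := nh.
have pphi i : circle_preserving L (fun t => fold L ((-1) ^+ b i * t + a i)).
  exact: circle_preserving_affine.
rewrite -(int_tmap pphi (pc_L1 nh)); apply: eq_Rintegral => x _.
rewrite -(W_foldv hp); congr h; apply/rowP => i.
by rewrite !mxE tnth_mktuple.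
Qed.

End periodic_continuous_functions.

Section fourier_potential.
Context {R : realType} (L : {posnum R}) (d : nat) (W : 'rV[R]_d -> R).
Local Notation dx := (torus_measure L d).
Hypotheses (nW : periodic_continuous L W) (W_even : coordinatewise_even W).

Definition cosine (n : 'I_d -> int) (v : 'rV[R]_d) : R :=
  \prod_i tcos L (n i) (v 0 i).

Lemma pc_cosine n : periodic_continuous L (cosine n).
Proof.
apply: (pc_prod (f := fun i => tcos L (n i))) => [i t|i]; last exact: continuous_tcos.
by have := tcos_period L (n i) t 1; rewrite mulr1.
Qed.

Lemma cosine_norm n v : `|cosine n v| <= 1.
Proof.
rewrite normr_prod; apply: prodr_ile1 => i _.
by rewrite normr_ge0 tcos_norm.
Qed.

Lemma W_flip (b : 'I_d -> bool) v : W (affine b (fun=> 0) v) = W v.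
Proof.
pose fl (s : seq 'I_d) : 'rV[R]_d := \row_j (if j \in s then - v 0 j else v 0 j).
have key s : uniq s -> W (fl s) = W v.
  elim: s => [_|i s IH /= /andP[si us]].
    by congr W; apply/rowP => j; rewrite mxE in_nil.
  rewrite -IH// -[RHS](W_even i); congr W; apply/rowP => j; rewrite !mxE in_cons.
  by case: eqVneq => [->|_]/=; rewrite ?(negbTE si).
rewrite -(key [seq i <- index_enum _ | b i]).
  congr W; apply/rowP => j; rewrite !mxE mem_filter mem_index_enum andbT addr0.
  by case: (b j); rewrite ?mulN1r ?mul1r.
by rewrite filter_uniq// index_enum_uniq.
Qed.

Definition cos_coeff (n : 'I_d -> int) : R :=
  \int[dx]_x (W (vec x) * cosine n (vec x)).

Lemma L1_Wcosine n b a :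
  dx.-L1 (fun x => W (vec x) * cosine n (affine b a (vec x))).
Proof.
exact: (pc_L1 (pcM nW (pc_affine b a (pc_cosine n)))).
Qed.

(** The potential is unchanged when coordinates are reflected. Averaging the
shifted cosine over all reflections kills every sine in its addition formula
and leaves the product of the cosines. *)
Lemma int_Wcosine_shift n (u : 'rV[R]_d) :
  \int[dx]_x (W (vec x) * cosine n (u - vec x)) = cosine n u * cos_coeff n.
Proof.
pose sgn (b : bool) : R := (-1) ^+ b.
have flip (b : {ffun 'I_d -> bool}) :
    \int[dx]_x (W (vec x) * cosine n (u - vec x)) =
    \int[dx]_x (W (vec x) * cosine n (affine b (u 0) (vec x))).
  pose h v := W v * cosine n (affine (fun=> true) (u 0) v).
  have nh : periodic_continuous L h := pcM nW (pc_affine _ _ (pc_cosine n)).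
  transitivity (\int[dx]_x h (vec x)).
    apply: eq_Rintegral => x _; congr (_ * cosine _ _).
    by apply/rowP => i; rewrite !mxE expr1 mulN1r addrC.
  rewrite -(int_affine (fun i => ~~ b i) (fun=> 0) nh).
  apply: eq_Rintegral => x _; rewrite /h W_flip; congr (_ * cosine _ _).
  by apply/rowP => i; rewrite !mxE addr0; case: (b i); rewrite ?expr1 ?expr0; ring.
have two : (2 ^+ d : R) != 0 by rewrite expf_neq0.
apply: (mulfI two).
have -> : 2 ^+ d * \int[dx]_x (W (vec x) * cosine n (u - vec x)) =
    \sum_(b : {ffun 'I_d -> bool})
      \int[dx]_x (W (vec x) * cosine n (affine b (u 0) (vec x))).
  under eq_bigr do rewrite -flip.
  by rewrite sumr_const card_ffun card_bool card_ord -[RHS]mulr_natl natrX.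
rewrite -int_sum; last by move=> b; exact: L1_Wcosine.
rewrite mulrA /cos_coeff -intZ; last exact: (pc_L1 (pcM nW (pc_cosine n))).
apply: eq_Rintegral => x _; rewrite -mulr_sumr mulrCA; congr (_ * _).
have -> : \sum_(b : {ffun 'I_d -> bool}) cosine n (affine b (u 0) (vec x)) =
    \sum_(b : {ffun 'I_d -> bool})
      \prod_i tcos L (n i) ((-1) ^+ b i * vec x 0 i + u 0 i).
  by apply: eq_bigr => b _; apply: eq_bigr => i _; rewrite mxE.
rewrite -(bigA_distr_bigA (fun i (b : bool) => tcos L (n i) ((-1) ^+ b * vec x 0 i + u 0 i))).
rewrite -mulrA -[X in _ ^+ X](card_ord d) -prodr_const -!big_split/=.
apply: eq_bigr => i _; rewrite big_bool/= expr1 expr0 mulN1r mul1r.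
have -> : - vec x 0 i + u 0 i = u 0 i - vec x 0 i by ring.
have -> : vec x 0 i + u 0 i = u 0 i - (- vec x 0 i) by ring.
by rewrite !tcosB tcosN tsinN; ring.
Qed.

End fourier_potential.

(** * The convolution kernel *)

Section convolution_kernel.
Context {R : realType} (L : {posnum R}) (d : nat) (W : 'rV[R]_d -> R).
Local Notation dx := (torus_measure L d).
Hypotheses (nW : periodic_continuous L W) (W_even : coordinatewise_even W).

Definition conv_kernel (z : points R d * points R d) : R := W (vec z.1 - vec z.2).

Lemma conv_kernel_bounded : exists C, bounded_kernel conv_kernel C.
Proof.
have [hp hc] := nW; have [C _ hC] := W_bounded hp hc.
exists C; split; last by move=> z; exact: hC.
apply: (measurable_W hc) => i.
rewrite (_ : (fun z => _) = (fun z : points R d * points R d => tnth z.1 i - tnth z.2 i)).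
  apply: measurable_funB.
    exact: (measurableT_comp (measurable_tnth i) measurable_fst).
  exact: (measurableT_comp (measurable_tnth i) measurable_snd).
by apply/funext => z; rewrite !mxE.
Qed.

(** Invariance of the torus measure under reflections and translations. *)
Lemma conv_kernel_marginal1 x : \int[dx]_y W (vec y) = 0 ->
  \int[dx]_y conv_kernel (x, y) = 0.
Proof.
move=> <-; rewrite -(int_affine (fun=> true) (vec x 0) nW).
apply: eq_Rintegral => y _; congr W; apply/rowP => i.
by rewrite !mxE expr1 mulN1r addrC.
Qed.

Lemma conv_kernel_marginal2 y : \int[dx]_x W (vec x) = 0 ->
  \int[dx]_x conv_kernel (x, y) = 0.
Proof.
move=> <-; rewrite -(int_affine (fun=> false) (fun i => - vec y 0 i) nW).
apply: eq_Rintegral => x _; congr W; apply/rowP => i.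
by rewrite !mxE expr0 mul1r.
Qed.

Lemma cosineN n (v : 'rV[R]_d) : cosine L n (- v) = cosine L n v.
Proof. by apply: eq_bigr => i _; rewrite mxE tcosN. Qed.

Lemma L1_cosine n : dx.-L1 (fun x => cosine L n (vec x)).
Proof. exact: (pc_L1 (pc_cosine L n)). Qed.

(** Evenness makes the products of cosines eigenfunctions of the convolution. *)
Lemma int_conv_cosine n y :
  \int[dx]_x (conv_kernel (x, y) * cosine L n (vec x)) =
  cos_coeff L W n * cosine L n (vec y).
Proof.
pose h v := W v * cosine L n (affine (fun=> false) (vec y 0) v).
have nh : periodic_continuous L h := pcM nW (pc_affine _ _ (pc_cosine L n)).
rewrite mulrC -cosineN -(int_Wcosine_shift nW W_even).
transitivity (\int[dx]_x h (vec x)).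
  rewrite -(int_affine (fun=> false) (fun i => - vec y 0 i) nh).
  apply: eq_Rintegral => x _; rewrite /h /conv_kernel; congr (_ * _).
    by congr W; apply/rowP => i; rewrite !mxE expr0 mul1r.
  by congr cosine; apply/rowP => i; rewrite !mxE !expr0; ring.
apply: eq_Rintegral => x _; rewrite /h -cosineN; congr (_ * _).
by congr cosine; apply/rowP => i; rewrite !mxE expr0; ring.
Qed.

Lemma bilin_cosine n :
  bilin dx conv_kernel (fun x => cosine L n (vec x)) (fun x => cosine L n (vec x)) =
  cos_coeff L W n * \int[dx]_x cosine L n (vec x) ^+ 2.
Proof.
have [C wC] := conv_kernel_bounded.
have gi := L1_cosine n.
have gm := L1_measurable gi.
have ki y : dx.-L1 (fun x => conv_kernel (x, y) * cosine L n (vec x)).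
  apply: (@L1_mulr _ _ _ _ _ _ C) => //; last by move=> x; exact: wC.2.
  by apply: (measurableT_comp wC.1); exact: pair2_measurable.
rewrite /bilin int_Fubini_swap; last 2 first.
- exact: (bilin_L1 wC gi gi).
- move=> y; have := L1Z (cosine L n (vec y)) (ki y).
  by apply: eq_integrable => // x _ /=; rewrite mulrC.
rewrite -intZ; last first.
  have := L1_mulr gm (fun x => cosine_norm L n (vec x)) gi.
  by apply: eq_integrable => // x _ /=; rewrite expr2.
apply: eq_Rintegral => y _.
transitivity (\int[dx]_x (cosine L n (vec y) * (conv_kernel (x, y) * cosine L n (vec x)))).
  by apply: eq_Rintegral => x _ /=; rewrite [RHS]mulrC.
by rewrite intZ// int_conv_cosine expr2; ring.
Qed.

Lemma L1_cosine_sqr n : dx.-L1 (fun x => cosine L n (vec x) ^+ 2).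
Proof.
have gi := L1_cosine n; have gm := L1_measurable gi.
have := L1_mulr gm (fun x => cosine_norm L n (vec x)) gi.
by apply: eq_integrable => // x _ /=; rewrite expr2.
Qed.

Lemma vecE (x : points R d) i : vec x 0 i = tnth x i.
Proof. by rewrite mxE. Qed.

Lemma int_cosine n : (exists i, n i != 0) -> \int[dx]_x cosine L n (vec x) = 0.
Proof.
move=> [i ni]; rewrite /cosine; under eq_Rintegral do under eq_bigr do rewrite vecE.
rewrite (@int_torus_prod R L d (fun i => tcos L (n i)) 1).
- by rewrite (bigD1 i)//= int_tcos (negbTE ni) mul0r.
- by move=> j; exact: measurable_tcos.
- by move=> j t; exact: tcos_norm.
Qed.

Lemma int_cosine_sqr_gt0 n : 0 < \int[dx]_x cosine L n (vec x) ^+ 2.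
Proof.
rewrite /cosine; under eq_Rintegral do rewrite -prodrXl.
under eq_Rintegral do under eq_bigr do rewrite vecE.
rewrite (@int_torus_prod R L d (fun i t => tcos L (n i) t ^+ 2) 1).
- apply: prodr_gt0 => i _.
  have -> : (fun t => tcos L (n i) t ^+ 2) = (fun t => 2^-1 * (1 + tcos L (n i *+ 2) t)).
    apply/funext => t.
    have -> : tcos L (n i *+ 2) t = tcos L (n i) t ^+ 2 *+ 2 - 1.
      by rewrite /tcos -cos_mulr2n; congr cos; rewrite rmorphMn/= !mulr2n; ring.
    by field.
  have c1 : (circle_measure L).-L1 (fun=> 1 : R) by exact: L1_cst.
  rewrite intZ; last by apply: L1D => //; exact: L1_tcos.
  rewrite intD//; last exact: L1_tcos.
  rewrite circle_int_cst int_tcos mul1r mulr_gt0// .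
  by case: ifP => _; [exact: addr_gt0|rewrite addr0].
- by move=> i; apply: measurable_funX; exact: measurable_tcos.
- by move=> i t; rewrite normrX expr_le1//; exact: tcos_norm.
Qed.

End convolution_kernel.

(** * Trigonometric approximation of the convolution kernel *)

Section fejer_approximation.
Context {R : realType} (L : {posnum R}) (d : nat) (W : 'rV[R]_d -> R).
Local Notation dx := (torus_measure L d).
Hypotheses (nW : periodic_continuous L W) (W_even : coordinatewise_even W).

Let Kf N (v : 'rV[R]_d) := \prod_i fejer L N (v 0 i).

Let freq N (F : {ffun 'I_d -> 'I_N.+1 * 'I_N.+1}) (i : 'I_d) : int :=
  (F i).1%:Z - (F i).2%:Z.

Let Kf_expand N v : Kf N v = N.+1%:R ^- d *
  \sum_(F : {ffun 'I_d -> 'I_N.+1 * 'I_N.+1}) cosine L (freq F) v.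
Proof.
rewrite /Kf /fejer big_split/= prodr_const card_ord exprVn; congr (_ * _).
exact: (bigA_distr_bigA (fun i (p : 'I_N.+1 * 'I_N.+1) => tcos L (p.1%:Z - p.2%:Z) (v 0 i))).
Qed.

Let Kf_ge0 N v : 0 <= Kf N v.
Proof. by apply: prodr_ge0 => i _; exact: fejer_ge0. Qed.

Let L1_Kf N : dx.-L1 (fun x => Kf N (vec x)).
Proof.
rewrite /Kf; under [X in dx.-L1 X]eq_fun do under eq_bigr do rewrite vecE.
apply: (@L1_torus_prod R L d (fun=> fejer L N) N.+1%:R).
- by move=> i; exact: measurable_fejer.
- by move=> i t; exact: fejer_norm.
Qed.

Let int_Kf N : \int[dx]_x Kf N (vec x) = L%:num ^+ d.
Proof.
rewrite /Kf; under eq_Rintegral do under eq_bigr do rewrite vecE.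
rewrite (@int_torus_prod R L d (fun=> fejer L N) N.+1%:R).
- by rewrite int_fejer prodr_const card_ord.
- by move=> i; exact: measurable_fejer.
- by move=> i t; exact: fejer_norm.
Qed.

Let Kf_moment N i :
  dx.-L1 (fun x => Kf N (vec x) * (1 - tcos L 1 (vec x 0 i))) /\
  \int[dx]_x (Kf N (vec x) * (1 - tcos L 1 (vec x 0 i))) <= L%:num ^+ d / N.+1%:R.
Proof.
pose g j t := fejer L N t * (if j == i then 1 - tcos L 1 t else 1).
have mg j : measurable_fun setT (g j).
  rewrite /g; apply: measurable_funM; first exact: measurable_fejer.
  by case: (j == i) => //; apply: measurable_funB => //; exact: measurable_tcos.
have gC j t : `|g j t| <= N.+1%:R * 2.
  rewrite normrM ler_pM ?fejer_norm//; case: ifP => _; rewrite ?normr1 ?ler1n//.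
  by rewrite (le_trans (ler_normB _ _))// normr1 -[leRHS]/(1 + 1 : R) lerD2l tcos_norm.
have E : (fun x : points R d => Kf N (vec x) * (1 - tcos L 1 (vec x 0 i))) =
    (fun x => \prod_j g j (tnth x j)).
  apply/funext => x; rewrite /g big_split/= -big_mkcond/= big_pred1_eq vecE.
  by congr (_ * _); apply: eq_bigr => j _; rewrite vecE.
rewrite E; split; first exact: (L1_torus_prod L mg gC).
rewrite (int_torus_prod L mg gC).
rewrite -[X in _ ^+ X](card_ord d) -prodr_const (bigD1 i)//= [X in _ <= X / _](bigD1 i)//=.
rewrite mulrAC; apply: ler_pM => //.
- apply: int_ge0 => t; rewrite /g eqxx mulr_ge0 ?fejer_ge0// subr_ge0; exact: cos_le1.
- apply: prodr_ge0 => j ji; apply: int_ge0 => t.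
  by rewrite /g (negbTE ji) mulr1 fejer_ge0.
- by rewrite /g eqxx; exact: int_fejer_moment.
- rewrite le_eqVlt; apply/orP; left; apply/eqP; apply: eq_bigr => j ji.
  by rewrite /g (negbTE ji); under eq_Rintegral do rewrite mulr1; rewrite int_fejer.
Qed.

Let shift_measurable (u : 'rV[R]_d) :
  measurable_fun setT (fun x : points R d => W (u - vec x)).
Proof.
have [_ hc] := nW; apply: (measurable_W hc) => i.
rewrite (_ : (fun x => _) = (fun x : points R d => u 0 i - tnth x i)).
  by apply: measurable_funB => //; exact: measurable_tnth.
by apply/funext => x; rewrite !mxE.
Qed.

(** Korovkin's argument: for a nonnegative kernel, convergence of the total mass
and of the second moments, measured by the gauge of [W_modulus], is enough. *)
Let Kf_approx (e : R) : 0 < e -> exists N, forall u : 'rV[R]_d,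
  `|W u - L%:num ^- d * \int[dx]_x (W (u - vec x) * Kf N (vec x))| <= e.
Proof.
move=> e0; have e2 : 0 < e / 2 by rewrite divr_gt0.
have [hp hc] := nW; have [C _ hC] := W_bounded hp hc.
have [M M0 HM] := W_modulus hp hc e2.
have d0 : 0 < e / 2 / (M * d%:R + 1).
  by rewrite divr_gt0// ltr_wpDl// mulr_ge0.
have [N _ /(_ N (leqnn N)) HN] := near_infty_natSinv_lt (PosNum d0).
rewrite /= in HN; exists N => u.
have L0 : 0 < L%:num ^+ d by rewrite exprn_gt0.
have i1 : dx.-L1 (fun x => W (u - vec x) * Kf N (vec x)).
  by apply: (@L1_mulr _ _ _ _ _ _ C) => //; exact: L1_Kf.
have E : W u - L%:num ^- d * \int[dx]_x (W (u - vec x) * Kf N (vec x)) =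
    L%:num ^- d * \int[dx]_x ((W u - W (u - vec x)) * Kf N (vec x)).
  under [in RHS]eq_Rintegral do rewrite mulrBl.
  rewrite intB//; last exact/L1Z/L1_Kf.
  by rewrite intZ ?int_Kf ?mulrBr 1?mulrCA ?mulVf ?mulr1 ?gt_eqF//; exact: L1_Kf.
have i2 : dx.-L1 (fun x => (W u - W (u - vec x)) * Kf N (vec x)).
  have := L1B (L1Z (W u) (L1_Kf N)) i1.
  by apply: eq_integrable => // x _ /=; rewrite mulrBl.
have i3 : dx.-L1 (fun x => \sum_i Kf N (vec x) * (1 - tcos L 1 (vec x 0 i))).
  by apply: L1_sum => i; have [] := Kf_moment N i.
rewrite E normrM (ger0_norm (ltW _)) ?invr_gt0// ler_pdivrMl//.
apply: le_trans (int_norm i2) _.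
apply: le_trans (_ : \int[dx]_x (e / 2 * Kf N (vec x) +
    M * \sum_i Kf N (vec x) * (1 - tcos L 1 (vec x 0 i))) <= _).
  apply: int_le => [||x]; first exact: L1_norm.
    by apply: L1D; apply: L1Z => //; exact: L1_Kf.
  rewrite normrM (ger0_norm (Kf_ge0 N _)) distrC -mulr_sumr.
  by have := ler_wpM2r (Kf_ge0 N (vec x)) (HM u (vec x)); lra.
rewrite (intD (L1Z (e / 2) (L1_Kf N)) (L1Z M i3)) (intZ _ (L1_Kf N)) (intZ _ i3).
rewrite int_Kf int_sum; last by move=> i; have [] := Kf_moment N i.
have : \sum_i \int[dx]_x (Kf N (vec x) * (1 - tcos L 1 (vec x 0 i))) <=
    \sum_(i < d) L%:num ^+ d / N.+1%:R.
  by apply: ler_sum => i _; have [] := Kf_moment N i.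
rewrite sumr_const card_ord -[X in _ <= X]mulr_natl => /(ler_wpM2l M0) h.
have Md0 : 0 < M * d%:R + 1 by rewrite ltr_wpDl// mulr_ge0.
have : (M * d%:R + 1) * N.+1%:R^-1 <= e / 2.
  by rewrite mulrC -ler_pdivlMr// ltW.
have N0 : 0 < N.+1%:R^-1 :> R by rewrite invr_gt0.
move=> /(ler_wpM2l (ltW L0)).
move: h (mulr_gt0 L0 N0); set S := \sum_i _; clearbody S.
set l : R := L%:num ^+ d; set k : R := N.+1%:R^-1; set D : R := d%:R.
by clearbody l k D; lra.
Qed.

Let int_shift_Kf N (u : 'rV[R]_d) :
  \int[dx]_z (W (u - vec z) * Kf N (vec z)) =
  N.+1%:R ^- d * \sum_F cosine L (freq F) u * cos_coeff L W (@freq N F).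
Proof.
pose h F v := W (affine (fun=> true) (u 0) v) * cosine L (@freq N F) v.
have nh F : periodic_continuous L (h F) := pcM (pc_affine _ _ nW) (pc_cosine L _).
have affE v : affine (fun=> true) (u 0) v = u - v.
  by apply/rowP => i; rewrite !mxE expr1 mulN1r addrC.
transitivity (\int[dx]_z (N.+1%:R ^- d * \sum_F h F (vec z))).
  apply: eq_Rintegral => z _; rewrite Kf_expand mulrCA mulr_sumr; congr (_ * _).
  by apply: eq_bigr => F _; rewrite /h affE.
rewrite intZ; last by apply: L1_sum => F; exact: pc_L1.
rewrite int_sum; last by move=> F; exact: pc_L1.
congr (_ * _); apply: eq_bigr => F _.
rewrite -(int_affine (fun=> true) (u 0) (nh F)) -(int_Wcosine_shift nW W_even).
apply: eq_Rintegral => z _; rewrite /h !affE; congr (W _ * _).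
by rewrite opprB addrC subrK.
Qed.

(** Convolving [W] with a product of Fejer kernels approximates it uniformly and
turns it into a finite sum of cosines weighted by positive multiples of
[cos_coeff]. The addition formula splits each cosine of a difference into
products of sines and cosines of the two variables, all with the same weight;
hence the approximation is diagonal, and it is nonnegative when the cosine
coefficients are. *)
Theorem conv_kernel_finite_rank (P : R -> Prop) :
  (forall n a, 0 <= a -> P (a * cos_coeff L W n)) ->
  finite_rank_approx P (conv_kernel W).
Proof.
move=> HP e e0; have [N HN] := Kf_approx e0.
pose a : R := L%:num ^- d * N.+1%:R ^- d.
have a0 : 0 <= a by rewrite mulr_ge0// invr_ge0 exprn_ge0.
pose J := ({ffun 'I_d -> 'I_N.+1 * 'I_N.+1} * {ffun 'I_d -> bool})%type.
pose f (j : J) i t := (if j.2 i then tsin else tcos) L (freq j.1 i) t.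
exists J, (fun j : J => a * cos_coeff L W (freq j.1)),
  (fun j (x : points R d) => \prod_i f j i (tnth x i)); split.
- by move=> j; exact: HP.
- move=> j; apply: (measurable_prod_tnth (g := f j)) => i.
  by rewrite /f; case: (j.2 i); [exact: measurable_tsin|exact: measurable_tcos].
- move=> j x; rewrite normr_prod; apply: prodr_ile1 => i _; rewrite normr_ge0/=.
  by rewrite /f; case: (j.2 i); [exact: tsin_norm|exact: tcos_norm].
move=> x y; apply: le_trans (HN (vec x - vec y)).
rewrite le_eqVlt; apply/orP; left; apply/eqP; congr `|_ - _|.
have -> : \int[dx]_z (W (vec x - vec y - vec z) * Kf N (vec z)) =
    N.+1%:R ^- d * \sum_F cosine L (freq F) (vec x - vec y) * cos_coeff L W (@freq N F).
  exact: int_shift_Kf.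
rewrite mulrA -/a mulr_sumr.
rewrite -(pair_bigA _ (fun F s => a * cos_coeff L W (freq F) *
   (\prod_i f (F, s) i (tnth x i) * \prod_i f (F, s) i (tnth y i))))/=.
apply: eq_bigr => F _.
rewrite -mulr_sumr (mulrC (cosine _ _ _)) mulrA; congr (_ * _).
pose g i (b : bool) := (if b then tsin else tcos) L (freq F i) (tnth x i) *
  (if b then tsin else tcos) L (freq F i) (tnth y i).
symmetry; transitivity (\prod_i \sum_b g i b).
  rewrite /cosine; apply: eq_bigr => i _.
  by rewrite !mxE tcosB big_bool/= addrC.
by rewrite bigA_distr_bigA; apply: eq_bigr => s _; rewrite -big_split.
Qed.

End fejer_approximation.

(** * Fourier coefficients *)

Section fourier_coefficients.
Context {R : realType} (L : {posnum R}) (d : nat) (W : 'rV[R]_d -> R).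
Local Notation dx := (torus_measure L d).
Hypotheses (nW : periodic_continuous L W) (W_even : coordinatewise_even W).
Implicit Types k : 'rV[int]_d.

Let L0 : 0 < L%:num `^ (- (d%:R / 2)).
Proof. exact: powR_gt0. Qed.

Lemma Theta_gt0 k : 0 < Theta (R := R) k.
Proof.
apply: prodr_gt0 => i _; rewrite sqrtr_gt0 subr_gt0.
by case: (_ == _) => /=; rewrite ?ltr0n// ltr1n.
Qed.

Lemma fourier_coeff_nonneg k : (forall i, 0 <= k 0 i) ->
  fourier_coeff L W k = L%:num `^ (- (d%:R / 2)) * Theta k * cos_coeff L W (k 0).
Proof.
move=> k0; rewrite /fourier_coeff /cos_coeff -intZ; last first.
  exact: (pc_L1 (pcM nW (pc_cosine L (k 0)))).
apply: eq_Rintegral => x _; rewrite /fourier_basis mulrCA; congr (_ * (_ * _)).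
apply: eq_bigr => i _; rewrite /fourier_basis1; case: ltgtP => [//|ki|ki].
- by have := k0 i; rewrite leNgt ki.
- by rewrite -ki tcos0.
Qed.

(** A negative frequency is a sine, which is odd under reflection of that
coordinate while the potential is even. So stability only concerns cosines. *)
Lemma fourier_coeff_neg k : (exists i, k 0 i < 0) -> fourier_coeff L W k = 0.
Proof.
move=> [i ki]; pose b j := j == i.
have fb_period n t : fourier_basis1 L n (t + L%:num) = fourier_basis1 L n t.
  rewrite /fourier_basis1; have c := tcos_period L n t 1; have s := tsin_period L n t 1.
  by rewrite mulr1 in c s; case: ifP => // _; case: ifP.
have fb_cont n : continuous (fourier_basis1 L n : R -> R).
  rewrite (_ : fourier_basis1 L n = if 0 < n then tcos L n else
    if n == 0 then fun=> 1 else tsin L n).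
    case: ifP => _; first exact: continuous_tcos.
    by case: ifP => _; [move=> t; exact: cvg_cst|exact: continuous_tsin].
  by apply/funext => t; rewrite /fourier_basis1; case: ifP => // _; case: ifP.
pose g (v : 'rV[R]_d) := \prod_j fourier_basis1 L (k 0 j) (v 0 j).
have ng : periodic_continuous L g.
  by apply: (pc_prod (f := fun j => fourier_basis1 L (k 0 j))) => // j; exact: fb_cont.
have nWg := pcM nW ng.
have E : fourier_coeff L W k =
    L%:num `^ (- (d%:R / 2)) * Theta k * \int[dx]_x (W (vec x) * g (vec x)).
  rewrite /fourier_coeff -intZ; last exact: (pc_L1 nWg).
  by apply: eq_Rintegral => x _; rewrite /fourier_basis mulrCA.
have flip : \int[dx]_x (W (vec x) * g (vec x)) =
    - \int[dx]_x (W (vec x) * g (vec x)).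
  rewrite -[LHS](int_affine b (fun=> 0) nWg) -mulN1r -intZ; last exact: (pc_L1 nWg).
  apply: eq_Rintegral => x _; rewrite W_flip// mulrCA; congr (_ * _).
  rewrite /g (bigD1 i)//= [in RHS](bigD1 i)//= mulrA; congr (_ * _).
    rewrite mxE addr0 /b eqxx expr1 mulN1r /fourier_basis1.
    by rewrite ltNge (ltW ki) lt_eqF//= -[LHS]/(tsin L _ _) tsinN mulN1r.
  by apply: eq_bigr => j ji; rewrite mxE addr0 /b (negbTE ji) expr0 mul1r.
by rewrite E (_ : \int[dx]_x _ = 0) ?mulr0//; lra.
Qed.

Lemma cos_coeff_abs n : cos_coeff L W (fun i => `|n i|%:Z) = cos_coeff L W n.
Proof.
apply: eq_Rintegral => x _; congr (_ * _); apply: eq_bigr => i _.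
case: (n i) => m; first by rewrite absz_nat.
rewrite NegzE abszN absz_nat /tcos -[RHS]cosN; congr cos.
by rewrite rmorphN/=; ring.
Qed.

Lemma H_stable_cos_coeff_ge0 : mean_zero L W -> H_stable L W -> forall n, 0 <= cos_coeff L W n.
Proof.
move=> W0 HW n; rewrite -cos_coeff_abs.
pose k : 'rV[int]_d := \row_i `|n i|%:Z.
have kE : k 0 = fun i => `|n i|%:Z by apply/funext => i; rewrite mxE.
have [k0|k0] := eqVneq k 0.
  have -> : cos_coeff L W (fun i => `|n i|%:Z) = \int[dx]_x W (vec x).
    apply: eq_Rintegral => x _; rewrite /cosine big1 ?mulr1// => i _.
    by have /rowP/(_ i) := k0; rewrite !mxE => ->; rewrite tcos0.
  by rewrite W0.
have := HW k k0; rewrite fourier_coeff_nonneg; last by move=> i; rewrite mxE.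
by rewrite kE pmulr_rge0// mulr_gt0// Theta_gt0.
Qed.

Lemma cos_coeff_half_shift n i :
  let a j := if j == i then L%:num / (2 * (n i)%:~R) else 0 in
  let f x := (W (vec x) - W (affine (fun=> false) a (vec x))) * cosine L n (vec x) in
  n i != 0 -> dx.-L1 f /\ 2 * cos_coeff L W n = \int[dx]_x f x.
Proof.
move=> a f ni.
pose h v := W (affine (fun=> false) a v) * cosine L n v.
have nh : periodic_continuous L h := pcM (pc_affine _ _ nW) (pc_cosine L n).
have ng : periodic_continuous L (fun v => W v * cosine L n v) := pcM nW (pc_cosine L n).
have E : cos_coeff L W n = - \int[dx]_x h (vec x).
  rewrite /cos_coeff -(int_affine (fun=> false) a ng) -mulN1r -intZ; last exact: pc_L1.
  apply: eq_Rintegral => x _; rewrite /h mulrCA; congr (_ * _).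
  rewrite /cosine (bigD1 i)//= [in RHS](bigD1 i)//= mulrA; congr (_ * _).
    by rewrite mxE expr0 mul1r /a eqxx tcos_half_period// mulN1r.
  by apply: eq_bigr => j ji; rewrite mxE expr0 mul1r /a (negbTE ji) addr0.
have fE : f = fun x => W (vec x) * cosine L n (vec x) - h (vec x).
  by apply/funext => x; rewrite /f mulrBl.
rewrite fE; split; first exact: (L1B (pc_L1 ng) (pc_L1 nh)).
by rewrite (intB (pc_L1 ng) (pc_L1 nh)) -[X in _ = X - _]/(cos_coeff L W n); lra.
Qed.

(** Riemann-Lebesgue in one coordinate: a shift by half a period changes the sign
of the cosine, and moves [W] little when the frequency is large. *)
Lemma cos_coeff_small (e : R) : 0 < e -> exists B : nat,
  forall n, (exists i, B%:Z <= n i) -> `|cos_coeff L W n| <= e.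
Proof.
move=> e0; have [hp hc] := nW.
pose l : R := L%:num ^+ d.
have l0 : 0 < l by rewrite exprn_gt0.
have el0 : 0 < e / l by rewrite divr_gt0.
have [M M0 HM] := W_modulus hp hc el0.
have eM : 0 < e / (l * (M + 1)) by rewrite divr_gt0// mulr_gt0//; lra.
have c0 : tcos L 1 @ (0 : R) --> tcos L 1 0 by exact: continuous_tcos.
have /cvgrPdist_lt/(_ _ eM)/nbhs_ballP[r /= r0 Hr] := c0.
have [B HB] : exists B : nat, L%:num / r < B%:R.
  exists `|Num.floor (L%:num / r)|.+1; rewrite -natr1 natr_absz ger0_norm ?floor_ge0 ?divr_ge0 ?(ltW r0)//.
  by have /andP[_] := floor_itv (L%:num / r); rewrite intrD.
exists B => n [i Bi].
have B0 : (0 : R) < B%:R by apply: lt_trans HB; rewrite divr_gt0.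
have ni : (B%:R : R) <= (n i)%:~R by rewrite -(ler_int R) in Bi.
have ni0 : n i != 0.
  by apply: contraTneq ni => ->; rewrite -ltNge.
set t : R := L%:num / (2 * (n i)%:~R).
have tr : `|t| < r.
  rewrite ger0_norm ?divr_ge0 ?mulr_ge0//; last lra.
  move: HB; rewrite /t !ltr_pdivrMr//; last lra.
  by move=> h; apply: lt_le_trans h _; rewrite mulrC ler_pM2l//; lra.
have ct : 1 - tcos L 1 t < e / (l * (M + 1)).
  have := Hr t; rewrite /ball/= sub0r normrN => /(_ tr).
  by rewrite (_ : tcos L 1 0 = 1) ?ltr_norml 1?andbC; [case/andP|rewrite /tcos mulr0 mul0r cos0].
have ct0 : 0 <= 1 - tcos L 1 t by rewrite subr_ge0 cos_le1.
have [] := cos_coeff_half_shift ni0; rewrite -/t.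
set a := affine _ _ => L1f gE.
have bound (x : points R d) : `|(W (vec x) - W (a (vec x))) * cosine L n (vec x)| <= e / l * 2.
  rewrite normrM -[leRHS]mulr1 ler_pM ?cosine_norm//.
  have -> : a (vec x) = vec x - \row_j (if j == i then - t else 0).
    by apply/rowP => j; rewrite !mxE expr0 mul1r; case: ifP => _; rewrite ?opprK ?oppr0.
  rewrite distrC (le_trans (HM _ _))// mulr2n mulrDr mulr1 lerD2l.
  rewrite (bigD1 i)//= mxE eqxx tcosN big1 ?addr0 => [|j ji]; last first.
    by rewrite mxE (negbTE ji) /tcos mulr0 mul0r cos0 subrr.
  have : M * (1 - tcos L 1 t) <= M * (e / (l * (M + 1))) by rewrite ler_wpM2l// ltW.
  move=> h; apply: le_trans h _.
  have -> : M * (e / (l * (M + 1))) = e / l * (M / (M + 1)).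
    by field; apply/andP; split; lra.
  by apply: ler_piMr; [exact: ltW|rewrite ler_pdivrMr; lra].
have L1c : dx.-L1 (fun=> e / l * 2) by exact: L1_cst.
have := int_norm L1f; rewrite -gE normrM (@ger0_norm _ 2)// => h.
have : \int[dx]_x `|(W (vec x) - W (a (vec x))) * cosine L n (vec x)| <=
    \int[dx]_x (e / l * 2).
  by apply: int_le => //; exact: L1_norm.
have -> : \int[dx]_x (e / l * 2) = 2 * e.
  rewrite Rintegral_cst// [X in fine X]torus_measureT/= -/l.
  by field; rewrite gt_eqF.
lra.
Qed.

(** Instability gives one negative cosine coefficient; those at most as large have
bounded frequencies by [cos_coeff_small], and among finitely many there is a
smallest. *)
Lemma cos_coeff_min : ~ H_stable L W -> exists k,
  [/\ forall i, 0 <= k 0 i, k != 0, cos_coeff L W (k 0) < 0 &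
      forall k', (forall i, 0 <= k' 0 i) -> k' != 0 -> cos_coeff L W (k 0) <= cos_coeff L W (k' 0)].
Proof.
move=> nH.
have [k0 [k0_ge0 k0_neq0 k0_lt0]] : exists k0,
    [/\ forall i, 0 <= k0 0 i, k0 != 0 & cos_coeff L W (k0 0) < 0].
  have /existsNP[k /not_implyP[kn0 /negP]] := nH; rewrite -ltNge => hk.
  have [[i ki]|kpos] := pselect (exists i, k 0 i < 0).
    by move: hk; rewrite fourier_coeff_neg ?ltxx//; exists i.
  have k0 i : 0 <= k 0 i by rewrite leNgt; apply/negP => ki; apply: kpos; exists i.
  exists k; split => //; move: hk; rewrite fourier_coeff_nonneg// pmulr_rlt0//.
  by rewrite mulr_gt0// Theta_gt0.
have e0 : 0 < - cos_coeff L W (k0 0) / 2 by lra.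
have [B HB] := cos_coeff_small e0.
have big k : cos_coeff L W (k 0) <= cos_coeff L W (k0 0) -> forall i, k 0 i < B%:Z.
  move=> kk0 i; rewrite ltNge; apply/negP => Bi.
  have := HB (k 0) (ex_intro _ i Bi); rewrite ler_norml => /andP[]; lra.
pose row (F : {ffun 'I_d -> 'I_B.+1}) : 'rV[int]_d := \row_i (F i)%:Z.
have row_onto k : (forall i, 0 <= k 0 i) -> (forall i, k 0 i < B%:Z) -> exists F, k = row F.
  move=> kge klt; exists [ffun i : 'I_d => inord (absz (k 0 i))].
  apply/rowP => i; rewrite !mxE ffunE inordK; first by rewrite gez0_abs.
  by have := klt i; have := kge i; lia.
have [F0 F0E] := row_onto _ k0_ge0 (big k0 (lexx _)).
have PF0 : row F0 != 0 by rewrite -F0E.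
case: (@Order.TotalTheory.arg_minP _ _ _ F0 (fun F => row F != 0)
  (fun F => cos_coeff L W (row F 0)) PF0) => F PF Fmin.
exists (row F); split => //.
- by move=> i; rewrite mxE.
- by apply: le_lt_trans k0_lt0; rewrite F0E; exact: Fmin.
move=> k kge kn0; have [h|h] := leP (cos_coeff L W (k 0)) (cos_coeff L W (k0 0)).
  have [Fk FkE] := row_onto _ kge (big k h).
  by rewrite FkE; apply: Fmin; rewrite -FkE.
by apply: le_trans (ltW h); rewrite F0E; exact: Fmin.
Qed.

Lemma fourier_ratios_inf k : (forall i, 0 <= k 0 i) -> k != 0 ->
  (forall k', (forall i, 0 <= k' 0 i) -> k' != 0 -> cos_coeff L W (k 0) <= cos_coeff L W (k' 0)) ->
  [/\ fourier_ratios L W (inf (fourier_ratios L W)),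
      lbound (fourier_ratios L W) (inf (fourier_ratios L W)) &
      inf (fourier_ratios L W) = L%:num `^ (- (d%:R / 2)) * cos_coeff L W (k 0)].
Proof.
move=> k0 kn0 kmin.
have ratioE k' : (forall i, 0 <= k' 0 i) ->
    fourier_coeff L W k' / Theta k' = L%:num `^ (- (d%:R / 2)) * cos_coeff L W (k' 0).
  by move=> ?; rewrite fourier_coeff_nonneg// mulrAC mulfK// gt_eqF// Theta_gt0.
set r := _ * cos_coeff L W (k 0).
have rin : fourier_ratios L W r by exists k => //; exact: ratioE.
have rlb : lbound (fourier_ratios L W) r.
  by move=> _ [k' [/= k'0 k'n0] <-]; rewrite ratioE// ler_pM2l//; exact: kmin.
have -> : inf (fourier_ratios L W) = r.
  apply/eqP; rewrite eq_le ge_inf//=; last by exists r.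
  by apply: lb_le_inf => //; exists r.
by split.
Qed.

End fourier_coefficients.

(** * Probability measures and their densities *)

Section measure_with_density.
Context d (T : measurableType d) (R : realType)
  (mu : {finite_measure set T -> \bar R}) (f : T -> R).
Hypotheses (f0 : forall x, 0 <= f x) (fi : mu.-L1 f) (f1 : \int[mu]_x f x = 1).

(** The hypotheses are arguments so that the probability instance can be attached
to this function. *)
Definition density_measure of (forall x, 0 <= f x) & mu.-L1 f & \int[mu]_x f x = 1 :
  set T -> \bar R := fun A => (\int[mu]_(x in A) (f x)%:E)%E.

Let nu := density_measure f0 fi f1.

Let nu0 : nu set0 = 0%E. Proof. exact: integral_set0. Qed.

Let nu_ge0 A : (0 <= nu A)%E.
Proof. by apply: integral_ge0 => x _; rewrite lee_fin. Qed.

Let nu_additive : semi_sigma_additive nu.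
Proof.
apply: (@semi_sigma_additive_nng_induced _ _ _ mu (EFin \o f)).
  exact: measurable_int fi.
by move=> x; rewrite lee_fin.
Qed.

HB.instance Definition _ := isMeasure.Build _ _ _ nu nu0 nu_ge0 nu_additive.

Let nuT : nu setT = 1%E.
Proof. by rewrite /nu /density_measure -f1 EFin_int. Qed.

HB.instance Definition _ := Measure_isProbability.Build _ _ _ nu nuT.

Lemma exists_probability_with_density : exists P : probability T R,
  forall A, measurable A -> P A = (\int[mu]_(x in A) (f x)%:E)%E.
Proof. by exists nu. Qed.

End measure_with_density.

Section densities.
Context {R : realType} (L : {posnum R}) (d : nat).
Local Notation dx := (torus_measure L d).
Implicit Types (P : probability (points R d) R) (f : points R d -> R).

(** A version of the density that is nonnegative everywhere; the powers and the
integrals of the functional do not depend on the version. *)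
Definition has_density P f := [/\ forall x, 0 <= f x, dx.-L1 f &
  forall A, measurable A -> P A = (\int[dx]_(x in A) (f x)%:E)%E].

Lemma has_density_dominates P f : has_density P f -> P `<< dx.
Proof.
move=> [f0 fi Pf]; apply/null_content_dominatesP => A mA A0.
by rewrite Pf// null_set_integral// ; exact: measurable_funTS (measurable_int dx fi).
Qed.

Lemma dominates_has_density P : P `<< dx -> exists f, has_density P f.
Proof.
move=> Pdx; pose g := Radon_Nikodym_SigmaFinite.f P dx.
have gE x : (fine (g x))%:E = g x.
  by rewrite fineK// Radon_Nikodym_SigmaFinite.f_fin_num.
exists (fun x => fine (g x)); split.
- by move=> x; rewrite fine_ge0// Radon_Nikodym_SigmaFinite.f_ge0.
- have := Radon_Nikodym_SigmaFinite.f_integrable Pdx.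
  by apply: eq_integrable => // x _ /=; rewrite gE.
- move=> A mA; rewrite (Radon_Nikodym_SigmaFinite.f_integral Pdx mA).
  by apply: eq_integral => x _; rewrite gE.
Qed.

Lemma has_density_int1 P f : has_density P f -> \int[dx]_x f x = 1.
Proof.
move=> [f0 fi Pf]; apply: EFin_inj; rewrite EFin_int// -Pf//.
exact: probability_setT.
Qed.

Lemma measurable_torus : measurable (torus L d).
Proof.
have -> : torus L d =
    \bigcap_(i in [set: 'I_d]) ((fun x : points R d => tnth x i) @^-1` `[0, L%:num[).
  apply/seteqP; split => [x Tx i _|x Tx i]; rewrite /= ?in_itv; first exact: Tx.
  by have := Tx i I; rewrite /= in_itv.
apply: fin_bigcap_measurable => // i _; rewrite -[X in measurable X]setTI.
by apply: measurable_tnth => //; exact: measurable_itv.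
Qed.

(** Folding the coordinates preserves the measure and has its range in the
fundamental domain. *)
Lemma torus_measure_torus : dx (torus L d) = dx setT.
Proof.
have pphi (i : 'I_d) : circle_preserving L (fun t => fold L (t + 0)).
  exact: circle_preserving_rot.
rewrite -(torus_preserving pphi measurable_torus); congr (dx _).
apply/seteqP; split => // x _ i; rewrite tnth_mktuple.
exact: fold_itv.
Qed.

Lemma dominates_torus_probability P : P `<< dx -> torus_probability L P.
Proof.
move=> /null_content_dominatesP Pdx; rewrite /torus_probability.
have mT := measurable_torus.
have dxC : dx (~` torus L d) = 0%E.
  have fT : (dx (torus L d) < +oo)%E by rewrite ltey_eq fin_num_measure.
  rewrite -setTD measureD// ?setTI; last by rewrite ltey_eq fin_num_measure.
  by rewrite [X in (_ - X)%E]torus_measure_torus subee// fin_num_measure.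
have PC : P (~` torus L d) = 0%E by apply: Pdx => //; exact: measurableC.
have PU : (P setT = P (torus L d) + P (~` torus L d))%E.
  by rewrite -(setUCr (torus L d)) measureU// ?setICr//; exact: measurableC.
by rewrite PC adde0 in PU; rewrite -PU; exact: probability_setT.
Qed.

Lemma density_ae P f : has_density P f -> {ae dx, forall x, density L P x = f x}.
Proof.
move=> hf; have Pdx := has_density_dominates hf; have [f0 fi Pf] := hf.
have := @integral_ae_eq _ _ _ dx setT measurableT
  (Radon_Nikodym (charge_of_finite_measure P) dx) (EFin \o f).
case=> //.
  move=> A _ mA; rewrite -Radon_Nikodym_integral//.
  by symmetry; exact: Pf.
move=> N [mN N0 hN]; exists N; split => // x /= xN; apply: hN => /=.
by apply: contra_not xN => /(_ I); rewrite /density => <-.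
Qed.

Lemma density_L1 P : P `<< dx -> dx.-L1 (density L P).
Proof.
move=> Pdx; have := @Radon_Nikodym_integrable _ _ _ (charge_of_finite_measure P) dx Pdx.
by apply: eq_integrable => // x _ /=; rewrite /density fineK// Radon_Nikodym_fin_num.
Qed.

Section free_energy_of_density.
Variables (m : R) (W : 'rV[R]_d -> R) (beta : R) (P : probability (points R d) R)
  (f : points R d -> R).
Hypotheses (nW : periodic_continuous L W) (hf : has_density P f).
Let kappa : R := beta^-1 / (m - 1).

Let mfm : measurable_fun setT (fun x => f x `^ m).
Proof.
by case: hf => _ fi _; exact: (measurableT_comp (measurable_powR m) (L1_measurable fi)).
Qed.

Let mrm : measurable_fun setT (fun x => density L P x `^ m).
Proof.
have ri := density_L1 (has_density_dominates hf).
exact: (measurableT_comp (measurable_powR m) (L1_measurable ri)).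
Qed.

Let power_ae : {ae dx, forall x, density L P x `^ m = f x `^ m}.
Proof. by apply: filterS (density_ae hf) => x ->. Qed.

Let power_L1 : dx.-L1 (fun x => density L P x `^ m) <-> dx.-L1 (fun x => f x `^ m).
Proof.
split=> h; apply/integrableP; split; try exact/measurable_EFinP.
  have /integrableP[_] := h; rewrite (ae_eq_integral (fun x => `|(f x `^ m)%:E|%E))//.
  - by apply: measurableT_comp => //; exact/measurable_EFinP.
  - by apply: measurableT_comp => //; exact/measurable_EFinP.
  - by apply: filterS power_ae => x /= -> _.
have /integrableP[_] := h; rewrite (ae_eq_integral (fun x => `|(density L P x `^ m)%:E|%E))//.
- by apply: measurableT_comp => //; exact/measurable_EFinP.
- by apply: measurableT_comp => //; exact/measurable_EFinP.
- by apply: filterS power_ae => x /= -> _.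
Qed.

Lemma free_energy_density : dx.-L1 (fun x => f x `^ m) ->
  free_energy L m W beta P = (energy dx (conv_kernel W) kappa m f - kappa)%:E.
Proof.
move=> fm; have Pdx := has_density_dominates hf; have [f0 fi Pf] := hf.
have ri := density_L1 Pdx; have [C wC] := conv_kernel_bounded nW.
have rm := power_L1.2 fm.
rewrite /free_energy; case: asboolP => [_|]; last first.
  by case; split => //; exact: (bilin_L1 wC ri ri).
congr EFin; rewrite /energy -/kappa.
rewrite (int_ae power_ae mrm mfm).
have -> : \int[(dx \x dx)%E]_z (W (vec z.1 - vec z.2) * density L P z.1 * density L P z.2)
    = bilin dx (conv_kernel W) f f.
  apply/eqP; rewrite -subr_eq0 -normr_le0; apply: le_trans (bilin_diff wC ri fi) _.
  rewrite (_ : \int[dx]_x `|density L P x - f x| = 0) ?mulr0//.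
  rewrite (@int_ae _ _ _ dx _ (fun=> 0)) ?Rintegral_cst ?mul0r//.
  - by apply: filterS (density_ae hf) => x ->; rewrite subrr normr0.
  - exact: (L1_measurable (L1_norm (L1B ri fi))).
ring.
Qed.

Lemma free_energy_infinite : ~ dx.-L1 (fun x => f x `^ m) ->
  free_energy L m W beta P = +oo%E.
Proof.
move=> nfm; rewrite /free_energy; case: asboolP => // -[_ rm _].
by exfalso; apply: nfm; apply/power_L1.
Qed.

End free_energy_of_density.

Lemma finite_free_energy m W beta P : periodic_continuous L W ->
  (free_energy L m W beta P < +oo)%E -> exists2 f, has_density P f & admissible dx m f.
Proof.
move=> nW; have [Pdx|nPdx] := pselect (P `<< dx); last first.
  by rewrite /free_energy; case: asboolP => [[/nPdx]//|]; rewrite ltxx.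
have [f hf] := dominates_has_density Pdx.
have [fm _|nfm] := pselect (dx.-L1 (fun x => f x `^ m)); last first.
  by rewrite (free_energy_infinite W beta hf nfm) ltxx.
by exists f => //; have [f0 fi _] := hf; split => //; exact: (has_density_int1 hf).
Qed.

Lemma admissible_probability m f : admissible dx m f ->
  exists2 P : probability (points R d) R, has_density P f & torus_probability L P.
Proof.
move=> [f0 fi f1 fm]; have [P HP] := exists_probability_with_density f0 fi f1.
have hf : has_density P f by split.
by exists P => //; apply: dominates_torus_probability; exact: has_density_dominates hf.
Qed.

Lemma uniform_has_density :
  has_density (@uniform_measure R L d : probability (points R d) R) (fun=> rho_infty L d).
Proof.
have r0 : 0 <= rho_infty L d by rewrite invr_ge0 exprn_ge0.
split=> // [|A mA]; first exact: L1_cst.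
by rewrite integral_cst.
Qed.

Lemma measure_eq_has_density P (Q : probability (points R d) R) f :
  measure_eq P Q -> has_density P f -> has_density Q f.
Proof. by move=> PQ [f0 fi Pf]; split => // A mA; rewrite -PQ//; exact: Pf. Qed.

Lemma close_densities_measure_eq P (Q : probability (points R d) R) f g :
  has_density P f -> has_density Q g ->
  \int[dx]_x `|f x - g x| = 0 -> measure_eq P Q.
Proof.
move=> [f0 fi Pf] [g0 gi Qg] fg A mA; transitivity (\int[dx]_(x in A) (f x)%:E)%E; first exact: Pf.
transitivity (\int[dx]_(x in A) (g x)%:E)%E; last by symmetry; exact: Qg.
have fgi := L1B fi gi; have mfg := L1_measurable fgi.
have : (\int[dx]_x `|(f x - g x)%:E| = 0)%E by rewrite -[RHS]/(0%:E) -fg EFin_int//; exact: L1_norm.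
move=> /(ae_eq_integral_abs dx measurableT (iffRL (measurable_EFinP _ _) mfg)) ae0.
have mf := measurable_int dx fi; have mg := measurable_int dx gi.
apply: ae_eq_integral => //; [exact: measurable_funTS mf|exact: measurable_funTS mg|].
apply: filterS ae0 => x /= h _; have := h I; rewrite /cst => -[/eqP].
by rewrite subr_eq0 => /eqP ->.
Qed.

End densities.

(** * The phase transition *)

Section phase_transition.
Context {R : realType} (L : {posnum R}) (d : nat) (m : R) (W : 'rV[R]_d -> R).
Hypotheses (m1 : 1 < m) (nW : periodic_continuous L W) (W_even : coordinatewise_even W)
  (W0 : mean_zero L W).
Local Notation dx := (torus_measure L d).
Local Notation w := (conv_kernel W).
Local Notation r := (rho_infty L d).
Local Notation unif := (@uniform_measure R L d : probability (points R d) R).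
Local Notation kappa beta := (beta^-1 / (m - 1)).
Local Notation F := (free_energy L m W).

(** The transition point is the supremum of the inverse temperatures with this
property. *)
Definition uniform_optimal (beta : R) := forall f, admissible dx m f ->
  energy dx w (kappa beta) m (fun=> r) <= energy dx w (kappa beta) m f.

Lemma rho_infty_gt0 : 0 < r.
Proof. by rewrite invr_gt0 exprn_gt0. Qed.

Lemma int_rho_infty : \int[dx]_x r = 1.
Proof. exact: (has_density_int1 (uniform_has_density L d)). Qed.

Lemma marginal1 x : \int[dx]_y w (x, y) = 0.
Proof. exact: conv_kernel_marginal1. Qed.

Lemma marginal2 y : \int[dx]_x w (x, y) = 0.
Proof. exact: conv_kernel_marginal2. Qed.

Lemma uniform_admissible : admissible dx m (fun=> r).
Proof. exact: (admissible_cst m rho_infty_gt0 int_rho_infty). Qed.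

Lemma free_energy_admissible beta P f : has_density L P f -> admissible dx m f ->
  F beta P = (energy dx w (kappa beta) m f - kappa beta)%:E.
Proof. by move=> hf [_ _ _ fm]; exact: free_energy_density. Qed.

Lemma minimiser_density beta P : minimiser L (F beta) P ->
  exists f, [/\ has_density L P f, admissible dx m f &
    forall g, admissible dx m g ->
      energy dx w (kappa beta) m f <= energy dx w (kappa beta) m g].
Proof.
move=> [_ Pmin].
have [|f hf af] := @finite_free_energy R L d m W beta P nW.
  have hu := has_density_dominates (uniform_has_density L d).
  apply: le_lt_trans (Pmin unif (dominates_torus_probability hu)) _.
  by rewrite (free_energy_admissible _ (uniform_has_density L d) uniform_admissible) ltry.
exists f; split => // g ag; have [Q hg tQ] := admissible_probability ag.
have := Pmin Q tQ; rewrite (free_energy_admissible _ hf af) (free_energy_admissible _ hg ag).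
by rewrite lee_fin lerD2r.
Qed.

Lemma density_minimiser beta P f : torus_probability L P -> has_density L P f ->
  admissible dx m f ->
  (forall g, admissible dx m g ->
    energy dx w (kappa beta) m f <= energy dx w (kappa beta) m g) ->
  minimiser L (F beta) P.
Proof.
move=> tP hf af fmin; split => // Q tQ.
have [fQ|] := ltP (F beta Q) +oo%E; last by apply: le_trans; exact: leey.
have [g hg ag] := finite_free_energy nW fQ.
rewrite (free_energy_admissible _ hf af) (free_energy_admissible _ hg ag).
by rewrite lee_fin lerD2r fmin.
Qed.

Lemma uniform_torus : torus_probability L unif.
Proof.
exact: (dominates_torus_probability (has_density_dominates (uniform_has_density L d))).
Qed.

Lemma uniform_minimiserP beta : uniform_optimal beta -> minimiser L (F beta) unif.
Proof.
exact: density_minimiser uniform_torus (uniform_has_density L d) uniform_admissible.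
Qed.

Lemma unique_minimiserP beta :
  uniform_optimal beta ->
  (forall f, admissible dx m f ->
    energy dx w (kappa beta) m f <= energy dx w (kappa beta) m (fun=> r) ->
    \int[dx]_x `|f x - r| = 0) ->
  unique_minimiser L (F beta) unif.
Proof.
move=> opt uniq; split; first exact: uniform_minimiserP.
move=> P /minimiser_density[f [hf af fmin]].
apply: (close_densities_measure_eq hf (uniform_has_density L d)).
by apply: uniq => //; exact: fmin uniform_admissible.
Qed.

Lemma kappa_anti b b' : 0 < b -> b < b' -> kappa b' < kappa b.
Proof.
move=> b0 bb; have m0 : 0 < m - 1 by rewrite subr_gt0.
by rewrite ltr_pM2r ?invr_gt0// ltf_pV2// posrE (lt_trans b0).
Qed.

(** Optimality is inherited by smaller inverse temperatures, where entropy weighs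
more, and becomes strict there. *)
Lemma uniform_optimal_anti b b' : 0 < b -> b < b' -> uniform_optimal b' ->
  unique_minimiser L (F b) unif.
Proof.
move=> b0 bb opt; have [C wC] := conv_kernel_bounded nW.
have kk := kappa_anti b0 bb.
apply: unique_minimiserP.
  exact: (uniform_min_mono wC m1 rho_infty_gt0 int_rho_infty marginal1 (ltW kk) opt).
exact: (uniform_min_unique wC m1 rho_infty_gt0 int_rho_infty marginal1 kk opt).
Qed.

Lemma kappa_onto k : 0 < k -> 0 < (k * (m - 1))^-1 /\ kappa (k * (m - 1))^-1 = k.
Proof.
move=> k0; have m0 : 0 < m - 1 by rewrite subr_gt0.
by rewrite invr_gt0 mulr_gt0// invrK mulfK// gt_eqF.
Qed.

Lemma uniform_optimal_small : exists2 b, 0 < b & uniform_optimal b.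
Proof.
have [C wC] := conv_kernel_bounded nW.
have [k k0 Hk] := uniform_min_large_kappa wC m1 rho_infty_gt0 int_rho_infty marginal1 marginal2.
have [b0 kE] := kappa_onto k0.
by exists (k * (m - 1))^-1 => // f af; rewrite kE; exact: Hk.
Qed.

Lemma uniform_optimal_closed b : 0 < b ->
  (forall b', 0 < b' -> b' < b -> exists2 b'', b' < b'' & uniform_optimal b'') ->
  uniform_optimal b.
Proof.
move=> b0 H; have [C wC] := conv_kernel_bounded nW.
apply: (uniform_min_closed wC m1 rho_infty_gt0 int_rho_infty marginal1) => k bk.
have m0 : 0 < m - 1 by rewrite subr_gt0.
have k0 : 0 < k by apply: lt_trans bk; rewrite divr_gt0// invr_gt0.
have [b'0 kE] := kappa_onto k0.
have [||b'' bb opt] := H (k * (m - 1))^-1 => //.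
  by rewrite invf_plt ?posrE ?mulr_gt0// -ltr_pdivrMr.
rewrite -kE; apply: (uniform_min_mono wC m1 rho_infty_gt0 int_rho_infty marginal1 _ opt).
by apply/ltW/kappa_anti.
Qed.

(** Linear instability. Perturb the constant [r] to [r (1 + e g)], with [g] a
product of cosines. The interaction changes by exactly half of
[r ^ 2 e ^ 2 (cos_coeff L W n) * G], with [G] the integral of [g ^ 2]; the
entropy term changes by at most [kappa r ^ m K e ^ 2 G] for any [K] above
[m (m - 1) / 2] once [e] is small. The hypothesis leaves room for such a [K]
with a negative total. *)
Lemma uniform_not_optimal beta n : 0 < beta -> (exists i, n i != 0) ->
  beta^-1 * m * r `^ m < - (r ^+ 2 * cos_coeff L W n) -> ~ uniform_optimal beta.
Proof.
move=> beta0 n0 hlt opt; have [C wC] := conv_kernel_bounded nW.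
have r0 := rho_infty_gt0; have gt1 := m1.
have m0 : 0 < m - 1 by rewrite subr_gt0.
have k0 : 0 < kappa beta by rewrite divr_gt0// invr_gt0.
set k : R := kappa beta in k0.
have rm0 : 0 < r `^ m by exact: powR_gt0.
set q := cos_coeff L W n in hlt.
(* The constant [K0] makes the total vanish; [K] is halfway to it. *)
pose K0 : R := - (r ^+ 2 * q) / (2 * (k * r `^ m)).
have kr0 : 0 < k * r `^ m by exact: mulr_gt0.
have kr2 : 0 < 2 * (k * r `^ m) by rewrite pmulr_rgt0.
have hK0 : m * (m - 1) / 2 < K0.
  rewrite /K0 ltr_pdivlMr//.
  suff -> : m * (m - 1) / 2 * (2 * (k * r `^ m)) = beta^-1 * m * r `^ m by [].
  by rewrite /k; field; lra.
pose K : R := (m * (m - 1) / 2 + K0) / 2.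
have hK1 : m * (m - 1) / 2 < K by rewrite /K; lra.
have hK2 : k * r `^ m * K + 2^-1 * (r ^+ 2 * q) < 0.
  have : K < K0 by rewrite /K; lra.
  rewrite /K0 ltr_pdivlMr//; lra.
have [s s0 Hs] := powR1D_le_quadratic m1 hK1.
pose e : R := Num.min s (1 / 2).
have e0 : 0 < e by rewrite lt_min s0 divr_gt0.
have es : e <= s by rewrite ge_min lexx.
have e2 : e <= 1 / 2 by rewrite ge_min lexx orbT.
pose g (x : points R d) := cosine L n (vec x).
have g1 x : `|g x| <= 1 by exact: cosine_norm.
have gi : dx.-L1 g by exact: L1_cosine.
have eg x : `|e * g x| <= e by rewrite normrM (gtr0_norm e0) ler_piMr// ltW.
pose f x := r + (r * e) * g x.
have fE x : f x = r * (1 + e * g x) by rewrite /f; ring.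
have pos x : 0 <= 1 + e * g x.
  by have := eg x; rewrite ler_norml => /andP[]; lra.
have ri : dx.-L1 (fun=> r) by exact: L1_cst.
have fi : dx.-L1 f by apply: L1D => //; exact: L1Z.
have f0 x : 0 <= f x by rewrite fE mulr_ge0// ltW.
have f1 : \int[dx]_x f x = 1.
  rewrite intD//; last exact: L1Z.
  by rewrite intZ// int_cosine// mulr0 addr0 int_rho_infty.
have mfm : measurable_fun setT (fun x => f x `^ m).
  exact: (measurableT_comp (measurable_powR m) (L1_measurable fi)).
have fmE x : f x `^ m = r `^ m * (1 + e * g x) `^ m.
  by rewrite fE powRM// ltW.
have fm : dx.-L1 (fun x => f x `^ m).
  apply: (@L1_bounded _ _ _ _ _ (r `^ m * 2 `^ m)) => // x.
  rewrite ger0_norm ?powR_ge0// fmE ler_wpM2l ?powR_ge0// ge0_ler_powR ?nnegrE//; first lra.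
  by have := eg x; rewrite ler_norml => /andP[]; lra.
have af : admissible dx m f by [].
have g2i := L1_cosine_sqr L n.
have := opt f af; rewrite -/k -subr_ge0.
rewrite (energy_excess wC r0 marginal1)//.
have -> : bilin dx w f f = (r * e) ^+ 2 * (q * \int[dx]_x g x ^+ 2).
  by rewrite (bilin_perturbation wC r0 marginal1 marginal2)// bilin_cosine.
have G0 := int_cosine_sqr_gt0 L n; rewrite -/(g _) in G0.
set G := \int[dx]_x g x ^+ 2.
have hS : \int[dx]_x (f x `^ m) - r `^ m * \int[dx]_x (1 : R) <= r `^ m * (K * e ^+ 2 * G).
  have L1one : dx.-L1 (fun=> 1 : R) by exact: L1_cst.
  have i3 : dx.-L1 (fun x => r `^ m * (1 + m * e * g x + K * e ^+ 2 * g x ^+ 2)).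
    by apply/L1Z/L1D; [apply: L1D => //; exact: L1Z|exact: L1Z].
  rewrite lerBlDl; apply: le_trans (_ : \int[dx]_x (r `^ m * (1 + m * e * g x + K * e ^+ 2 * g x ^+ 2)) <= _).
    apply: int_le => // x; rewrite fmE ler_pM2l//.
    by have := Hs _ (le_trans (eg x) es); rewrite exprMn; lra.
  rewrite intZ; last by apply: L1D; [apply: L1D => //; exact: L1Z|exact: L1Z].
  rewrite intD; [|by apply: L1D => //; exact: L1Z|exact: L1Z].
  rewrite intD//; last exact: L1Z.
  by rewrite !intZ// int_cosine// mulr0 addr0 mulrDr.
move=> h.
have : 0 <= e ^+ 2 * G * (k * r `^ m * K + 2^-1 * (r ^+ 2 * q)).
  apply: le_trans h _; have := ler_wpM2l (ltW k0) hS; rewrite exprMn; lra.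
rewrite pmulr_rge0; last by rewrite mulr_gt0// exprn_gt0.
by rewrite leNgt hK2.
Qed.

Lemma uniform_optimal_le_sharp beta : ~ H_stable L W -> 0 < beta ->
  uniform_optimal beta -> beta <= beta_sharp L m W.
Proof.
move=> nH beta0 opt; have [k [kge kn0 klt kmin]] := cos_coeff_min nW W_even nH.
have [_ _ infE] := fourier_ratios_inf nW kge kn0 kmin.
rewrite leNgt; apply/negP => hb; apply: (uniform_not_optimal beta0 _ _ opt (n := k 0)).
  apply/not_existsP => h; move/eqP: kn0; apply; apply/rowP => i; rewrite mxE.
  by apply/eqP; apply: contrapT => /negP; exact: h.
move: hb; rewrite /beta_sharp infE.
have r0 := rho_infty_gt0.
(* With [h ^ 2 = r] all half-integer powers of [r] become rational in [h]. *)
pose h : R := r `^ (1 / 2).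
have -> : L%:num `^ (- (d%:R / 2)) = h.
  by rewrite /h /rho_infty -powR_mulrn// -powRN -powRrM; congr (_ `^ _); field.
set q := cos_coeff L W (k 0) in klt *.
have h0 : 0 < h by exact: powR_gt0.
have h2 : h * h = r.
  by rewrite -powRD ?(gt_eqF r0) ?implybT// -[RHS]powRr1 ?(ltW r0)//; congr (_ `^ _); field.
have -> : r `^ (m - 3 / 2) = r `^ m / (h * r).
  apply: (canRL (mulfK _)); first by rewrite gt_eqF ?mulr_gt0.
  rewrite /h -{3}(powRr1 (ltW r0)) -!powRD ?(gt_eqF r0) ?implybT//.
  by congr (_ `^ _); field.
have hq : 0 < - q by rewrite oppr_gt0.
have -> : - (m * (r `^ m / (h * r)) / (h * q)) = m * r `^ m / (r ^+ 2 * - q).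
  rewrite -h2; move: (_ `^ m) => x; field.
  by rewrite (gt_eqF h0) (lt_eqF klt).
rewrite ltr_pdivrMr; last by rewrite mulr_gt0// exprn_gt0.
by rewrite -mulrN -mulrA ltr_pdivrMl.
Qed.

(** Stability makes the interaction nonnegative, so that the uniform density is
the unique minimiser at every inverse temperature. *)
Lemma no_transition_if_H_stable : H_stable L W -> forall beta_c,
  ~ transition_point L m W beta_c.
Proof.
move=> HW bc [bc0 _ _ H]; have [C wC] := conv_kernel_bounded nW.
have [|P Pmin nPu] := H (bc + 1); first by rewrite ltrDl.
apply: nPu; have [f [hf af fmin]] := minimiser_density Pmin.
apply: (close_densities_measure_eq hf (uniform_has_density L d)).
have b0 : 0 < bc + 1 by rewrite addr_gt0.
have k0 : 0 < kappa (bc + 1) by rewrite divr_gt0 ?invr_gt0// subr_gt0.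
have [_ fi _ _] := af.
have B0 : 0 <= bilin dx w f f.
  apply: bilin_ge0 wC _ fi; apply: (conv_kernel_finite_rank nW W_even) => n a a0.
  by rewrite mulr_ge0// H_stable_cos_coeff_ge0.
have [_] := uniform_min_positive wC m1 rho_infty_gt0 int_rho_infty marginal1 k0 af B0.
by apply; exact: fmin uniform_admissible.
Qed.

Lemma transition_if_not_H_stable : ~ H_stable L W -> exists beta_c,
  [/\ 0 < beta_c, beta_c <= beta_sharp L m W & transition_point L m W beta_c].
Proof.
move=> nH; have [C wC] := conv_kernel_bounded nW.
pose A := [set b | 0 < b /\ uniform_optimal b].
have [b1 b10 opt1] := uniform_optimal_small.
have A0 : A !=set0 by exists b1.
have ubA : ubound A (beta_sharp L m W).
  by move=> b [b0 optb]; exact: uniform_optimal_le_sharp.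
have hA : has_sup A by split => //; exists (beta_sharp L m W).
have bc0 : 0 < sup A.
  by apply: (lt_le_trans b10); exact: (sup_upper_bound hA (conj b10 opt1)).
have below b : 0 < b -> b < sup A -> exists2 b', b < b' & uniform_optimal b'.
  move=> b0 /(sup_gt A0)[b' [b'0 optb'] bb']; by exists b'.
exists (sup A); split => //; first exact: ge_sup.
split => //.
- by move=> b b0 /(below _ b0)[b' bb']; exact: uniform_optimal_anti.
- by apply: uniform_minimiserP; exact: uniform_optimal_closed.
move=> b bcb; have b0 : 0 < b by exact: lt_trans bcb.
have k0 : 0 < kappa b by rewrite divr_gt0 ?invr_gt0// subr_gt0.
have nopt : ~ uniform_optimal b.
  move=> opt; have : b <= sup A by exact: (sup_upper_bound hA (conj b0 opt)).
  by rewrite leNgt bcb.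
have fr : finite_rank_approx (fun=> True) w by exact: (conv_kernel_finite_rank nW W_even).
have [|f af fmin] := energy_minimiser_exists wC m1 k0 fr (mu := dx).
  by exists (fun=> r); exact: uniform_admissible.
have [P hf tP] := admissible_probability af.
exists P; first exact: density_minimiser hf af fmin.
move=> Pu; apply: nopt => g ag; apply: le_trans (fmin g ag).
have hu := measure_eq_has_density Pu hf.
have := free_energy_admissible b hu af.
rewrite (free_energy_admissible b (uniform_has_density L d) uniform_admissible) => -[].
by move/addIr => ->.
Qed.

End phase_transition.

Theorem proposition5p12 (R : realType) (d : nat) (L : {posnum R}) (m : R)
    (W : 'rV[R]_d -> R) (d_gt0 : (0 < d)%N) (m_gt1 : 1 < m)
    (W_periodic : torus_periodic L W)
    (W_C2 : continuously_differentiable 2 W)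
    (W_even : coordinatewise_even W) (W_mean0 : mean_zero L W) :
  (~ H_stable L W ->
     (fourier_ratios L W (inf (fourier_ratios L W)) /\
      lbound (fourier_ratios L W) (inf (fourier_ratios L W))) /\
     exists beta_c : R,
       [/\ 0 < beta_c, beta_c <= beta_sharp L m W &
           transition_point L m W beta_c]) /\
  (~ H_stable L W <-> exists beta_c : R, transition_point L m W beta_c).
Proof.
have nW : periodic_continuous L W by split => //; case: W_C2.
split=> [nH|]; last split=> [nH|[bc tbc] HW].
- split; last exact: transition_if_not_H_stable.
  have [k [kge kn0 _ kmin]] := cos_coeff_min nW W_even nH.
  by have [] := fourier_ratios_inf nW kge kn0 kmin.
- have [bc [_ _ tbc]] := transition_if_not_H_stable m_gt1 nW W_even W_mean0 nH.
  by exists bc.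
- exact: (no_transition_if_H_stable m_gt1 nW W_even W_mean0 HW tbc).
Qed.
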